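(* Let $1<p<\infty$, let $X$ be a Banach space over $\mathbb K$, and let $A\subset\mathbb K$ be closed, convex and bounded. Let $(\Omega,\mathcal F,\mathbb P)$ be a probability space with a filtration $\mathbb F=(\mathcal F_n)_{n\ge0}$, and assume there is a sequence $(r_n)_{n\ge1}$ of independent Rademacher random variables such that $r_n$ is $\mathcal F_n$-measurable and independent of $\mathcal F_{n-1}$ for each $n\ge1$. Let $(a'_n)_{n\ge0}$ be a sequence with values in $\mathrm{Ext}(A)$ such that $(a'_n)_{n\ge N}$ is dense in $\mathrm{Ext}(A)$ for every $N\ge0$. Define the linear operator $T_A$ on $\mathcal M_p^{\mathrm{dis}}(X)$ by $(T_Af)_n=a'_0f_0+\sum_{i=1}^na'_i\,df_i$, $n\ge0$, for each $f=(f_n)_{n\ge0}\in\mathcal M_p^{\mathrm{dis}}(X)$. Then $\|T_A\|_{\mathcal L(\mathcal M_p^{\mathrm{dis}}(X))}=\beta_{p,X}^A$ (both sides possibly infinite).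
   Context: $\mathcal M_p^{\mathrm{dis}}(X)$ is the Banach space of $X$-valued $\mathbb F$-martingales $f=(f_n)_{n\ge0}$ with $f_n\in L^p(\Omega;X)$ for all $n$ and such that $f_\infty=\lim_nf_n$ exists in $L^p(\Omega;X)$, with norm $\|f\|=\|f_\infty\|_{L^p(\Omega;X)}$; $df_n=f_n-f_{n-1}$ for $n\ge1$. A Rademacher variable takes values $\pm1$ with probability $1/2$ each. $\mathrm{Ext}(A)$ is the set of extreme points of $A$. The UMD$_p^A$ constant $\beta_{p,X}^A\in[0,\infty]$ is the least $\beta\ge0$ such that for every martingale difference sequence $(d_n)_{n=1}^N$ in $L^p(\Omega;X)$ (on any probability space) and every deterministic sequence $(\varepsilon_n)_{n=1}^N$ in $A$, $\bigl(\mathbb E\|\sum_n\varepsilon_nd_n\|^p\bigr)^{1/p}\le\beta\bigl(\mathbb E\|\sum_nd_n\|^p\bigr)^{1/p}$. *)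

(* Defs.v *)
From HB Require Import structures.
From mathcomp Require Import all_boot all_order all_algebra.
From mathcomp Require Import all_classical all_reals all_analysis.
From mathcomp.real_closed Require Import complex.
Set Implicit Arguments.
Unset Strict Implicit.
Unset Printing Implicit Defensive.
Import Order.TTheory GRing.Theory Num.Theory.
Import numFieldNormedType.Exports.
Local Open Scope ring_scope.
Local Open Scope classical_set_scope.

Definition scal (R : realType) (c : bool) : numFieldType :=
  if c then (R[i] : numFieldType) else (R : numFieldType).

(* real value of a scalar (the real part; used for norms, which are real) *)
Definition re_scal (R : realType) (c : bool) : scal R c -> R :=
  if c as b return scal R b -> R then (fun z : R[i] => complex.Re z)
  else (fun x : R => x).

Section ScalarSets.
Context {K : numFieldType}.

Definition bounded_scal_set (A : set K) : Prop :=
  exists M : K, forall a, A a -> `|a| <= M.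

Definition extreme_points (A : set K) : set K :=
  [set a | A a /\ forall b b' t, A b -> A b' -> 0 < t < 1 ->
                   a = t * b + (1 - t) * b' -> b = b'].
End ScalarSets.

Section Probability.
Context {R : realType} {d : measure_display} {Omega : measurableType d}.
Variable P : probability Omega R.

Definition is_filtration (F : nat -> set (set Omega)) : Prop :=
  [/\ forall n, sigma_algebra setT (F n),
      forall n, F n `<=` measurable
    & forall n m, (n <= m)%N -> F n `<=` F m].

Definition rv_measurable_wrt (G : set (set Omega)) (g : Omega -> R) : Prop :=
  forall B : set R, measurable B -> G (g @^-1` B).

Definition is_rademacher (g : Omega -> R) : Prop :=
  measurable_fun setT g /\
  P (g @^-1` [set 1]) = (2^-1)%:E /\ P (g @^-1` [set -1]) = (2^-1)%:E.

Definition indep_of_sigma (G : set (set Omega)) (g : Omega -> R) : Prop :=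
  forall B : set R, measurable B -> forall C, G C ->
    P (g @^-1` B `&` C) = (P (g @^-1` B) * P C)%E.

Definition mutually_independent_pos (r : nat -> Omega -> R) : Prop :=
  forall (s : seq nat) (B : nat -> set R),
    uniq s -> all (fun i => (0 < i)%N) s -> (forall i, measurable (B i)) ->
    P (\bigcap_(i in [set` s]) (r i @^-1` B i)) =
    (\prod_(i <- s) P (r i @^-1` B i))%E.

Definition rademacher_adapted (F : nat -> set (set Omega)) (r : nat -> Omega -> R)
  : Prop :=
  mutually_independent_pos r /\
  forall n, (0 < n)%N ->
    [/\ is_rademacher (r n), rv_measurable_wrt (F n) (r n)
      & indep_of_sigma (F n.-1) (r n)].

Section Bochner.
Context {c : bool} {X : normedModType (scal R c)}.
Local Notation K := (scal R c).

Definition simple_wrt (G : set (set Omega)) (g : Omega -> X) : Prop :=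
  finite_set (range g) /\ forall x : X, G (g @^-1` [set x]).

Definition strongly_measurable_wrt (G : set (set Omega)) (f : Omega -> X) : Prop :=
  exists s : nat -> Omega -> X, (forall k, simple_wrt G (s k)) /\
    forall w, (fun k => s k w) @ \oo --> f w.

Definition Lpn (p : R) (f : Omega -> X) : \bar R :=
  Lnorm P p%:E (fun w => (re_scal `|f w|)%:E).

Definition in_Lp (p : R) (f : Omega -> X) : Prop :=
  strongly_measurable_wrt measurable f /\ (Lpn p f < +oo)%E.

(* continuous real-linear functionals X -> R (additivity + continuity) *)
Definition real_functional (psi : X -> R) : Prop :=
  (forall x y, psi (x + y) = psi x + psi y) /\ continuous psi.

(* X-valued L^p-martingale w.r.t. F: f_n in L^p(Omega,F_n;X) and
   E[f_n | F_{n-1}] = f_{n-1}, expressed weakly:  int_B psi(f_n) = int_B psi(f_{n-1})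
   for all B in F_{n-1} and all continuous real functionals psi. *)
Definition Lp_martingale (F : nat -> set (set Omega)) (p : R)
  (f : nat -> Omega -> X) : Prop :=
  (forall n, in_Lp p (f n) /\ strongly_measurable_wrt (F n) (f n)) /\
  forall n, (0 < n)%N -> forall psi, real_functional psi ->
    forall B, F n.-1 B ->
      (\int[P]_(w in B) (psi (f n w))%:E = \int[P]_(w in B) (psi (f n.-1 w))%:E)%E.

Definition Lp_limit (p : R) (f : nat -> Omega -> X) (g : Omega -> X) : Prop :=
  in_Lp p g /\ (fun n => Lpn p (fun w => f n w - g w)) @ \oo --> 0%E.

Definition Mdis (F : nat -> set (set Omega)) (p : R) (f : nat -> Omega -> X) : Prop :=
  Lp_martingale F p f /\ exists g, Lp_limit p f g.

Definition TA (a : nat -> K) (f : nat -> Omega -> X) : nat -> Omega -> X :=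
  fun n w => a 0%N *: f 0%N w + \sum_(1 <= i < n.+1) a i *: (f i w - f i.-1 w).

Definition opnorm_TA (F : nat -> set (set Omega)) (p : R) (a : nat -> K) : \bar R :=
  ereal_sup [set z | exists f, Mdis F p f /\
     (exists g, Lp_limit p f g /\ (Lpn p g <= 1)%E) /\
     ((exists h, Lp_limit p (TA a f) h /\ z = Lpn p h) \/
      (~ Mdis F p (TA a f) /\ z = +oo%E))].
End Bochner.
End Probability.

Section UMD.
Context {R : realType} {c : bool} {X : normedModType (scal R c)}.
Local Notation K := (scal R c).

Definition Lp_mds {d : measure_display} {Omega : measurableType d}
  (Q : probability Omega R) (G : nat -> set (set Omega)) (p : R)
  (dd : nat -> Omega -> X) (N : nat) : Prop :=
  is_filtration G /\
  forall n, (1 <= n <= N)%N ->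
    [/\ in_Lp Q p (dd n), strongly_measurable_wrt (G n) (dd n)
      & forall psi, real_functional psi -> forall B, G n.-1 B ->
          (\int[Q]_(w in B) (psi (dd n w))%:E = 0)%E].

Definition UMD_A_ineq (p : R) (A : set K) (b : R) : Prop :=
  forall (d : measure_display) (Omega : measurableType d) (Q : probability Omega R)
    (G : nat -> set (set Omega)) (dd : nat -> Omega -> X) (N : nat) (eps : nat -> K),
    Lp_mds Q G p dd N -> (forall n, (1 <= n <= N)%N -> A (eps n)) ->
    (Lpn Q p (fun w => (\sum_(1 <= n < N.+1) eps n *: dd n w)%R)
      <= b%:E * Lpn Q p (fun w => (\sum_(1 <= n < N.+1) dd n w)%R))%E.

(* beta^A_{p,X} in [0,+oo] (inf of the empty set is +oo) *)
Definition beta_A (p : R) (A : set K) : \bar R :=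
  ereal_inf [set b%:E | b in [set b : R | 0 <= b /\ UMD_A_ineq p A b]].
End UMD.

(* Main.v *)
(** Upper bound: the UMD inequality applied to the differences of f shows that T_A f is
    Cauchy whenever f converges.  The term f_0 is not a difference; multiplying the whole
    martingale (up to time N) by the sign of the coin tossed at time N+1 turns it into one
    without changing any norm.

    Lower bound, C being the operator norm: put W(x, y) = |y|^p - C^p |x|^p and consider
    finite binary trees which from a state (x, y) move to (x + v, y + e v) or
    (x - v, y - e v), with e an extreme point of A.  Such a tree is realised, up to a small
    error, as a martingale for the given filtration: a step with multiplier e is made at a
    time n with a_n close to e, using r_n as the coin.  Hence trees started at (0, 0) have
    nonpositive mean gain.  The supremum of mean gains over trees is midpoint concave in
    the directions (v, e v), so Jensen's inequality extends the estimate to martingale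
    differences with finitely many values, and density to all of L^p.  Finally the norm of
    sum eps_i d_i is convex in each eps_i, so its maximum over A is attained at an extreme
    point. *)

Require Import Defs.
From HB Require Import structures.
From mathcomp Require Import all_boot all_order all_algebra.
From mathcomp Require Import finmap.
From mathcomp Require Import all_classical all_reals all_analysis.
From mathcomp.real_closed Require Import complex.
From mathcomp Require Import measurable_realfun ring lra.
Import Order.TTheory GRing.Theory Num.Theory.
Import numFieldNormedType.Exports.
Local Open Scope ring_scope.
Local Open Scope classical_set_scope.
Set Implicit Arguments.
Unset Strict Implicit.
Unset Printing Implicit Defensive.

(** * Scalars and real-valued norms *)

Section Scalars.
Context {R : realType}.

(** The martingale property is given weakly, through continuous real functionals. Vector identities,
    such as a vanishing average, are recovered from it by a norming functional, built with Zorn's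
    lemma by treating [X] as a real space over either scalar field. The supremum of gains over trees
    could a priori be infinite or discontinuous, so it is never formed: [zigzag] relates a state to
    the values of its trees, and concavity becomes a rule for merging trees. Merging at midpoints
    produces only dyadic weights. Other weights are rounded, and the lost mass is paid for by the
    local lower bound of W, at an arbitrarily small loss per step. The given multipliers merely
    approximate [e]. A finite tree is therefore fixed before any time is chosen, and its nodes
    decide how close each multiplier must be. Density of every tail of the sequence then provides a
    suitable time later than those already used; at all other times the martingale stands still.
    Martingales made from trees start at 0, so the factor of f_0 matters only in the upper bound. *)

Definition real_scal (c : bool) : R -> scal R c :=
  if c as b return R -> scal R b then (fun x => x%:C%C) else (fun x : R => x).

Lemma re_scalK c : cancel (@real_scal c) (@re_scal R c).
Proof. by case: c. Qed.

Lemma re_scalD c (x y : scal R c) : re_scal (x + y) = re_scal x + re_scal y.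
Proof. by case: c x y => //= -[? ?] [? ?]. Qed.

Lemma re_scal_le c (x y : scal R c) : x <= y -> re_scal x <= re_scal y.
Proof. by case: c x y => //= x y; rewrite lecE => /andP[]. Qed.

Lemma real_scal_re c (x : scal R c) : 0 <= x -> real_scal c (re_scal x) = x.
Proof.
by case: c x => //= -[a b]; rewrite lecE/= => /andP[/eqP -> _].
Qed.

Lemma real_scalD c (x y : R) : real_scal c (x + y) = real_scal c x + real_scal c y.
Proof. by case: c => //=; rewrite rmorphD. Qed.

Lemma real_scalM c (x y : R) : real_scal c (x * y) = real_scal c x * real_scal c y.
Proof. by case: c => //=; rewrite rmorphM. Qed.

Lemma real_scalN c (x : R) : real_scal c (- x) = - real_scal c x.
Proof. by case: c => //=; rewrite rmorphN. Qed.

Lemma real_scal1 c : real_scal c 1 = 1.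
Proof. by case: c. Qed.

Lemma real_scal0 c : real_scal c 0 = 0.
Proof. by case: c. Qed.

Lemma real_scal_le c (x y : R) : (real_scal c x <= real_scal c y) = (x <= y).
Proof. by case: c => //=; rewrite lecR. Qed.

Lemma real_scal_lt c (x y : R) : (real_scal c x < real_scal c y) = (x < y).
Proof. by case: c => //=; rewrite ltcR. Qed.

Lemma norm_real_scal c (x : R) : `|real_scal c x| = real_scal c `|x|.
Proof.
case: c => //=.
by rewrite normc_def/= expr0n/= addr0 sqrtr_sqr.
Qed.

Lemma re_scalM c (x y : scal R c) : 0 <= x -> 0 <= y ->
  re_scal (x * y) = re_scal x * re_scal y.
Proof.
move=> x0 y0; rewrite -[in LHS](real_scal_re x0) -[in LHS](real_scal_re y0).
by rewrite -real_scalM re_scalK.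
Qed.

End Scalars.

Section RealNorm.
Context {R : realType} {c : bool}.
Notation K := (scal R c).
Context {X : normedModType K}.

Definition rnorm (x : X) : R := re_scal `|x|.
Definition snorm (k : K) : R := re_scal `|k|.

Lemma rnormE (x : X) : `|x| = real_scal c (rnorm x).
Proof. by rewrite real_scal_re. Qed.

Lemma snormE (k : K) : `|k| = real_scal c (snorm k).
Proof. by rewrite real_scal_re. Qed.

Lemma rnorm_ge0 x : 0 <= rnorm x.
Proof. by rewrite -(real_scal_le c) real_scal0 -rnormE. Qed.

Lemma snorm_ge0 k : 0 <= snorm k.
Proof. by rewrite -(real_scal_le c) real_scal0 -snormE. Qed.

Lemma rnorm0 : rnorm 0 = 0.
Proof. by rewrite /rnorm normr0; case: (c). Qed.

Lemma rnorm_eq0 x : rnorm x = 0 -> x = 0.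
Proof. by move=> x0; apply/eqP; rewrite -normr_eq0 rnormE x0 real_scal0. Qed.

Lemma rnormD x y : rnorm (x + y) <= rnorm x + rnorm y.
Proof. by rewrite -re_scalD; apply: re_scal_le; exact: ler_normD. Qed.

Lemma rnormN x : rnorm (- x) = rnorm x.
Proof. by rewrite /rnorm normrN. Qed.

Lemma rnormBC x y : rnorm (x - y) = rnorm (y - x).
Proof. by rewrite -rnormN opprB. Qed.

Lemma rnormB x y : rnorm (x - y) <= rnorm x + rnorm y.
Proof. by rewrite -(rnormN y) rnormD. Qed.

Lemma rnormZ k x : rnorm (k *: x) = snorm k * rnorm x.
Proof. by rewrite /rnorm normrZ re_scalM. Qed.

Lemma snorm_real (t : R) : snorm (real_scal c t) = `|t|.
Proof. by rewrite /snorm norm_real_scal re_scalK. Qed.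

Lemma rnormZr (t : R) x : rnorm (real_scal c t *: x) = `|t| * rnorm x.
Proof. by rewrite rnormZ snorm_real. Qed.

Lemma rnorm_dist x y : `|rnorm x - rnorm y| <= rnorm (x - y).
Proof.
rewrite ler_norml; apply/andP; split.
  by rewrite lerNl opprB lerBlDr rnormBC -{1}(subrK x y) rnormD.
by rewrite lerBlDr -{1}(subrK y x) rnormD.
Qed.

Lemma rnorm_sum (I : Type) (s : seq I) (Q : pred I) (f : I -> X) :
  rnorm (\sum_(i <- s | Q i) f i) <= \sum_(i <- s | Q i) rnorm (f i).
Proof.
elim/big_rec2 : _ => [|i y x _ h]; first by rewrite rnorm0.
by rewrite (le_trans (rnormD _ _))// lerD2l.
Qed.

Lemma real_scal_gt0 (e : R) : (0 < real_scal c e) = (0 < e).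
Proof. by rewrite -{1}(real_scal0 c) real_scal_lt. Qed.

(** A positive element of [K] is real even when [K] is complex, so radii in [K] and radii in [R]
    describe the same neighbourhoods. *)
Lemma cvg_rnormP (T : Type) (F : set_system T) (FF : Filter F) (u : T -> X) (l : X) :
  u @ F --> l <-> (fun n => rnorm (u n - l)) @ F --> (0 : R).
Proof.
split => [/cvgrPdist_lt h|/cvgrPdist_lt h]; apply/cvgrPdist_lt => e e0.
  have e0' : 0 < real_scal c e by rewrite real_scal_gt0.
  move: (h _ e0'); apply: filterS => n.
  by rewrite rnormE real_scal_lt sub0r normrN rnormBC ger0_norm// rnorm_ge0.
have e0' : 0 < re_scal e by rewrite -real_scal_gt0 real_scal_re// ltW.
move: (h _ e0'); apply: filterS => n.
rewrite sub0r normrN ger0_norm ?rnorm_ge0// rnormBC rnormE => he.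
by rewrite -(real_scal_re (ltW e0)) real_scal_lt.
Qed.

Lemma continuous_rnormP (T : pseudoMetricNormedZmodType R) (psi : X -> T) :
  (forall x e, 0 < e -> exists2 d, 0 < d &
     forall y, rnorm (y - x) < d -> `|psi y - psi x| < e) -> continuous psi.
Proof.
move=> h x; apply/cvgrPdist_lt => e e0.
have [d d0 hd] := h x e e0.
apply/nbhs_ballP; exists (real_scal c d) => /=; first by rewrite real_scal_gt0.
move=> y; rewrite -ball_normE /= rnormE real_scal_lt => xy.
by rewrite distrC; apply: hd; rewrite rnormBC.
Qed.

Lemma continuous0_rnorm (psi : X -> R) : continuous psi -> 
  forall x e, 0 < e -> exists2 d, 0 < d &
     forall y, rnorm (y - x) < d -> `|psi y - psi x| < e.
Proof.
move=> h x e e0; have /cvgrPdist_lt/(_ _ e0) := h x.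
move=> /nbhs_ballP[d /= d0 hd]; exists (re_scal d).
  by rewrite -real_scal_gt0 real_scal_re// ltW.
move=> y xy; rewrite distrC; apply: hd; rewrite -ball_normE/=.
by rewrite -(real_scal_re (ltW d0)) rnormE real_scal_lt rnormBC.
Qed.

Lemma real_functional0 (psi : X -> R) : real_functional psi -> psi 0 = 0.
Proof. by move=> [h _]; apply: (@addrI _ (psi 0)); rewrite -h !addr0. Qed.

Lemma real_functionalN (psi : X -> R) x : real_functional psi -> psi (- x) = - psi x.
Proof.
move=> h; apply: (@addrI _ (psi x)); case: (h) => hD _.
by rewrite -hD !subrr real_functional0.
Qed.

Lemma real_functionalB (psi : X -> R) x y : real_functional psi ->
  psi (x - y) = psi x - psi y.
Proof. by move=> h; case: (h) => -> _; rewrite real_functionalN. Qed.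

Lemma real_functional_sum (psi : X -> R) (I : Type) (s : seq I) (Q : pred I) (f : I -> X) :
  real_functional psi ->
  psi (\sum_(i <- s | Q i) f i) = \sum_(i <- s | Q i) psi (f i).
Proof.
move=> h; case: (h) => hD _.
by apply: (big_morph psi hD); exact: real_functional0.
Qed.

(** Additivity gives homogeneity for integers at once. Write [x] as [m] copies of a vector on which
    [psi] is less than 1; rounding [m] up costs the summand 1. An affine bound is enough for
    integrability over a probability space. *)
Lemma real_functional_bound (psi : X -> R) : real_functional psi ->
  exists2 C, 0 <= C & forall x, `|psi x| <= C * rnorm x + 1.
Proof.
move=> h; have [hD hc] := h.
have [d d0 hd] := continuous0_rnorm hc 0 ltr01.
exists d^-1; first by rewrite invr_ge0 ltW.
move=> x.
have psiMn y n : psi (y *+ n) = psi y *+ n.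
  by elim: n => [|n ih]; rewrite ?mulr0n ?real_functional0// !mulrS hD ih.
have q0 : 0 <= d^-1 * rnorm x by rewrite mulr_ge0 ?rnorm_ge0// invr_ge0 ltW.
set m := (Num.truncn (d^-1 * rnorm x)).+1.
have m0 : (0 : R) < m%:R by rewrite ltr0n.
pose y := real_scal c m%:R^-1 *: x.
have xy : x = y *+ m.
  rewrite /y scalerMnl -[LHS]scale1r; congr (_ *: _).
  rewrite -mulr_natr -(_ : real_scal c m%:R = m%:R).
    by rewrite -real_scalM mulVf ?real_scal1// gt_eqF.
  rewrite /m; elim: (_.+1) => [|k ih]; first by rewrite real_scal0.
  by rewrite -addn1 !natrD real_scalD ih real_scal1.
have := hd y.
rewrite subr0 real_functional0// subr0 /y rnormZr ger0_norm ?invr_ge0 ?(ltW m0)//.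
rewrite mulrC ltr_pdivrMr// -ltr_pdivrMl// => /(_ _)/wrap[].
  by have := truncnS_gt (d^-1 * rnorm x); rewrite -/m.
move=> hy; rewrite xy psiMn normrMn -mulr_natr -xy.
apply: (@le_trans _ _ m%:R); first by rewrite ler_piMl// ?ler0n// ltW.
rewrite /m -natr1 lerD2r truncn_le//.
Qed.

Lemma rnorm_le_real_functional (psi : X -> R) :
  (forall x y, psi (x + y) = psi x + psi y) -> (forall x, `|psi x| <= rnorm x) ->
  real_functional psi.
Proof.
move=> hD hle; split => //; apply: continuous_rnormP => x e e0.
exists e => // y; apply: le_lt_trans.
have -> : psi y - psi x = psi (y - x); last exact: hle.
by rewrite -{1}(subrK x y) hD addrK.
Qed.

Lemma real_functionalZ (psi : X -> R) k : real_functional psi ->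
  real_functional (fun x => psi (k *: x)).
Proof.
move=> h; have [hD hc] := h; split => [x y|]; first by rewrite scalerDr hD.
by move=> x; apply: (@continuous_comp _ _ _ ( *:%R k) psi); 
  [exact: scaler_continuous|exact: hc].
Qed.

End RealNorm.

Section Completeness.
Context {R : realType} {c : bool} {X : completeNormedModType (scal R c)}.

Lemma rnorm_cauchy_cvg (u : nat -> X) :
  (forall e, 0 < e -> exists N : nat, forall n m, (N <= n)%N -> (N <= m)%N ->
     rnorm (u n - u m) < e) -> exists l : X, u @ \oo --> l.
Proof.
move=> h; apply/cvg_ex; apply/cauchy_cvgP; apply/cauchy_ballP => e e0.
have e0' : 0 < re_scal e by rewrite -(@real_scal_gt0 _ c) real_scal_re// ltW.
have [N hN] := h _ e0'; near_simpl; near=> n m => /=.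
rewrite -ball_normE/= rnormE -(real_scal_re (ltW e0)) real_scal_lt.
by apply: hN; [near: n|near: m]; exists N.
Unshelve. all: by end_near. Qed.

End Completeness.

(** * Norming functionals *)

Section HahnBanach.
Context {R : realType} {c : bool}.
Notation K := (scal R c).
Context {X : normedModType K}.
Implicit Types (q : X -> R) (t : R).
Local Notation rs := (real_scal c).

Definition sublinear q := [/\ forall x y, q (x + y) <= q x + q y,
  forall t x, 0 < t -> q (rs t *: x) = t * q x & forall x, q x <= rnorm x].

Lemma sublinear0 q : sublinear q -> q 0 = 0.
Proof.
move=> [_ hZ _]; have := hZ 2 0 (ltr0n _ 2); rewrite scaler0; lra.
Qed.

Lemma sublinear_ge q x : sublinear q -> - rnorm x <= q x.
Proof.
move=> h; have q0 := sublinear0 h; have [hD _ hle] := h.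
have := hD x (- x); rewrite subrr q0 => h1.
have := hle (- x); rewrite rnormN; lra.
Qed.

(* The directional infimum of a sublinear functional is again sublinear and
   lies below it; on a minimal functional it forces q (x + v) >= q x + q v,
   that is, additivity. *)
Definition dir_inf q v x := inf [set q (x + rs t *: v) - t * q v | t in [set t | 0 <= t]].

Lemma dir_inf_le q v x t : sublinear q -> 0 <= t ->
  dir_inf q v x <= q (x + rs t *: v) - t * q v.
Proof.
move=> h t0; apply: ge_inf; last by exists t.
exists (- rnorm x) => _ [s s0 <-].
have [hD hZ hle] := h.
have h1 := hD (x + rs s *: v) (- x).
have h2 := hle (- x); rewrite rnormN in h2.
rewrite (addrC x) addrK in h1.
have h3 : q (rs s *: v) = s * q v.
  move: s0; rewrite /= le_eqVlt => /orP[/eqP <-|/hZ//].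
  by rewrite real_scal0 scale0r mul0r sublinear0.
rewrite h3 in h1; rewrite (addrC x); lra.
Qed.

Lemma dir_inf_ge q v x b :
  (forall t, 0 <= t -> b <= q (x + rs t *: v) - t * q v) -> b <= dir_inf q v x.
Proof.
move=> h; apply: lb_le_inf; last by move=> _ [t t0 <-]; exact: h.
by exists (q (x + rs 0 *: v) - 0 * q v), 0 => /=.
Qed.

Lemma dir_inf_le_self q v x : sublinear q -> dir_inf q v x <= q x.
Proof.
move=> h; have := @dir_inf_le q v x 0 h (lexx _).
by rewrite real_scal0 scale0r addr0 mul0r subr0.
Qed.

Lemma sublinear_dir_inf q v : sublinear q -> sublinear (dir_inf q v).
Proof.
move=> h; have [hD hZ hle] := h.
have subadd x y : dir_inf q v (x + y) <= dir_inf q v x + dir_inf q v y.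
  rewrite -lerBlDr; apply: dir_inf_ge => t t0.
  rewrite lerBlDr [leRHS]addrC -lerBlDr; apply: dir_inf_ge => s s0.
  have := @dir_inf_le q v (x + y) (t + s) h (addr_ge0 t0 s0).
  rewrite real_scalD scalerDl addrACA.
  have := hD (x + rs t *: v) (y + rs s *: v); lra.
have homle t x : 0 < t -> dir_inf q v (rs t *: x) <= t * dir_inf q v x.
  move=> t0; rewrite -ler_pdivrMl//; apply: dir_inf_ge => s s0.
  rewrite ler_pdivrMl//.
  have := @dir_inf_le q v (rs t *: x) (t * s) h (mulr_ge0 (ltW t0) s0).
  by rewrite real_scalM -scalerA -scalerDr hZ// mulrBr mulrA.
split => // [t x t0|x].
- apply/eqP; rewrite eq_le homle//=.
  rewrite -ler_pdivlMl//; have := @homle t^-1 (rs t *: x).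
  rewrite scalerA -real_scalM mulVf ?gt_eqF// real_scal1 scale1r; apply.
  by rewrite invr_gt0.
- exact: le_trans (dir_inf_le_self v x h) (hle x).
Qed.

Lemma sublinear_rnorm : sublinear (@rnorm R c X).
Proof.
split => // [|t x t0]; first exact: rnormD.
by rewrite rnormZr gtr0_norm.
Qed.

(** Zorn's lemma for the reversed pointwise order. The pointwise infimum of a chain is finite, every
    member being at least [- rnorm x], and it is subadditive because any two members are comparable,
    so the smaller one can be used at both arguments. *)
Lemma exists_minimal_sublinear q0 : sublinear q0 ->
  exists q, [/\ sublinear q, forall x, q x <= q0 x &
    forall q', sublinear q' -> (forall x, q' x <= q x) -> q' = q].
Proof.
move=> h0.
pose T := {q | sublinear q /\ forall x, q x <= q0 x}.
pose r (s t : T) : bool := `[< forall x, sval t x <= sval s x >].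
have t0 : T by exists q0.
have sval_inj (s t : T) : sval s = sval t -> s = t.
  case: s t => [s hs] [t ht] /= st; subst t; congr exist; exact: Prop_irrelevance.
have [t|s t u /asboolP st /asboolP tu|s t /asboolP st /asboolP ts|C Ctot|[q [hq qq0]] qmin] := @Zorn T r.
- by apply/asboolP.
- by apply/asboolP => x; exact: le_trans (tu x) (st x).
- by apply: sval_inj; apply/funext => x; apply/eqP; rewrite eq_le st ts.
- have [[c0 Cc0]|C0] := pselect (exists s, C s); last first.
    by exists t0 => s Cs; case: C0; exists s.
  pose m x := inf [set sval s x | s in C].
  have m_le s x : C s -> m x <= sval s x.
    move=> Cs; apply: ge_inf; last by exists s.
    exists (- rnorm x) => _ [u _ <-]; apply: sublinear_ge.
    by have [] := svalP u.
  have m_ge x b : (forall s, C s -> b <= sval s x) -> b <= m x.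
    move=> h; apply: lb_le_inf; first by exists (sval c0 x), c0.
    by move=> _ [s Cs <-]; exact: h.
  have mhom t x : 0 < t -> m (rs t *: x) <= t * m x.
    move=> tp; rewrite -ler_pdivrMl//; apply: (m_ge) => s Cs.
    have [[_ hZ _] _] := svalP s.
    by rewrite ler_pdivrMl// -hZ// m_le.
  have hm : sublinear m.
    split => [x y|t x tp|x].
    + rewrite -lerBlDr; apply: (m_ge) => s Cs.
      rewrite lerBlDr [leRHS]addrC -lerBlDr; apply: (m_ge) => u Cu.
      rewrite lerBlDr.
      have [/asboolP su|/asboolP us] := Ctot _ _ Cs Cu.
        have [[hD _ _] _] := svalP u.
        have := hD x y; have := m_le _ (x + y) Cu; have := su x; lra.
      have [[hD _ _] _] := svalP s.
      have := hD x y; have := m_le _ (x + y) Cs; have := us y; lra.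
    + apply/eqP; rewrite eq_le mhom//=.
      rewrite -ler_pdivlMl//; have := @mhom t^-1 (rs t *: x).
      rewrite scalerA -real_scalM mulVf ?gt_eqF// real_scal1 scale1r; apply.
      by rewrite invr_gt0.
    + have [[_ _ hle] _] := svalP c0.
      exact: le_trans (m_le _ x Cc0) (hle x).
  have mq0 x : m x <= q0 x.
    by have [_ h] := svalP c0; exact: le_trans (m_le _ x Cc0) (h x).
  by exists (exist _ m (conj hm mq0)) => s Cs; apply/asboolP => x /=; exact: m_le.
- exists q; split => // q' hq' q'q.
  have q'q0 x : q' x <= q0 x by exact: le_trans (q'q x) (qq0 x).
  have := qmin (exist _ q' (conj hq' q'q0)) => /(_ _)/wrap[].
    by apply/asboolP.
  by move=> [].
Qed.

(** Minimality is taken below the directional infimum of the norm along [v]. At [- v] with parameter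
    1 that infimum is at most [- rnorm v], which forces [psi v >= rnorm v]. Homogeneity for
    nonnegative reals is recorded because it is applied to the probability weights of simple
    integrals. *)
Lemma norming_functional (v : X) : exists psi : X -> R,
  [/\ real_functional psi, forall t x, 0 <= t -> psi (rs t *: x) = t * psi x,
   forall x, psi x <= rnorm x & psi v = rnorm v].
Proof.
have [q [hq qle qmin]] := exists_minimal_sublinear (sublinear_dir_inf v sublinear_rnorm).
have [hD hZ hle] := hq.
have hadd x y : q (x + y) = q x + q y.
  apply/eqP; rewrite eq_le hD/=.
  have qE := qmin _ (sublinear_dir_inf y hq) (fun z => dir_inf_le_self y z hq).
  have := @dir_inf_le q y x 1 hq ler01; rewrite qE real_scal1 scale1r mul1r; lra.
have q0 := sublinear0 hq.
have qN x : q (- x) = - q x.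
  by apply: (@addrI _ (q x)); rewrite -hadd !subrr.
exists q; split => //.
- apply: rnorm_le_real_functional => // x.
  by rewrite ler_norml hle andbT sublinear_ge.
- move=> t x; rewrite le_eqVlt => /orP[/eqP <-|/hZ//].
  by rewrite real_scal0 scale0r mul0r.
- apply/eqP; rewrite eq_le hle/=.
  have := qle (- v).
  have := @dir_inf_le _ v (- v) 1 sublinear_rnorm ler01.
  rewrite real_scal1 scale1r addNr rnorm0 mul1r qN; lra.
Qed.

End HahnBanach.

(** * Simple and strongly measurable functions *)

Section SigmaAlgebra.
Context {T : Type} {G : set (set T)}.
Hypothesis hG : sigma_algebra setT G.

Lemma sigma_alg0 : G set0. Proof. by case: hG. Qed.

Lemma sigma_algC A : G A -> G (~` A).
Proof. by case: hG => _ h _ /h; rewrite setTD. Qed.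

Lemma sigma_algT : G setT.
Proof. by rewrite -setC0; apply: sigma_algC; exact: sigma_alg0. Qed.

Lemma sigma_algU A B : G A -> G B -> G (A `|` B).
Proof.
move=> GA GB; rewrite -bigcup2E; case: hG => _ _; apply => -[|[|n]] //=.
exact: sigma_alg0.
Qed.

Lemma sigma_algI A B : G A -> G B -> G (A `&` B).
Proof.
move=> GA GB; rewrite -(setCK (A `&` B)) setCI.
by apply: sigma_algC; apply: sigma_algU; exact: sigma_algC.
Qed.

Lemma sigma_alg_fin_bigcup (I : Type) (D : set I) (F : I -> set T) :
  finite_set D -> (forall i, D i -> G (F i)) -> G (\bigcup_(i in D) F i).
Proof.
move=> fD; have [s sE] : exists s : seq {classic I}, [set x | x \in s] = D.
  by have /finite_seqP[s ->] := (fD : finite_set (D : set {classic I})); exists s.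
rewrite -{}sE; elim: s => [|x s ih] h.
  rewrite (_ : \bigcup_(_ in _) _ = set0); first exact: sigma_alg0.
  by rewrite -subset0 => w [].
rewrite (_ : \bigcup_(_ in _) _ = F x `|` \bigcup_(i in [set x | x \in s]) F i).
  apply: sigma_algU; first by apply: h; rewrite /= mem_head.
  by apply: ih => i /= si; apply: h; rewrite /= in_cons si orbT.
rewrite predeqE => w; split => [[i /=]|[Fx|[i /= si Fi]]].
- by rewrite in_cons => /orP[/eqP ->|si] Fi; [left|right; exists i].
- by exists x => //=; rewrite mem_head.
- by exists i => //=; rewrite in_cons si orbT.
Qed.

End SigmaAlgebra.

(* [simple_wrt] for an arbitrary codomain, so that tuples of simple functions
   (histories, pairs of states) are covered as well. *)
Definition simple_fun {T U : Type} (G : set (set T)) (g : T -> U) : Prop :=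
  finite_set (range g) /\ forall x, G (g @^-1` [set x]).

Section SimpleFun.
Context {T : Type} {G : set (set T)}.
Hypothesis hG : sigma_algebra setT G.

Lemma simple_preimage U (g : T -> U) (Y : set U) : simple_fun G g -> G (g @^-1` Y).
Proof.
move=> [fg gx].
rewrite (_ : _ @^-1` _ = \bigcup_(x in range g `&` Y) (g @^-1` [set x])).
  apply: sigma_alg_fin_bigcup => //.
  by apply: sub_finite_set fg; exact: subIsetl.
rewrite predeqE => w; split => [Yw|[v [_ Yv] /= gw]].
  by exists (g w) => //; split => //; exists w.
by rewrite /preimage/= gw.
Qed.

Lemma simple_comp U V (g : T -> U) (phi : U -> V) : simple_fun G g ->
  simple_fun G (phi \o g).
Proof.
move=> sg; split => [|x]; last by rewrite comp_preimage; exact: simple_preimage.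
have [fg _] := sg; rewrite (_ : range _ = phi @` (range g)); first exact: finite_image.
by rewrite image_comp.
Qed.

Lemma simple_pair U V (g : T -> U) (h : T -> V) : simple_fun G g -> simple_fun G h ->
  simple_fun G (fun w => (g w, h w)).
Proof.
move=> [fg gx] [fh hx]; split => [|[x y]].
  apply: (@sub_finite_set _ _ (range g `*` range h)); last exact: finite_setX.
  by move=> _ [w _ <-]; split; exists w.
rewrite (_ : _ @^-1` _ = (g @^-1` [set x]) `&` (h @^-1` [set y])); first exact: sigma_algI.
by rewrite predeqE => w; split => [[/= gw hw]|[/= gw hw]]; [split|congr pair].
Qed.

Lemma simple_cst U (u : U) : simple_fun G (fun _ : T => u).
Proof.
split => [|x]; first by apply: (@sub_finite_set _ _ [set u]) => // _ [? _ <-].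
have [->|ux] := pselect (u = x).
  by rewrite (_ : _ @^-1` _ = setT); [exact: sigma_algT|rewrite predeqE].
by rewrite (_ : _ @^-1` _ = set0); [exact: sigma_alg0|rewrite predeqE].
Qed.

Lemma simple_mem S : G S -> simple_fun G (fun w => `[< S w >]).
Proof.
move=> GS; split => [|x].
  by apply: (@sub_finite_set _ _ [set true; false]) => // b _; case: b; [left|right].
case: x.
  rewrite (_ : _ @^-1` _ = S)//; rewrite predeqE => w; split => [/asboolP//|?].
  exact/asboolP.
rewrite (_ : _ @^-1` _ = ~` S); first exact: sigma_algC.
by rewrite predeqE => w; split => [/asboolP//|?]; exact/asboolP.
Qed.

Lemma simple_if U (g h : T -> U) S : G S -> simple_fun G g -> simple_fun G h ->
  simple_fun G (fun w => if `[< S w >] then g w else h w).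
Proof.
move=> /simple_mem GS sg sh.
exact: (simple_comp (fun x => if x.1 then x.2.1 else x.2.2)
  (simple_pair GS (simple_pair sg sh))).
Qed.

Lemma simple_op2 U V Z (op : U -> V -> Z) (g : T -> U) (h : T -> V) :
  simple_fun G g -> simple_fun G h -> simple_fun G (fun w => op (g w) (h w)).
Proof. by move=> sg sh; exact: (simple_comp (fun x => op x.1 x.2) (simple_pair sg sh)). Qed.

Lemma simple_sum (U : nmodType) (I : eqType) (s : seq I) (f : I -> T -> U) :
  (forall i, i \in s -> simple_fun G (f i)) -> simple_fun G (fun w => \sum_(i <- s) f i w).
Proof.
elim: s => [|x s ih] h.
  by under eq_fun do rewrite big_nil; exact: simple_cst.
under eq_fun do rewrite big_cons; apply: simple_op2.
  by apply: h; rewrite mem_head.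
by apply: ih => i si; apply: h; rewrite in_cons si orbT.
Qed.

End SimpleFun.

Lemma simple_sub T U (G H : set (set T)) (g : T -> U) : G `<=` H ->
  simple_fun G g -> simple_fun H g.
Proof. by move=> GH [fg gx]; split => // x; exact/GH/gx. Qed.

Section StrongMeasurability.
Context {R : realType} {c : bool} {X : normedModType (scal R c)}.
Context {d : measure_display} {Omega : measurableType d}.
Implicit Types (G : set (set Omega)) (f g : Omega -> X).

Lemma simple_fun_measurable U (g : Omega -> U) (phi : U -> R) : simple_fun measurable g ->
  measurable_fun setT (fun w => phi (g w)).
Proof.
move=> sg _ B mB; rewrite setTI.
exact: (@simple_preimage _ _ (@sigma_algebra_measurable _ Omega) _ _ (phi @^-1` B) sg).
Qed.

Lemma strongly_measurable_simple G g : simple_fun G g -> strongly_measurable_wrt G g.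
Proof. by move=> sg; exists (fun=> g); split => // w; exact: cvg_cst. Qed.

Lemma strongly_measurable_sub G H f : G `<=` H -> strongly_measurable_wrt G f ->
  strongly_measurable_wrt H f.
Proof. by move=> GH [s [sG sf]]; exists s; split => // k; exact: simple_sub (sG k). Qed.

Section OneSigmaAlgebra.
Context {G : set (set Omega)}.
Hypothesis hG : sigma_algebra setT G.

Lemma strongly_measurable_cst (x : X) : strongly_measurable_wrt G (fun _ : Omega => x).
Proof. by apply: strongly_measurable_simple; exact: simple_cst. Qed.

Lemma strongly_measurableD f g : strongly_measurable_wrt G f ->
  strongly_measurable_wrt G g -> strongly_measurable_wrt G (fun w => f w + g w).
Proof.
move=> [s [sG sf]] [t [tG tg]]; exists (fun k w => s k w + t k w); split => [k|w].
  exact: (simple_op2 hG +%R (sG k) (tG k)).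
by apply: cvgD; [exact: sf|exact: tg].
Qed.

Lemma strongly_measurableZ k f : strongly_measurable_wrt G f ->
  strongly_measurable_wrt G (fun w => k *: f w).
Proof.
move=> [s [sG sf]]; exists (fun i w => k *: s i w); split => [i|w].
  exact: (simple_comp hG ( *:%R k) (sG i)).
by apply: cvgZr; exact: sf.
Qed.

Lemma strongly_measurableB f g : strongly_measurable_wrt G f ->
  strongly_measurable_wrt G g -> strongly_measurable_wrt G (fun w => f w - g w).
Proof.
move=> [s [sG sf]] [t [tG tg]]; exists (fun k w => s k w - t k w); split => [k|w].
  exact: (simple_op2 hG (fun x y => x - y) (sG k) (tG k)).
by apply: cvgB; [exact: sf|exact: tg].
Qed.

Lemma strongly_measurable_if S f g : G S -> strongly_measurable_wrt G f ->
  strongly_measurable_wrt G g ->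
  strongly_measurable_wrt G (fun w => if `[< S w >] then f w else g w).
Proof.
move=> GS [s [sG sf]] [t [tG tg]].
exists (fun k w => if `[< S w >] then s k w else t k w); split => [k|w].
  exact: (simple_if hG GS (sG k) (tG k)).
by case: asboolP => _.
Qed.

Lemma strongly_measurable_sum (I : eqType) (s : seq I) (f : I -> Omega -> X) :
  (forall i, i \in s -> strongly_measurable_wrt G (f i)) ->
  strongly_measurable_wrt G (fun w => \sum_(i <- s) f i w).
Proof.
elim: s => [|x s ih] h.
  by under eq_fun do rewrite big_nil; exact: strongly_measurable_cst.
under eq_fun do rewrite big_cons; apply: strongly_measurableD.
  by apply: h; rewrite mem_head.
by apply: ih => i si; apply: h; rewrite in_cons si orbT.
Qed.

(** [G] is a bare set of sets. The limit theorem for measurable functions is applied on the type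
    that carries [<<s G >>], which equals [G]. *)
Lemma strongly_measurable_comp (phi : X -> R) f : continuous phi ->
  strongly_measurable_wrt G f -> forall B, measurable B -> G ((fun w => phi (f w)) @^-1` B).
Proof.
move=> phic [s [sG sf]] B mB.
have -> : G = <<s G >> by rewrite sigma_algebra_id.
suff : @measurable_fun _ _ (g_sigma_algebraType G) R setT (fun w => phi (f w)).
  by move=> /(_ measurableT _ mB); rewrite setTI.
apply: (@measurable_realfun.measurable_fun_cvg _ (g_sigma_algebraType G) R setT
  (fun k w => phi (s k w))) => [k|w _].
  move=> _ C mC; rewrite setTI; apply: sub_sigma_algebra.
  exact: (@simple_preimage _ _ hG _ _ (phi @^-1` C) (sG k)).
by apply: (@cvg_comp _ _ _ (s^~ w) phi _ (nbhs (f w))); [exact: sf|exact: phic].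
Qed.

End OneSigmaAlgebra.

Lemma continuous_rnorm : continuous (@rnorm R c X).
Proof.
apply: continuous_rnormP => x e e0; exists e => // y.
by apply: le_lt_trans; exact: rnorm_dist.
Qed.

Lemma strongly_measurable_fun_comp (phi : X -> R) f : continuous phi ->
  strongly_measurable_wrt measurable f -> measurable_fun setT (fun w => phi (f w)).
Proof.
move=> phic sf _ B mB; rewrite setTI.
exact: (strongly_measurable_comp (@sigma_algebra_measurable _ Omega) phic sf mB).
Qed.

Lemma measurable_rnorm f : strongly_measurable_wrt measurable f ->
  measurable_fun setT (fun w => rnorm (f w)).
Proof. exact: strongly_measurable_fun_comp continuous_rnorm. Qed.

End StrongMeasurability.

(** * The L^p norm *)

Section LpNorm.
Context {R : realType} {c : bool} {X : normedModType (scal R c)}.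
Context {d : measure_display} {Omega : measurableType d}.
Variable P : probability Omega R.
Variable p : R.
Hypothesis p1 : 1 < p.
Implicit Types (f g : Omega -> X).
Local Notation strong := (@strongly_measurable_wrt R d Omega c X measurable).

Let p0 : 0 < p. Proof. exact: lt_trans ltr01 p1. Qed.

Lemma LpnE f : Lpn P p f =
  ((\int[P]_w ((rnorm (f w)) `^ p)%:E) `^ p^-1)%E.
Proof.
rewrite /Lpn unlock; apply: (congr1 (fun x => (x `^ p^-1)%E)).
apply: eq_integral => w _ /=.
by rewrite ger0_norm // rnorm_ge0.
Qed.

Lemma measurable_rnorm_pow f : strong f ->
  measurable_fun setT (fun w => ((rnorm (f w)) `^ p)%:E).
Proof.
move=> sf; apply/measurable_EFinP.
apply: (measurableT_comp (measurable_powR p)); exact: measurable_rnorm.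
Qed.

Lemma int_pow_ge0 f : (0 <= \int[P]_w ((rnorm (f w)) `^ p)%:E)%E.
Proof. by apply: integral_ge0 => w _; rewrite lee_fin powR_ge0. Qed.

Lemma Lpn_ge0 f : (0 <= Lpn P p f)%E.
Proof. exact: Lnorm_ge0. Qed.

Lemma Lpn_pow f : ((Lpn P p f) `^ p = \int[P]_w ((rnorm (f w)) `^ p)%:E)%E.
Proof. by rewrite LpnE -poweRrM mulVf ?gt_eqF// poweRe1// int_pow_ge0. Qed.

Lemma Lpn_le f g : strong f -> strong g -> (forall w, rnorm (f w) <= rnorm (g w)) ->
  (Lpn P p f <= Lpn P p g)%E.
Proof.
move=> sf sg fg; rewrite !LpnE; apply: gt0_ler_poweR.
- by rewrite invr_ge0 ltW.
- by rewrite in_itv/= int_pow_ge0 leey.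
- by rewrite in_itv/= int_pow_ge0 leey.
apply: ge0_le_integral => //.
- by move=> w _; rewrite lee_fin powR_ge0.
- exact: measurable_rnorm_pow.
- exact: measurable_rnorm_pow.
- by move=> w _; rewrite lee_fin ge0_ler_powR// ?nnegrE ?rnorm_ge0// ltW.
Qed.

Lemma eq_Lpn f g : (forall w, rnorm (f w) = rnorm (g w)) -> Lpn P p f = Lpn P p g.
Proof. by move=> fg; rewrite !LpnE; under eq_integral do rewrite fg. Qed.

Lemma Lpn_le_pow f (e : R) : 0 <= e ->
  (Lpn P p f <= e%:E)%E = (\int[P]_w ((rnorm (f w)) `^ p)%:E <= (e `^ p)%:E)%E.
Proof.
move=> e0; rewrite -Lpn_pow; apply/idP/idP => h.
  rewrite -poweR_EFin; apply: gt0_ler_poweR => //; first exact: ltW.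
    by rewrite in_itv/= Lpn_ge0 leey.
  by rewrite in_itv/= lee_fin e0 leey.
have := @gt0_ler_poweR R p^-1 _ _ _ _ _ h; rewrite invr_ge0 (ltW p0) => /(_ isT).
rewrite -!poweRrM mulfV ?gt_eqF// poweRe1 ?Lpn_ge0// poweR_EFin -powRrM mulfV ?gt_eqF// powRr1//.
by apply; rewrite in_itv/= ?leey ?andbT// ?poweR_ge0// lee_fin powR_ge0.
Qed.

Lemma LpnD f g : strong f -> strong g ->
  (Lpn P p (fun w => (f w + g w)%R) <= Lpn P p f + Lpn P p g)%E.
Proof.
move=> sf sg; have mf := measurable_rnorm sf; have mg := measurable_rnorm sg.
apply: le_trans (minkowski_EFin P mf mg (ltW p1)).
have sfg := strongly_measurableD (@sigma_algebra_measurable _ Omega) sf sg.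
rewrite LpnE unlock; apply: gt0_ler_poweR.
- by rewrite invr_ge0 ltW.
- by rewrite in_itv/= (int_pow_ge0 (fun w => f w + g w)) leey.
- by rewrite in_itv/= leey andbT integral_ge0// => w _; rewrite poweR_ge0.
apply: ge0_le_integral => //.
- by move=> w _; rewrite lee_fin powR_ge0.
- exact: measurable_rnorm_pow.
- apply: (measurableT_comp (measurable_poweR p)); apply: measurableT_comp => //.
  by apply/measurable_EFinP; exact: measurable_funD.
- move=> w _ /=; rewrite lee_fin ge0_ler_powR// ?nnegrE ?rnorm_ge0// ?(ltW p0)//.
  by rewrite (le_trans (rnormD _ _))// ler_norm.
Qed.

Lemma LpnN f : Lpn P p (fun w => - f w) = Lpn P p f.
Proof. by apply: eq_Lpn => w; rewrite rnormN. Qed.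

Lemma LpnBC f g : Lpn P p (fun w => f w - g w) = Lpn P p (fun w => g w - f w).
Proof. by apply: eq_Lpn => w; rewrite rnormBC. Qed.

Lemma Lpn0 : Lpn P p (fun=> 0 : X) = 0%E.
Proof.
rewrite LpnE; under eq_integral do rewrite rnorm0 powR0 ?gt_eqF//.
by rewrite integral0 poweR0r// invr_eq0 gt_eqF.
Qed.

Lemma LpnZ k f : strong f -> Lpn P p (fun w => k *: f w) = ((snorm k)%:E * Lpn P p f)%E.
Proof.
move=> sf; rewrite !LpnE.
under eq_integral do rewrite rnormZ powRM ?snorm_ge0 ?rnorm_ge0// EFinM.
rewrite ge0_integralZl//; last 2 first.
- by move=> w _; rewrite lee_fin powR_ge0.
- by rewrite lee_fin powR_ge0.
- rewrite poweRM ?int_pow_ge0 ?lee_fin ?powR_ge0//; congr (_ * _)%E.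
  by rewrite poweR_EFin -powRrM mulfV ?gt_eqF// powRr1// snorm_ge0.
- exact: measurable_rnorm_pow.
Qed.

Lemma Lpn_sum (I : eqType) (s : seq I) (f : I -> Omega -> X) :
  (forall i, i \in s -> strong (f i)) ->
  (Lpn P p (fun w => \sum_(i <- s) f i w)%R <= \sum_(i <- s) Lpn P p (f i))%E.
Proof.
elim: s => [|x s ih] h.
  by under [X in Lpn _ _ X]eq_fun do rewrite big_nil; rewrite Lpn0 big_nil.
under [X in Lpn _ _ X]eq_fun do rewrite big_cons.
have hs i : i \in s -> strong (f i) by move=> si; apply: h; rewrite in_cons si orbT.
rewrite big_cons; apply: (le_trans (LpnD _ _)).
- by apply: h; rewrite mem_head.
- exact: (strongly_measurable_sum (@sigma_algebra_measurable _ Omega)).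
- by rewrite leeD2l// ih.
Qed.

Lemma LpnB f g : strong f -> strong g ->
  (Lpn P p (fun w => (f w - g w)%R) <= Lpn P p f + Lpn P p g)%E.
Proof.
move=> sf sg; rewrite -(LpnN g); apply: LpnD => //.
have := strongly_measurableZ (@sigma_algebra_measurable _ Omega) (-1) sg.
by under eq_fun do rewrite scaleN1r.
Qed.

Lemma in_LpD f g : in_Lp P p f -> in_Lp P p g -> in_Lp P p (fun w => f w + g w).
Proof.
move=> [sf lf] [sg lg]; split.
  exact: (strongly_measurableD (@sigma_algebra_measurable _ Omega)).
by apply: le_lt_trans (LpnD sf sg) _; exact: lte_add_pinfty.
Qed.

Lemma in_LpB f g : in_Lp P p f -> in_Lp P p g -> in_Lp P p (fun w => f w - g w).
Proof.
move=> [sf lf] [sg lg]; split.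
  exact: (strongly_measurableB (@sigma_algebra_measurable _ Omega)).
by apply: le_lt_trans (LpnB sf sg) _; exact: lte_add_pinfty.
Qed.

Lemma in_LpZ k f : in_Lp P p f -> in_Lp P p (fun w => k *: f w).
Proof.
move=> [sf lf]; split; first exact: (strongly_measurableZ (@sigma_algebra_measurable _ Omega)).
by rewrite LpnZ// lte_mul_pinfty// lee_fin snorm_ge0.
Qed.

Lemma in_Lp0 : in_Lp P p (fun=> 0 : X).
Proof.
split; last by rewrite Lpn0.
exact: (strongly_measurable_cst (@sigma_algebra_measurable _ Omega)).
Qed.

Lemma in_Lp_sum (I : eqType) (s : seq I) (f : I -> Omega -> X) :
  (forall i, i \in s -> in_Lp P p (f i)) -> in_Lp P p (fun w => \sum_(i <- s) f i w).
Proof.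
elim: s => [|x s ih] h.
  by under eq_fun do rewrite big_nil; exact: in_Lp0.
under eq_fun do rewrite big_cons; apply: in_LpD.
  by apply: h; rewrite mem_head.
by apply: ih => i si; apply: h; rewrite in_cons si orbT.
Qed.

Lemma Lpn_fin_num f : in_Lp P p f -> Lpn P p f \is a fin_num.
Proof. by move=> [_ lf]; rewrite ge0_fin_numE// Lpn_ge0. Qed.

Lemma Lpn_dist f g : in_Lp P p f -> in_Lp P p g ->
  `|fine (Lpn P p f) - fine (Lpn P p g)| <= fine (Lpn P p (fun w => f w - g w)).
Proof.
move=> lf lg; have lfg := in_LpB lf lg; have lgf := in_LpB lg lf.
have h1 := LpnD lg.1 lfg.1; have h2 := LpnD lf.1 lgf.1.
rewrite (_ : (fun w => _) = f) in h1; last by apply/funext => w; rewrite subrKC.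
rewrite (_ : (fun w => _) = g) in h2; last by apply/funext => w; rewrite subrKC.
rewrite (LpnBC g f) in h2.
move: h1 h2; rewrite -(fineK (Lpn_fin_num lf)) -(fineK (Lpn_fin_num lg)).
rewrite -(fineK (Lpn_fin_num lfg)) -!EFinD !lee_fin ler_norml => h1 h2.
by apply/andP; split; lra.
Qed.

Lemma integrable_rnorm_pow f : in_Lp P p f ->
  P.-integrable setT (fun w => ((rnorm (f w)) `^ p)%:E).
Proof.
move=> [sf lf]; apply/integrableP; split; first exact: measurable_rnorm_pow.
under eq_integral do rewrite gee0_abs ?lee_fin ?powR_ge0//.
by rewrite -Lpn_pow poweR_lty.
Qed.

Lemma in_Lp_bounded f (M : R) : strong f -> (forall w, rnorm (f w) <= M) ->
  in_Lp P p f /\ (Lpn P p f <= M%:E)%E.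
Proof.
move=> sf fM; have M0 : 0 <= M by apply: le_trans (fM point); exact: rnorm_ge0.
have h : (Lpn P p f <= M%:E)%E.
  rewrite Lpn_le_pow//; apply: (@le_trans _ _ (\int[P]_(w in setT) (M `^ p)%:E)%E).
    apply: ge0_le_integral => //.
    - by move=> w _; rewrite lee_fin powR_ge0.
    - exact: measurable_rnorm_pow.
    - by move=> w _; rewrite lee_fin ge0_ler_powR// ?nnegrE ?rnorm_ge0// ltW.
  by rewrite integral_cst//= [X in (_ * X)%E]probability_setT mule1.
by split => //; split => //; exact: le_lt_trans h (ltry _).
Qed.

(** Hölder's inequality against the constant 1, whose conjugate norm is 1 on a probability space. *)
Lemma integral_rnorm_le f : strong f -> (\int[P]_w (rnorm (f w))%:E <= Lpn P p f)%E.
Proof.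
move=> sf; have mf := measurable_rnorm sf.
have p11 : 0 < 1 - p^-1 by rewrite subr_gt0 invf_lt1.
have := @hoelder _ _ _ P (fun w => rnorm (f w)) (cst 1) p (1 - p^-1)^-1 mf
  (measurable_cst _) p0.
rewrite invr_gt0 p11 invrK addrC subrK => /(_ isT erefl).
rewrite Lnorm1 (_ : (EFin \o cst 1)%R = cst 1%E)// Lnorm_cst1.
rewrite [X in (X `^ _)%E]probability_setT poweR1r mule1; apply: le_trans.
rewrite le_eqVlt; apply/orP; left; apply/eqP.
by apply: eq_integral => w _ /=; rewrite mulr1 ger0_norm// rnorm_ge0.
Qed.

Lemma integrable_rnorm f : in_Lp P p f -> P.-integrable setT (fun w => (rnorm (f w))%:E).
Proof.
move=> [sf lf]; apply/integrableP; split.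
  by apply/measurable_EFinP; exact: measurable_rnorm.
under eq_integral do rewrite gee0_abs ?lee_fin ?rnorm_ge0//.
exact: le_lt_trans (integral_rnorm_le sf) lf.
Qed.

Lemma integrable_functional f (psi : X -> R) : in_Lp P p f -> real_functional psi ->
  P.-integrable setT (EFin \o (psi \o f)).
Proof.
move=> hf hpsi; have [C C0 hC] := real_functional_bound hpsi.
have := integrableD measurableT (integrableZl measurableT C (integrable_rnorm hf))
  (finite_measure_integrable_cst P 1 measurableT).
apply: le_integrable => //.
  apply/measurable_EFinP; apply: strongly_measurable_fun_comp; last by case: hf.
  by case: hpsi.
move=> w _ /=; rewrite lee_fin.
rewrite [leRHS]ger0_norm; first exact: hC.
by rewrite addr_ge0// mulr_ge0// rnorm_ge0.
Qed.

End LpNorm.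

(** * Approximation by simple functions *)

(** Differentiability settles [x > 0]. At 0 the bound [y ^ p <= y] for [y <= 1] replaces it. *)
Lemma powR_continuous_ge0 (R : realType) (p x e : R) : 1 < p -> 0 <= x -> 0 < e ->
  exists2 d, 0 < d & forall y, 0 <= y -> `|y - x| < d -> `|y `^ p - x `^ p| < e.
Proof.
move=> p1; have p0 : 0 < p by exact: lt_trans ltr01 p1.
rewrite le_eqVlt => /orP[/eqP <-|x0] e0.
  exists (Num.min 1 e); first by rewrite lt_min ltr01.
  move=> y y0; rewrite powR0 ?gt_eqF// !subr0 lt_min !ger0_norm ?powR_ge0//.
  move=> /andP[y1 ye].
  move: y0; rewrite le_eqVlt => /orP[/eqP <-|y0]; first by rewrite powR0 ?gt_eqF.
  by apply: le_lt_trans ye; apply: ge1r_powR; [rewrite y0 ltW|exact: ltW].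
have /derivable1_diffP/differentiable_continuous : derivable ((@powR R)^~ p) x 1.
  by apply: derivable_powR; rewrite in_itv/= x0.
move=> /cvgrPdist_lt/(_ _ e0)/nbhs_ballP[d /= d0 hd]; exists d => // y _ yx.
by rewrite distrC; apply: hd; rewrite -ball_normE/= distrC.
Qed.

Lemma powR_cvg0_seq (R : realType) (p : R) (u : nat -> R) : 1 < p -> (forall n, 0 <= u n) ->
  u @ \oo --> 0 -> (fun n => u n `^ p) @ \oo --> 0.
Proof.
move=> p1 u0 /cvgrPdist_lt uc; apply/cvgrPdist_lt => e e0.
have [d d0 hd] := powR_continuous_ge0 p1 (lexx 0) e0.
move: (uc _ d0); apply: filterS => n; rewrite !(distrC 0) => /(hd _ (u0 n)).
by rewrite powR0// gt_eqF// (lt_trans _ p1).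
Qed.

Lemma cvge0_lt (R : realType) (u : nat -> \bar R) (e : R) : u @ \oo --> 0%E -> 0 < e ->
  \forall n \near \oo, (u n < e%:E)%E.
Proof.
move=> /fine_cvgP[fu /cvgrPdist_lt hu] e0.
apply: filterS2 fu (hu _ e0) => n un; rewrite sub0r normrN => h.
by rewrite -(fineK un) lte_fin; exact: le_lt_trans (ler_norm _) h.
Qed.

Lemma cvge0P (R : realType) (u : nat -> \bar R) : (forall n, 0 <= u n)%E ->
  (forall e : R, 0 < e -> \forall n \near \oo, (u n <= e%:E)%E) -> u @ \oo --> 0%E.
Proof.
move=> u0 h; apply/fine_cvgP; split.
  apply: filterS (h 1 ltr01) => n un; rewrite ge0_fin_numE//.
  exact: le_lt_trans un (ltry _).
apply/cvgrPdist_le => e e0; apply: filterS (h e e0) => n un.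
rewrite sub0r normrN ger0_norm ?fine_ge0// -lee_fin fineK// ge0_fin_numE//.
exact: le_lt_trans un (ltry _).
Qed.

Lemma simple_fun_bounded (R : realType) T U (G : set (set T)) (g : T -> U) (phi : U -> R) :
  simple_fun G g -> exists2 M, 0 <= M & forall w, phi (g w) <= M.
Proof.
move=> [fg _]; have /finite_seqP[s sE] : finite_set (phi @` range g) by exact: finite_image.
exists (\sum_(i <- s) `|i|) => [|w]; first by rewrite sumr_ge0.
have : phi (g w) \in s.
  have : [set` s] (phi (g w)) by rewrite -sE; exists (g w) => //; exists w.
  by [].
move=> ws; rewrite (perm_big _ (perm_to_rem ws))/= big_cons.
by rewrite (le_trans (ler_norm _))// lerDl sumr_ge0.
Qed.

Section Approximation.
Context {R : realType} {c : bool} {X : normedModType (scal R c)}.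
Context {d : measure_display} {Omega : measurableType d}.
Variable P : probability Omega R.
Variable p : R.
Hypothesis p1 : 1 < p.
Implicit Types (f g : Omega -> X).

Lemma simple_in_Lp G (g : Omega -> X) : G `<=` measurable -> simple_fun G g -> in_Lp P p g.
Proof.
move=> Gm sg; have [M _ hM] := simple_fun_bounded rnorm sg.
have [] // := in_Lp_bounded P p1 _ hM.
by apply: (strongly_measurable_sub Gm); exact: strongly_measurable_simple.
Qed.

(** Pointwise approximants need not be dominated. Each is replaced by 0 where its norm exceeds
    [2 * rnorm (f w)], so that the error is at most [3 * rnorm (f w)]. Convergence survives: where
    [f] is nonzero the cut is eventually inactive, and where [f] vanishes the truncated function is
    0. Dominated convergence concludes. *)
Lemma Lp_approx G f e : sigma_algebra setT G -> G `<=` measurable ->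
  strongly_measurable_wrt G f -> in_Lp P p f -> 0 < e ->
  exists2 s : Omega -> X, simple_fun G s & (Lpn P p (fun w => (s w - f w)%R) <= e%:E)%E.
Proof.
move=> hG Gm sf lf e0.
have p0 : 0 < p by exact: lt_trans ltr01 p1.
have [s [sG cs]] := sf.
pose E j := [set w | rnorm (s j w) <= 2 * rnorm (f w)].
have GE j : G (E j).
  rewrite (_ : E j = \bigcup_(x in range (s j)) ((s j @^-1` [set x]) `&`
      ((fun w => rnorm (f w)) @^-1` `[rnorm x / 2, +oo[))).
    apply: (sigma_alg_fin_bigcup hG); first by case: (sG j).
    move=> x _; apply: (sigma_algI hG); first by case: (sG j) => _; apply.
    by apply: (strongly_measurable_comp hG (@continuous_rnorm R c X)) => //; exact: measurable_itv.
  rewrite predeqE => w; split.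
    move=> h; exists (s j w); first by exists w.
    by split => //=; rewrite in_itv/= andbT ler_pdivrMr// mulrC.
  by move=> [x _ [/= <-]]; rewrite in_itv/= andbT ler_pdivrMr// mulrC.
pose t j w := if `[< E j w >] then s j w else 0.
have tG j : simple_fun G (t j).
  exact: (simple_if hG (GE j) (sG j) (simple_cst hG (0 : X))).
have tm j : strongly_measurable_wrt measurable (t j).
  by apply: (strongly_measurable_sub Gm); exact: strongly_measurable_simple.
have sfm : strongly_measurable_wrt measurable f by case: lf.
have tfm j := strongly_measurableB (@sigma_algebra_measurable _ Omega) (tm j) sfm.
have tle j w : rnorm (t j w - f w) <= 3 * rnorm (f w).
  rewrite /t; case: asboolP => [h|_].
    by have := rnormB (s j w) (f w); rewrite /E/= in h; lra.
  by rewrite sub0r rnormN; have := rnorm_ge0 (f w); lra.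
have tc w : (fun j => rnorm (t j w - f w)) @ \oo --> (0 : R).
  apply/cvgrPdist_lt => a a0.
  have [fw0|fw0] := eqVneq (rnorm (f w)) 0.
    near=> j; have := tle j w; rewrite fw0 mulr0 => h.
    by rewrite sub0r normrN ger0_norm ?rnorm_ge0//; exact: le_lt_trans h a0.
  have fw1 : 0 < rnorm (f w) by rewrite lt_neqAle eq_sym fw0 rnorm_ge0.
  have /cvg_rnormP/cvgrPdist_lt h := cs w.
  near=> j.
  have h1 : rnorm (s j w - f w) < Num.min a (rnorm (f w)).
    rewrite -[ltLHS]ger0_norm ?rnorm_ge0// -[_ (s j w - f w)]subr0 distrC.
    by near: j; apply: h; rewrite lt_min a0.
  move: h1; rewrite lt_min => /andP[h1 h2].
  have -> : t j w = s j w.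
    rewrite /t; case: asboolP => // -[]; rewrite /E/=.
    have := rnormD (s j w - f w) (f w); rewrite subrK; lra.
  by rewrite sub0r normrN ger0_norm ?rnorm_ge0.
have pc w : (fun j => ((rnorm (t j w - f w)) `^ p)%:E) @ \oo --> (0 : R)%:E.
  by apply: cvg_EFin; [exact: nearW|apply: powR_cvg0_seq => // j; exact: rnorm_ge0].
have dom j w : (`|((rnorm (t j w - f w)) `^ p)%:E| <=
    (3 `^ p)%:E * ((rnorm (f w)) `^ p)%:E)%E.
  rewrite gee0_abs; last by rewrite lee_fin powR_ge0.
  rewrite -EFinM lee_fin -powRM ?rnorm_ge0//.
  by rewrite ge0_ler_powR ?nnegrE ?mulr_ge0 ?rnorm_ge0// ltW.
have [_ _ hc] := @dominated_convergence _ _ _ P setT measurableT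
  (fun j w => ((rnorm (t j w - f w)) `^ p)%:E) (fun=> 0%E)
  (fun w => ((3 `^ p)%:E * ((rnorm (f w)) `^ p)%:E)%E)
  (fun j => measurable_rnorm_pow p (tfm j)) (measurable_cst _)
  (aeW _ (fun w _ => pc w))
  (integrableZl measurableT _ (integrable_rnorm_pow p1 lf))
  (aeW _ (fun w j _ => dom j w)).
rewrite integral0 in hc.
have [N _ hN] := cvge0_lt hc (powR_gt0 p e0).
exists (t N) => //.
rewrite (Lpn_le_pow P p1 (fun w => t N w - f w) (ltW e0)).
by apply: ltW; exact: (hN N (leqnn N)).
Unshelve. all: by end_near. Qed.

End Approximation.

(** * Jensen inequality along midpoints and zigzag trees *)

Section DyadicJensen.
Context {R : realType} {c : bool} {X : normedModType (scal R c)}.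
Local Notation rs := (real_scal c).
(** [S u z] says that the value [z] is attained at [u]. The relation stands for the function whose
    value at [u] is the supremum of these [z], and [S_mid] for its midpoint concavity; [S_lb] is a
    lower bound on balls. *)
Variable S : X -> R -> Prop.
Hypothesis S_mid : forall u v z1 z2, S (u + v) z1 -> S (u - v) z2 -> S u ((z1 + z2) / 2).
Hypothesis S_lb : forall B, exists2 L, 0 <= L &
  forall u, rnorm u <= B -> exists2 z, - L <= z & S u z.

Lemma real_scal_natr n (x : X) : rs n%:R *: x = x *+ n.
Proof.
elim: n => [|n ih]; first by rewrite real_scal0 scale0r.
by rewrite -natr1 real_scalD scalerDl ih real_scal1 scale1r mulrSr.
Qed.

(** The averages of the two halves of the list are [u + v] and [u - v], where [u] is the overall
    average and [v] half the difference of the two. *)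
Lemma dyadic_midpoint m (s : seq (X * R)) : size s = (2 ^ m)%N ->
  (forall q, q \in s -> S q.1 q.2) ->
  S (rs (2 ^- m) *: \sum_(q <- s) q.1) (2 ^- m * \sum_(q <- s) q.2).
Proof.
elim: m s => [|m ih] s ss hs.
  case: s ss hs => [//|q [|//]] _ hs.
  rewrite !big_seq1 expr0 invr1 real_scal1 scale1r mul1r; apply: hs.
  by rewrite mem_head.
have s1 : size (take (2 ^ m) s) = (2 ^ m)%N.
  by rewrite size_takel// ss leq_exp2l.
have s2 : size (drop (2 ^ m) s) = (2 ^ m)%N.
  by rewrite size_drop ss expnS mul2n -addnn addnK.
have {s1} h1 := ih _ s1 (fun q hq => hs q (mem_take hq)).
have {s2} h2 := ih _ s2 (fun q hq => hs q (mem_drop hq)).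
rewrite -(cat_take_drop (2 ^ m) s) !big_cat/=.
move: h1 h2; set A := \sum_(q <- take _ _) q.1; set B := \sum_(q <- drop _ _) q.1.
set a := \sum_(q <- take _ _) q.2; set b := \sum_(q <- drop _ _) q.2 => h1 h2.
have -> : 2 ^- m.+1 * (a + b) = (2 ^- m * a + 2 ^- m * b) / 2.
  by rewrite exprS invfM; ring.
have E : 2 ^- m = 2 ^- m.+1 + 2 ^- m.+1 :> R by rewrite exprS invfM; field.
have EA (D : X) : rs (2 ^- m.+1) *: (D + D) = rs (2 ^- m) *: D.
  by rewrite E real_scalD scalerDl scalerDr.
apply: (S_mid (v := rs (2 ^- m.+1) *: (A - B))).
  by rewrite -scalerDr addrACA subrr addr0 EA.
by rewrite -scalerBr opprB [A + B + _]addrC addrA subrK EA.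
Qed.

(* The weights are rounded down to multiples of 2^-m; the missing mass is put on
   one point u', which is a convex combination of the u i up to a factor, so that
   the value at u' is bounded below independently of m. *)
Lemma midpoint_jensen (I : eqType) (s : seq I) (w : I -> R) (u : I -> X) (z : I -> R) eta :
  (forall i, i \in s -> 0 <= w i) -> \sum_(i <- s) w i = 1 ->
  \sum_(i <- s) rs (w i) *: u i = 0 -> (forall i, i \in s -> S (u i) (z i)) -> 0 < eta ->
  exists2 z', \sum_(i <- s) w i * z i - eta <= z' & S 0 z'.
Proof.
move=> w0 w1 wu hS eta0.
have [L L0 hL] := S_lb (\sum_(i <- s) rnorm (u i)).
(* Total loss before division by [N = 2 ^ m]: rounding changes each weight by at most one unit,
   which costs [z i] at most once, and at most [size s] units go to the extra point, each worth at
   least [- L]. Hence [m] is chosen with [Z / eta < N]. *)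
pose Z := \sum_(i <- s) `|z i| + (size s)%:R * L.
have Z0 : 0 <= Z by rewrite addr_ge0 ?mulr_ge0// sumr_ge0.
have [m hm] : exists m, Z / eta < 2 ^+ m.
  exists (Num.truncn (Z / eta)).+1; apply: (lt_trans (truncnS_gt _)).
  by rewrite -natrX ltr_nat ltn_expl.
pose N : R := 2 ^+ m.
have N0 : 0 < N by rewrite exprn_gt0.
have hmN : Z / eta < N by [].
pose n i := Num.truncn (N * w i).
have nle i : i \in s -> (n i)%:R <= N * w i.
  by move=> si; rewrite truncn_le mulr_ge0// ?w0// ltW.
have ngt i : N * w i - (n i)%:R <= 1.
  by have := truncnS_gt (N * w i); rewrite -natr1 -/(n i); lra.
have sN : \sum_(i <- s) N * w i = N by rewrite -mulr_sumr w1 mulr1.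
have snle : (\sum_(i <- s) n i <= 2 ^ m)%N.
  rewrite -(ler_nat R) natr_sum natrX -[leRHS]/N -sN big_seq [leRHS]big_seq.
  by apply: ler_sum => i si; exact: nle.
pose k := (2 ^ m - \sum_(i <- s) n i)%N.
have kE : k%:R = \sum_(i <- s) (N * w i - (n i)%:R).
  by rewrite natrB// natrX natr_sum sumrB sN.
have ks : k%:R <= (size s)%:R :> R.
  rewrite kE -sum1_size natr_sum; apply: ler_sum => i _; exact: ngt.
(* The remainders sum to [k], and [k] copies of [u'] restore the sum 0. If [k = 0], then all
   remainders vanish and [u'] is 0, as the inverse of 0 is 0. *)
pose u' := rs k%:R^-1 *: \sum_(i <- s) rs (N * w i - (n i)%:R) *: u i.
have uE : u' *+ k + \sum_(i <- s) (u i) *+ n i = 0.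
  have -> : u' *+ k = \sum_(i <- s) rs (N * w i - (n i)%:R) *: u i.
    rewrite /u' -real_scal_natr scalerA -real_scalM.
    have [k0|k0] := eqVneq (k%:R : R) 0; last by rewrite mulfV// real_scal1 scale1r.
    rewrite k0 mul0r real_scal0 scale0r big_seq big1// => i si.
    suff -> : N * w i - (n i)%:R = 0 by rewrite real_scal0 scale0r.
    move: k0; rewrite kE big_seq => /eqP; rewrite psumr_eq0; last first.
      by move=> j sj; rewrite subr_ge0 nle.
    by move=> /allP/(_ i si)/implyP/(_ si)/eqP.
  rewrite -big_split/= (eq_bigr (fun i => rs N *: (rs (w i) *: u i))).
    by rewrite -scaler_sumr wu scaler0.
  move=> i _; rewrite -real_scal_natr -scalerDl -real_scalD subrK real_scalM.
  by rewrite scalerA.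
have [|z' z'L Sz'] := hL u'.
  rewrite /u' rnormZr ger0_norm ?invr_ge0//.
  have [k0|k0] := posnP k; first by rewrite k0 invr0 mul0r sumr_ge0// => i _; exact: rnorm_ge0.
  have k1 : k%:R^-1 <= 1 :> R by rewrite invf_le1 ?ltr0n// ler1n.
  have h : rnorm (\sum_(i <- s) rs (N * w i - (n i)%:R) *: u i) <= \sum_(i <- s) rnorm (u i).
    apply: le_trans (rnorm_sum _ _ _) _; rewrite big_seq [leRHS]big_seq.
    apply: ler_sum => i si; rewrite rnormZr ger0_norm ?subr_ge0 ?nle//.
    by rewrite ler_piMl ?rnorm_ge0.
  by apply: le_trans h; rewrite ler_piMl ?rnorm_ge0.
pose l := nseq k (u', z') ++ flatten [seq nseq (n i) (u i, z i) | i <- s].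
have lsize : size l = (2 ^ m)%N.
  rewrite size_cat size_nseq size_flatten /shape -map_comp sumnE big_map.
  by under eq_bigr do rewrite /= size_nseq; rewrite subnK.
have lS q : q \in l -> S q.1 q.2.
  rewrite mem_cat => /orP[|/flattenP[_ /mapP[i si ->]]].
    by rewrite mem_nseq => /andP[_ /eqP ->].
  by rewrite mem_nseq => /andP[_ /eqP ->]; exact: hS.
have lsum (V : nmodType) (g : X * R -> V) : \sum_(q <- l) g q =
    g (u', z') *+ k + \sum_(i <- s) g (u i, z i) *+ n i.
  have nseqE j q : \sum_(q' <- nseq j q) g q' = g q *+ j.
    by elim: j => [|j ih]; rewrite ?big_nil ?mulr0n//= big_cons ih mulrS.
  rewrite big_cat/= nseqE big_flatten/= big_map; congr (_ + _).
  by apply: eq_bigr => i _; rewrite nseqE.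
have := dyadic_midpoint lsize lS; rewrite !lsum/= uE scaler0 => Sl.
eexists; last exact: Sl.
rewrite -[2 ^- m]/(N^-1) [leRHS]mulrC ler_pdivlMr//.
have h1 : N * \sum_(i <- s) w i * z i - \sum_(i <- s) `|z i| <= \sum_(i <- s) z i *+ n i.
  rewrite lerBlDr mulr_sumr -big_split/= big_seq [leRHS]big_seq.
  apply: ler_sum => i si; rewrite -mulr_natr mulrA.
  have : (N * w i - (n i)%:R) * z i <= `|z i|.
    rewrite (le_trans (ler_norm _))// normrM ler_piMl// ger0_norm ?subr_ge0 ?nle//.
  by rewrite mulrBl (mulrC _%:R); lra.
have h2 : - ((size s)%:R * L) <= z' *+ k.
  rewrite -mulr_natr; have := ler_wpM2r L0 ks.
  have := ler_wpM2r (ler0n R k) z'L; lra.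
have h3 : Z <= N * eta by rewrite -ler_pdivrMr// ltW.
move: h1 h2 h3; rewrite /Z mulrBl (mulrC (\sum_(i <- s) w i * z i)) (mulrC eta); lra.
Qed.

End DyadicJensen.

(** * Bellman gains and zigzag trees *)

Section Zigzag.
Context {R : realType} {c : bool} {X : normedModType (scal R c)}.
Local Notation K := (scal R c).
Variables (p C : R).
Hypothesis p1 : 1 < p.

Definition bellman_gain (x y : X) : R := rnorm y `^ p - C `^ p * rnorm x `^ p.

Lemma bellman_gain_lb x e y B : exists2 L, 0 <= L &
  forall u, rnorm u <= B -> - L <= bellman_gain (x + u) (y + e *: u).
Proof.
exists (C `^ p * (rnorm x + B) `^ p); first by rewrite mulr_ge0 ?powR_ge0.
move=> u uB; have p0 : 0 <= p by rewrite ltW// (lt_trans ltr01).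
rewrite /bellman_gain -[leLHS]sub0r lerB ?powR_ge0// ler_wpM2l ?powR_ge0//.
have h : rnorm (x + u) <= rnorm x + B by apply: le_trans (rnormD _ _) _; rewrite lerD2l.
by rewrite ge0_ler_powR ?nnegrE ?rnorm_ge0//; exact: le_trans (rnorm_ge0 _) h.
Qed.

(* Values of finite zigzag trees: from (x, y) one moves by +-(v, e v), e in E, each
   sign with probability 1/2; the supremum of these values is the zigzag-concave
   (Burkholder) majorant of the gain. *)
Inductive zigzag (E : set K) : X -> X -> R -> Prop :=
| zigzag_leaf x y : zigzag E x y (bellman_gain x y)
| zigzag_node e v x y z1 z2 : E e -> zigzag E (x + v) (y + e *: v) z1 ->
    zigzag E (x - v) (y - e *: v) z2 -> zigzag E x y ((z1 + z2) / 2).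

(* Same trees, but the multipliers are the terms of the sequence a, used at
   increasing times after n. *)
Inductive timed_zigzag (a : nat -> K) : nat -> X -> X -> R -> Prop :=
| timed_leaf n x y : timed_zigzag a n x y (bellman_gain x y)
| timed_node n m v x y z1 z2 : (n < m)%N ->
    timed_zigzag a m (x + v) (y + a m *: v) z1 ->
    timed_zigzag a m (x - v) (y - a m *: v) z2 -> timed_zigzag a n x y ((z1 + z2) / 2).

(** Leaf values are continuous in the second coordinate, and a finite tree has finitely many leaves,
    so one tolerance [rho] serves the whole tree. The first coordinate is reproduced exactly; only
    [y] is perturbed, by the errors [(a m - e) *: v] accumulated along a branch. *)
Lemma zigzag_timed E a :
  (forall e, E e -> forall n rho, 0 < rho -> exists2 m, (n < m)%N & snorm (a m - e) < rho) ->
  forall x y z, zigzag E x y z -> forall delta, 0 < delta -> exists2 rho, 0 < rho &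
    forall n y', rnorm (y' - y) < rho ->
      exists2 z', z - delta <= z' & timed_zigzag a n x y' z'.
Proof.
move=> dens x y z; elim => {x y z} [x y|e v x y z1 z2 Ee _ ih1 _ ih2] delta delta0.
  have [rho rho0 hrho] := powR_continuous_ge0 p1 (rnorm_ge0 y) delta0.
  exists rho => // n y' y'y; exists (bellman_gain x y'); last exact: timed_leaf.
  have := hrho _ (rnorm_ge0 y') (le_lt_trans (rnorm_dist _ _) y'y).
  rewrite ltr_norml /bellman_gain => /andP[+ _]; lra.
have [r1 r10 h1] := ih1 _ delta0; have [r2 r20 h2] := ih2 _ delta0.
(* Half of the children's tolerance is left for the error present at this node, half for the error
   of the new multiplier. *)
pose r := Num.min r1 r2 / 2.
have r0 : 0 < r by rewrite divr_gt0// lt_min r10.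
exists r => // n y' y'y.
have v1 : 0 < rnorm v + 1 by have := rnorm_ge0 v; lra.
have [m nm hm] := dens e Ee n (r / (rnorm v + 1)) (divr_gt0 r0 v1).
have hv : rnorm ((a m - e) *: v) < r.
  rewrite rnormZ; move: hm; rewrite ltr_pdivlMr//; apply: le_lt_trans.
  by rewrite ler_wpM2l ?snorm_ge0// lerDl.
have r12 : r + r = Num.min r1 r2 by rewrite /r; lra.
have [rr1 rr2] : r + r <= r1 /\ r + r <= r2 by rewrite r12 !ge_min !lexx orbT.
have [|z1' z1z hz1] := h1 m (y' + a m *: v).
  rewrite opprD addrACA -scalerBl (le_lt_trans (rnormD _ _))//; lra.
have [|z2' z2z hz2] := h2 m (y' - a m *: v).
  rewrite opprD addrACA -opprD -scalerBl (le_lt_trans (rnormB _ _))//; lra.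
exists ((z1' + z2') / 2); first by lra.
exact: timed_node nm hz1 hz2.
Qed.

(** With [e] fixed, the states [(x + u, y + e *: u)] form an affine family in [u] in which a step by
    [v] is a tree step with multiplier [e]; this is the midpoint rule. The local lower bound comes
    from the tree that is a single leaf. *)
Lemma zigzag_jensen (E : set K) e x y (I : eqType) (s : seq I) (w : I -> R) (u : I -> X)
    (z : I -> R) eta : E e ->
  (forall i, i \in s -> 0 <= w i) -> \sum_(i <- s) w i = 1 ->
  \sum_(i <- s) real_scal c (w i) *: u i = 0 ->
  (forall i, i \in s -> zigzag E (x + u i) (y + e *: u i) (z i)) -> 0 < eta ->
  exists2 z', \sum_(i <- s) w i * z i - eta <= z' & zigzag E x y z'.
Proof.
move=> Ee w0 w1 wu hz eta0.
pose S u z := zigzag E (x + u) (y + e *: u) z.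
have S_mid u' v z1 z2 : S (u' + v) z1 -> S (u' - v) z2 -> S u' ((z1 + z2) / 2).
  rewrite /S !scalerDr scalerN !addrA; exact: zigzag_node.
have S_lb B : exists2 L, 0 <= L & forall u', rnorm u' <= B -> exists2 z', - L <= z' & S u' z'.
  have [L L0 hL] := bellman_gain_lb x e y B; exists L => // u' /hL uB.
  by eexists; [exact: uB|exact: zigzag_leaf].
have [z' zz' Sz'] := midpoint_jensen S_mid S_lb w0 w1 wu hz eta0.
by exists z' => //; move: Sz'; rewrite /S scaler0 !addr0.
Qed.

End Zigzag.

(** * Zigzag trees as martingales driven by fair coins *)

Section SimpleIntegrals.
Context {R : realType} {d : measure_display} {Omega : measurableType d}.
Variable P : probability Omega R.

Definition prob (B : set Omega) : R := fine (P B).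

Lemma probE B : measurable B -> (prob B)%:E = P B.
Proof. by move=> mB; rewrite /prob fineK// fin_num_measure. Qed.

Lemma prob_ge0 B : 0 <= prob B.
Proof. by rewrite /prob fine_ge0. Qed.

Lemma simple_integrable U (g : Omega -> U) (phi : U -> R) H : simple_fun measurable g ->
  measurable H -> P.-integrable H (EFin \o (fun w => phi (g w))).
Proof.
move=> sg mH; have [M M0 hM] := simple_fun_bounded (fun u => `|phi u|) sg.
apply: measurable_bounded_integrable => //.
- by rewrite (le_lt_trans (probability_le1 P mH))// ltry.
- exact: (measurable_funS measurableT (@subsetT _ H) (simple_fun_measurable phi sg)).
- exists M; split; first exact: num_real.
  by move=> x Mx w _; apply: le_trans (ltW Mx); exact: hM.
Qed.

Lemma Rintegral_split S B (f : Omega -> R) : measurable S -> measurable B ->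
  P.-integrable B (EFin \o f) ->
  \int[P]_(w in B) f w = \int[P]_(w in S `&` B) f w + \int[P]_(w in ~` S `&` B) f w.
Proof.
move=> mS mB fB; rewrite -Rintegral_setU.
- by rewrite -setIUl setUv setTI.
- exact: measurableI.
- by apply: measurableI => //; exact: measurableC.
- by rewrite -setIUl setUv setTI.
- apply/disj_setPS => w [[Sw _] [nSw _]]; exact: nSw.
Qed.

Lemma Rintegral_const B (k : R) : measurable B -> \int[P]_(w in B) k = k * prob B.
Proof. by move=> mB; rewrite Rintegral_cst. Qed.

End SimpleIntegrals.

(** A coin is encoded by one event, the complement being its other face. This absorbs the null set
    on which a Rademacher variable is neither 1 nor -1. *)
Definition fair_coins {R : realType} {d : measure_display} {Omega : measurableType d}
    (P : probability Omega R) (F : nat -> set (set Omega)) (S : nat -> set Omega) :=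
  forall n, (0 < n)%N -> F n (S n) /\ forall B, F n.-1 B ->
    prob P (S n `&` B) = 2^-1 * prob P B /\ prob P (~` S n `&` B) = 2^-1 * prob P B.

Section TreeEmbedding.
Context {R : realType} {c : bool} {X : normedModType (scal R c)}.
Local Notation K := (scal R c).
Context {d : measure_display} {Omega : measurableType d}.
Variable P : probability Omega R.
Variables (F : nat -> set (set Omega)) (S : nat -> set Omega) (p C : R).
Hypothesis hF : is_filtration F.
Hypothesis hS : fair_coins P F S.

Let sF n : sigma_algebra setT (F n). Proof. by case: hF. Qed.
Let Fm n : F n `<=` measurable. Proof. by case: hF => _ h _; exact: h. Qed.
Let Fle n m : (n <= m)%N -> F n `<=` F m. Proof. by case: hF => _ _; apply. Qed.

Lemma timed_zigzag_process (a : nat -> K) n (x y : X) z : timed_zigzag p C a n x y z ->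
  exists D : nat -> Omega -> X, exists M : nat,
  [/\ forall i, simple_fun (F i) (D i),
   forall i, (i <= n)%N || (M < i)%N -> D i = fun=> 0,
   forall i, (0 < i)%N -> forall psi, real_functional psi -> forall B, F i.-1 B ->
     \int[P]_(w in B) psi (D i w) = 0 &
   forall B M', F n B -> (M <= M')%N ->
     \int[P]_(w in B) bellman_gain p C (x + \sum_(1 <= i < M'.+1) D i w)
        (y + \sum_(1 <= i < M'.+1) a i *: D i w) = z * prob P B].
Proof.
elim=> {n x y z} [n x y|n m v x y z1 z2 nm _ [D1 [M1 [s1 n1 i1 h1]]] _ [D2 [M2 [s2 n2 i2 h2]]]].
  exists (fun _ _ => 0), 0%N; split => //.
  - by move=> i; exact: simple_cst.
  - move=> i i0 psi hpsi B FB; under eq_Rintegral do rewrite real_functional0//.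
    by rewrite Rintegral_const ?mul0r//; exact: Fm FB.
  - move=> B M' FB _.
    under eq_Rintegral => w _.
      rewrite big1// addr0 big1 ?addr0; last by move=> i _; rewrite scaler0.
    over.
    by rewrite Rintegral_const//; exact: Fm FB.
have m0 : (0 < m)%N by exact: leq_ltn_trans nm.
have [FS hSB] := hS m0.
have mS := Fm FS.
pose D i w := if (i < m)%N then 0 : X else if i == m then (if `[< S m w >] then v else - v)
  else if `[< S m w >] then D1 i w else D2 i w.
have DS i w : S m w -> D i w = if i == m then v else D1 i w.
  move=> Sw; rewrite /D; case: ltnP => im; last by case: asboolP.
  by rewrite ltn_eqF// n1// ltnW.
have DSC i w : ~ S m w -> D i w = if i == m then - v else D2 i w.
  move=> Sw; rewrite /D; case: ltnP => im; last by case: asboolP.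
  by rewrite ltn_eqF// n2// ltnW.
have sD i : simple_fun (F i) (D i).
  rewrite /D; case: ltnP => im; first exact: (simple_cst (sF i)).
  have FSi : F i (S m) by exact: Fle im _ FS.
  case: eqP => _; first by apply: (simple_if (sF i)) => //; exact: (simple_cst (sF i)).
  exact: simple_if.
have sDm i : simple_fun measurable (D i) by exact: simple_sub (sD i).
exists D, (maxn m (maxn M1 M2)); split => //.
- move=> i /orP[inn|]; first by apply/funext => w; rewrite /D (leq_ltn_trans inn nm).
  rewrite !gtn_max => /and3P[mi M1i M2i]; apply/funext => w; rewrite /D ltnNge (ltnW mi)/=.
  by rewrite gtn_eqF// n1 ?M1i ?orbT// n2 ?M2i ?orbT//; case: asboolP.
- move=> i i0 psi hpsi B FB; have mB := Fm FB.
  rewrite (Rintegral_split mS mB); last exact: (simple_integrable _ psi (sDm i)).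
  have -> : \int[P]_(w in S m `&` B) psi (D i w) =
            \int[P]_(w in S m `&` B) psi (if i == m then v else D1 i w).
    by apply: eq_Rintegral => w; rewrite inE => -[Sw _]; rewrite DS.
  have -> : \int[P]_(w in ~` S m `&` B) psi (D i w) =
            \int[P]_(w in ~` S m `&` B) psi (if i == m then - v else D2 i w).
    by apply: eq_Rintegral => w; rewrite inE => -[Sw _]; rewrite DSC.
  have [im|im] := eqVneq i m.
    rewrite im in FB; have [hB1 hB2] := hSB _ FB.
    rewrite !Rintegral_const ?hB1 ?hB2 ?real_functionalN ?mulNr ?subrr//.
    + by apply: measurableI => //; exact: measurableC.
    + exact: measurableI.
  have [mi|mi] := ltnP m i; last first.
    rewrite n1 ?mi// n2 ?mi// real_functional0// !Rintegral_const ?mul0r ?addr0//.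
    + by apply: measurableI => //; exact: measurableC.
    + exact: measurableI.
  have FSi : F i.-1 (S m) by apply: Fle FS; rewrite -ltnS prednK.
  rewrite i1// ?i2// ?addr0//; first by apply: (sigma_algI (sF _)) => //; exact: (sigma_algC (sF _)).
  exact: (sigma_algI (sF _)).
- move=> B M' FB; rewrite !geq_max => /and3P[mM' M1M' M2M'].
  have mB := Fm FB.
  have FmB : F m B by exact: Fle (ltnW nm) _ FB.
  have FB' : F m.-1 B by apply: Fle FB; rewrite -ltnS prednK.
  have [hB1 hB2] := hSB _ FB'.
  have sumE (u : X) (b : nat -> K) (E : nat -> X) : E m = 0 ->
      \sum_(1 <= i < M'.+1) b i *: (if i == m then u else E i) =
      b m *: u + \sum_(1 <= i < M'.+1) b i *: E i.
    move=> Em; have mi : m \in index_iota 1 M'.+1 by rewrite mem_index_iota m0 ltnS.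
    rewrite !(bigD1_seq m)//= ?iota_uniq// eqxx Em scaler0 add0r; congr (_ + _).
    by apply: eq_bigr => i /negbTE ->.
  have sumE1 (u : X) (E : nat -> X) : E m = 0 ->
      \sum_(1 <= i < M'.+1) (if i == m then u else E i) = u + \sum_(1 <= i < M'.+1) E i.
    move=> Em; have := sumE u (fun=> 1) E Em; rewrite scale1r.
    by under eq_bigr do rewrite scale1r; under [in RHS]eq_bigr do rewrite scale1r.
  rewrite (Rintegral_split mS mB); last first.
    apply: (@simple_integrable _ _ _ P _
      (fun w => (\sum_(1 <= i < M'.+1) D i w, \sum_(1 <= i < M'.+1) a i *: D i w))
      (fun q => bellman_gain p C (x + q.1) (y + q.2))) => //.
    apply: (simple_pair (@sigma_algebra_measurable _ Omega)).
      by apply: (simple_sum (@sigma_algebra_measurable _ Omega)).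
    apply: (simple_sum (@sigma_algebra_measurable _ Omega)) => i _.
    exact: (simple_comp (@sigma_algebra_measurable _ Omega) ( *:%R (a i))).
  rewrite (_ : \int[P]_(w in S m `&` B) _ = z1 * prob P (S m `&` B)); last first.
    have FSB : F m (S m `&` B) by exact: (sigma_algI (sF _)).
    apply: (etrans _ (h1 _ _ FSB M1M')).
    apply: eq_Rintegral => w; rewrite inE => -[Sw _].
    rewrite (eq_bigr _ (fun i _ => DS i w Sw)).
    rewrite (eq_bigr _ (fun i _ => congr1 ( *:%R (a i)) (DS i w Sw))).
    by rewrite sumE1 ?n1 ?leqnn// sumE ?n1 ?leqnn// !addrA.
  rewrite (_ : \int[P]_(w in ~` S m `&` B) _ = z2 * prob P (~` S m `&` B)); last first.
    have FSB : F m (~` S m `&` B).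
      by apply: (sigma_algI (sF _)) => //; exact: (sigma_algC (sF _)).
    apply: (etrans _ (h2 _ _ FSB M2M')).
    apply: eq_Rintegral => w; rewrite inE => -[Sw _].
    rewrite (eq_bigr _ (fun i _ => DSC i w Sw)).
    rewrite (eq_bigr _ (fun i _ => congr1 ( *:%R (a i)) (DSC i w Sw))).
    by rewrite sumE1 ?n2 ?leqnn// sumE ?n2 ?leqnn// scalerN !addrA.
  by rewrite hB1 hB2; field.
Qed.

End TreeEmbedding.

(** * From the operator norm to zigzag trees *)

Section GainIntegral.
Context {R : realType} {c : bool} {X : normedModType (scal R c)}.
Context {d : measure_display} {Omega : measurableType d}.
Variable P : probability Omega R.
Variables (p C : R).
Hypothesis p1 : 1 < p.
Implicit Types f g : Omega -> X.

Let p0 : 0 < p. Proof. exact: lt_trans ltr01 p1. Qed.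

Lemma EFin_Rintegral B (f : Omega -> R) : measurable B -> P.-integrable B (EFin \o f) ->
  (\int[P]_(w in B) (f w)%:E = (\int[P]_(w in B) f w)%R%:E)%E.
Proof. by move=> mB fB; rewrite /Rintegral fineK//; exact: integrable_fin_num. Qed.

Lemma Rintegral_rnorm_pow f : in_Lp P p f ->
  \int[P]_w (rnorm (f w) `^ p) = fine (Lpn P p f) `^ p.
Proof.
move=> lf; apply: EFin_inj; rewrite -poweR_EFin (fineK (Lpn_fin_num lf)) Lpn_pow//.
by rewrite EFin_Rintegral//; exact: integrable_rnorm_pow.
Qed.

Lemma Rintegral_gain f g : in_Lp P p f -> in_Lp P p g ->
  \int[P]_w bellman_gain p C (f w) (g w) =
  fine (Lpn P p g) `^ p - C `^ p * fine (Lpn P p f) `^ p.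
Proof.
move=> lf lg; rewrite -!Rintegral_rnorm_pow// -RintegralZl//; last first.
  exact: integrable_rnorm_pow.
rewrite -RintegralB//; first exact: integrable_rnorm_pow.
apply: (@eq_integrable _ _ _ P setT measurableT
  (fun w => ((C `^ p)%:E * (rnorm (f w) `^ p)%:E)%E)) => //.
by apply: integrableZl => //; exact: integrable_rnorm_pow.
Qed.

Lemma gain_le0 f g : 0 <= C -> in_Lp P p f -> in_Lp P p g ->
  (\int[P]_w bellman_gain p C (f w) (g w) <= 0) = (Lpn P p g <= C%:E * Lpn P p f)%E.
Proof.
move=> C0 lf lg; rewrite Rintegral_gain//.
have f0 : 0 <= fine (Lpn P p f) by rewrite fine_ge0// Lpn_ge0.
have g0 : 0 <= fine (Lpn P p g) by rewrite fine_ge0// Lpn_ge0.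
rewrite -(fineK (Lpn_fin_num lf)) -(fineK (Lpn_fin_num lg)) -EFinM lee_fin subr_le0.
rewrite -powRM//; apply/idP/idP => h.
  rewrite leNgt; apply/negP => /(gt0_ltr_powR p0).
  by rewrite !nnegrE mulr_ge0// => /(_ isT g0); rewrite ltNge h.
by rewrite ge0_ler_powR ?nnegrE ?mulr_ge0// ltW.
Qed.

End GainIntegral.

Section OpnormBound.
Context {R : realType} {c : bool} {X : normedModType (scal R c)}.
Local Notation K := (scal R c).
Context {d : measure_display} {Omega : measurableType d}.
Variable P : probability Omega R.
Variables (F : nat -> set (set Omega)) (p C : R) (a : nat -> K).
Hypothesis p1 : 1 < p.
Hypothesis C0 : 0 <= C.
Hypothesis hF : is_filtration F.
Hypothesis hC : (opnorm_TA (X := X) P F p a <= C%:E)%E.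

Let p0 : 0 < p. Proof. exact: lt_trans ltr01 p1. Qed.
Let sF n : sigma_algebra setT (F n). Proof. by case: hF. Qed.
Let Fm n : F n `<=` measurable. Proof. by case: hF => _ h _; exact: h. Qed.
Let Fle n m : (n <= m)%N -> F n `<=` F m. Proof. by case: hF => _ _; apply. Qed.

Definition simple_mds (D : nat -> Omega -> X) (M : nat) :=
  [/\ forall i, simple_fun (F i) (D i),
   forall i, (M < i)%N -> D i = fun=> 0 &
   forall i, (0 < i)%N -> forall psi, real_functional psi -> forall B, F i.-1 B ->
     \int[P]_(w in B) psi (D i w) = 0].

Lemma Lp_limit_eventually (f : nat -> Omega -> X) M g : in_Lp P p g ->
  (forall n, (M <= n)%N -> f n = g) -> Lp_limit P p f g.
Proof.
move=> lg fg; split => //; apply: cvg_near_cst; exists M => // n /= Mn.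
rewrite fg//; under [X in Lpn _ _ X]eq_fun do rewrite subrr.
exact: Lpn0.
Qed.

(** The partial sums of [D] start at 0 and are constant from time [M] on, so both they and their
    transform converge in L^p trivially, and the supremum defining the operator norm applies to
    them. *)
Lemma opnorm_simple_mds_unit D M : simple_mds D M ->
  (Lpn P p (fun w => (\sum_(1 <= i < M.+1) D i w)%R) <= 1)%E ->
  (Lpn P p (fun w => (\sum_(1 <= i < M.+1) a i *: D i w)%R) <= C%:E)%E.
Proof.
move=> [sD D0 iD] g1.
pose f n w := \sum_(1 <= i < n.+1) D i w.
have sf n : simple_fun (F n) (f n).
  apply: (simple_sum (sF n)) => i; rewrite mem_index_iota ltnS => /andP[_ il].
  exact: simple_sub (Fle il) (sD i).
have lD i : in_Lp P p (D i) by exact: (simple_in_Lp P p1 (@Fm i) (sD i)).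
have lf n : in_Lp P p (f n) by exact: (simple_in_Lp P p1 (@Fm n) (sf n)).
have fS n : f n.+1 = fun w => f n w + D n.+1 w.
  by apply/funext => w; rewrite /f big_nat_recr.
have f0 : f 0%N = fun=> 0 by apply/funext => w; rewrite /f big_geq.
have TAE n : TA a f n = fun w => \sum_(1 <= i < n.+1) a i *: D i w.
  apply/funext => w; rewrite /TA f0 scaler0 add0r; apply: eq_big_nat => i /andP[i1 _].
  by case: i i1 => // i _; rewrite fS /= addrAC subrr add0r.
have sumE (b : nat -> K) n w : (M <= n)%N ->
    \sum_(1 <= i < n.+1) b i *: D i w = \sum_(1 <= i < M.+1) b i *: D i w.
  move=> Mn; rewrite (@big_cat_nat _ _ _ M.+1)//= [X in _ + X]big_nat [X in _ + X]big1 ?addr0// => i /andP[Mi _].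
  by rewrite D0// scaler0.
have fE n : (M <= n)%N -> f n = f M.
  move=> Mn; apply/funext => w; have := sumE (fun=> 1) n w Mn.
  by under eq_bigr do rewrite scale1r; under [in RHS]eq_bigr do rewrite scale1r.
have limf : Lp_limit P p f (f M) := Lp_limit_eventually (lf M) fE.
have Mf : Mdis P F p f.
  split; last by exists (f M).
  split => [n|[//|n] _ psi hpsi B FB]; first by split => //; exact: strongly_measurable_simple.
  have mB := Fm FB.
  rewrite !EFin_Rintegral//; last 2 first.
  - exact: simple_integrable (simple_sub (@Fm n) (sf n)) mB.
  - exact: simple_integrable (simple_sub (@Fm n.+1) (sf n.+1)) mB.
  rewrite fS; under eq_Rintegral do rewrite (proj1 hpsi).
  rewrite RintegralD// ?iD ?addr0//.
  - exact: simple_integrable (simple_sub (@Fm n) (sf n)) mB.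
  - exact: simple_integrable (simple_sub (@Fm n.+1) (sD n.+1)) mB.
apply: le_trans hC; apply: ereal_sup_ubound.
exists f; split => //; split; first by exists (f M).
left; exists (fun w => \sum_(1 <= i < M.+1) a i *: D i w); split => //.
apply: (Lp_limit_eventually (M := M)).
  by apply: (in_Lp_sum p1) => i _; exact: in_LpZ.
by move=> n Mn; rewrite TAE; apply/funext => w; exact: sumE.
Qed.

(** The operator norm is a supremum over the unit ball; homogeneity extends the bound to all
    norms. *)
Lemma opnorm_simple_mds D M : simple_mds D M ->
  (Lpn P p (fun w => (\sum_(1 <= i < M.+1) a i *: D i w)%R) <=
   C%:E * Lpn P p (fun w => (\sum_(1 <= i < M.+1) D i w)%R))%E.
Proof.
move=> hD; have [sD D0 iD] := hD.
have lD i : in_Lp P p (D i) by exact: (simple_in_Lp P p1 (@Fm i) (sD i)).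
set g := (X in (_ <= _ * Lpn _ _ X)%E); set h := (X in (Lpn _ _ X <= _)%E).
have lg : in_Lp P p g by apply: (in_Lp_sum p1).
have lh : in_Lp P p h by apply: (in_Lp_sum p1) => i _; exact: in_LpZ.
have scaled t : 0 < t -> t * fine (Lpn P p g) <= 1 -> t * fine (Lpn P p h) <= C.
  move=> t0 tg.
  have hDt : simple_mds (fun i w => real_scal c t *: D i w) M.
    split => [i|i Mi|i i0 psi hpsi B FB].
    - exact: (simple_comp (sF i) ( *:%R (real_scal c t)) (sD i)).
    - by rewrite D0//; apply/funext => w; rewrite scaler0.
    - exact: (iD i i0 _ (real_functionalZ _ hpsi)).
  have := opnorm_simple_mds_unit hDt.
  rewrite (_ : (fun w => _) = fun w => real_scal c t *: g w); last first.
    by apply/funext => w; rewrite /g scaler_sumr.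
  rewrite (_ : (fun w => \sum_(_ <= _ < _) a _ *: _) = fun w => real_scal c t *: h w); last first.
    apply/funext => w; rewrite /h scaler_sumr; apply: eq_bigr => i _.
    by rewrite !scalerA mulrC.
  rewrite !LpnZ//; [|by case: lh|by case: lg].
  rewrite snorm_real gtr0_norm// -(fineK (Lpn_fin_num lg)) -(fineK (Lpn_fin_num lh)).
  by rewrite -!EFinM !lee_fin; apply.
rewrite -(fineK (Lpn_fin_num lg)) -(fineK (Lpn_fin_num lh)) -EFinM lee_fin.
have g0 : 0 <= fine (Lpn P p g) by rewrite fine_ge0// Lpn_ge0.
have h0 : 0 <= fine (Lpn P p h) by rewrite fine_ge0// Lpn_ge0.
have [gz|gz] := eqVneq (fine (Lpn P p g)) 0.
  rewrite gz mulr0 leNgt; apply/negP => hp.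
  (* If [g] has norm 0, every multiple of [D] lies in the unit ball; this factor would give its
     transform the norm [C + 1]. *)
  have tp : 0 < (C + 1) / fine (Lpn P p h) by rewrite divr_gt0// ltr_wpDl.
  have := scaled _ tp; rewrite gz mulr0 => /(_ ler01).
  by rewrite divfK ?gt_eqF// => ?; lra.
have gp : 0 < fine (Lpn P p g) by rewrite lt_neqAle eq_sym gz.
have := scaled (fine (Lpn P p g))^-1; rewrite invr_gt0 gp mulVf// => /(_ isT (lexx _)).
by rewrite mulrC ler_pdivrMr.
Qed.

(** The loss [delta] accounts for replacing exact multipliers by terms of [a]. The perturbed tree
    also starts at (0, 0), and its value is the mean gain of a martingale of the given filtration,
    which the operator norm makes nonpositive. *)
Lemma zigzag_le0 (S : nat -> set Omega) (E : set K) : fair_coins P F S ->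
  (forall e, E e -> forall n rho, 0 < rho -> exists2 m, (n < m)%N & snorm (a m - e) < rho) ->
  forall z, zigzag (X := X) p C E 0 0 z -> z <= 0.
Proof.
move=> hS dens z hz; apply/ler_addgt0Pl => delta delta0; rewrite addr0.
have [rho rho0 /(_ 0%N 0)] := zigzag_timed p1 dens hz delta0.
rewrite subr0 rnorm0 => /(_ rho0)[z' zz' /(timed_zigzag_process hF hS)].
move=> [D [M [sD D0 iD /(_ setT M (sigma_algT (sF 0)) (leqnn M))]]].
have hD : simple_mds D M by split => // i Mi; apply: D0; rewrite Mi orbT.
have lD i : in_Lp P p (D i) by exact: (simple_in_Lp P p1 (@Fm i) (sD i)).
under eq_Rintegral do rewrite !add0r.
rewrite (_ : prob P setT = 1) ?mulr1; last by rewrite /prob probability_setT.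
move=> z'E; suff : z' <= 0 by lra.
rewrite -z'E gain_le0//; first exact: opnorm_simple_mds.
- by apply: (in_Lp_sum p1).
- by apply: (in_Lp_sum p1) => i _; exact: in_LpZ.
Qed.

End OpnormBound.

(** * From zigzag trees to simple martingales *)

Section Partition.
Context {R : realType} {d : measure_display} {Omega : measurableType d}.
Variable P : probability Omega R.

Lemma Rintegral_partition (T : choiceType) (g : Omega -> T) (phi : Omega -> R) H :
  simple_fun measurable g -> measurable H -> P.-integrable H (EFin \o phi) ->
  \int[P]_(w in H) phi w =
  \sum_(v <- fset_set (range g)) \int[P]_(w in H `&` g @^-1` [set v]) phi w.
Proof.
move=> sg mH iH; have [fg mg] := sg.
have mpre Y : measurable (H `&` g @^-1` Y).
  apply: measurableI => //.
  exact: (simple_preimage (@sigma_algebra_measurable _ Omega) Y sg).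
have aux (s : seq T) : uniq s -> \int[P]_(w in H `&` g @^-1` [set` s]) phi w =
    \sum_(v <- s) \int[P]_(w in H `&` g @^-1` [set v]) phi w.
  elim: s => [_|v s ih /= /andP[vs us]].
    rewrite big_nil (_ : _ `&` _ = set0) ?Rintegral_set0//.
    by rewrite -subset0 => w [_].
  rewrite big_cons -ih// -Rintegral_setU//; last 2 first.
  - apply: integrableS iH => //; last by move=> w [[]|[]].
    by apply: measurableU; exact: mpre.
  - apply/disj_setPS => w [[_ /= wv] [_ /=]]; rewrite wv => sv.
    by move: vs; rewrite sv.
  - by rewrite -setIUr; congr (\int[P]_(w in _ `&` _) phi w); rewrite predeqE => w;
      rewrite /= in_cons; split => [/orP[/eqP|]|[->|->]]; rewrite ?eqxx ?orbT//; [left|right].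
rewrite -aux ?fset_uniq//; congr (\int[P]_(w in _) phi w).
rewrite predeqE => w; split => [Hw|[]//]; split => //=.
by rewrite in_fset_set//; apply/mem_set; exists w.
Qed.

Lemma prob_partition (T : choiceType) (g : Omega -> T) H :
  simple_fun measurable g -> measurable H ->
  prob P H = \sum_(v <- fset_set (range g)) prob P (H `&` g @^-1` [set v]).
Proof.
move=> sg mH; have [fg mg] := sg.
rewrite -[LHS]mul1r -Rintegral_const// (Rintegral_partition sg)//.
  by apply: eq_bigr => v _; rewrite Rintegral_const ?mul1r//; exact: measurableI.
exact: finite_measure_integrable_cst.
Qed.

Lemma Rintegral_null U (g : Omega -> U) (phi : U -> R) H : simple_fun measurable g ->
  measurable H -> prob P H = 0 -> \int[P]_(w in H) phi (g w) = 0.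
Proof.
move=> sg mH H0; have [M M0 hM] := simple_fun_bounded (fun u => `|phi u|) sg.
have iphi := simple_integrable P phi sg mH.
apply/eqP; rewrite -normr_le0; apply: (le_trans (le_normr_Rintegral mH iphi)).
have -> : (0 : R) = \int[P]_(w in H) M by rewrite Rintegral_const// H0 mulr0.
apply: le_Rintegral => //.
- exact: (simple_integrable P (fun u => `|phi u|) sg mH).
- exact: finite_measure_integrable_cst.
Qed.

Context {c : bool} {X : normedModType (scal R c)}.
Local Notation rs := (real_scal c).

(* The Bochner integral over H of a simple function. *)
Definition simple_int (g : Omega -> X) (H : set Omega) : X :=
  \sum_(v <- fset_set (range g)) rs (prob P (H `&` g @^-1` [set v])) *: v.

(** The link between vector-valued integrals and the weak integrals of the martingale condition. *)
Lemma functional_simple_int (g : Omega -> X) H (psi : X -> R) : simple_fun measurable g ->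
  measurable H -> real_functional psi ->
  (forall t x, 0 <= t -> psi (rs t *: x) = t * psi x) ->
  psi (simple_int g H) = \int[P]_(w in H) psi (g w).
Proof.
move=> sg mH hpsi psiZ; have [_ mg] := sg.
rewrite real_functional_sum// (Rintegral_partition sg)//; last exact: (simple_integrable P psi sg mH).
apply: eq_bigr => v _; rewrite psiZ ?prob_ge0// mulrC.
rewrite -Rintegral_const; last exact: measurableI.
by apply: eq_Rintegral => w; rewrite inE => -[_ /= ->].
Qed.

End Partition.

Section SimpleMartingaleGain.
Context {R : realType} {c : bool} {X : normedModType (scal R c)}.
Local Notation K := (scal R c).
Context {d : measure_display} {Omega : measurableType d}.
Variable P : probability Omega R.
Variables (p C : R) (E : set K) (N : nat).
Variables (dd : nat -> Omega -> X) (eps : nat -> K) (HH : nat -> set (set Omega)).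
Hypothesis p1 : 1 < p.
Hypothesis dd_simple : forall i, simple_fun measurable (dd i).
Hypothesis epsE : forall i, (1 <= i <= N)%N -> E (eps i).
Hypothesis HH_measurable : forall i, HH i `<=` measurable.
Hypothesis HH_split : forall i H v, HH i H -> HH i.+1 (H `&` dd i.+1 @^-1` [set v]).
Hypothesis HH_mean0 : forall i H, (i < N)%N -> HH i H -> simple_int P (dd i.+1) H = 0.

Let tail_integrable j x y H : measurable H -> P.-integrable H (EFin \o (fun w =>
  bellman_gain p C (x + \sum_(j <= i < N.+1) dd i w)
                   (y + \sum_(j <= i < N.+1) eps i *: dd i w))).
Proof.
apply: (@simple_integrable _ _ _ P _
  (fun w => (\sum_(j <= i < N.+1) dd i w, \sum_(j <= i < N.+1) eps i *: dd i w))
  (fun q => bellman_gain p C (x + q.1) (y + q.2))) => //.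
apply: (simple_pair (@sigma_algebra_measurable _ Omega)).
  by apply: (simple_sum (@sigma_algebra_measurable _ Omega)).
apply: (simple_sum (@sigma_algebra_measurable _ Omega)) => i _.
exact: (simple_comp (@sigma_algebra_measurable _ Omega) ( *:%R (eps i))).
Qed.

(** Induction on the number [k] of remaining steps. On a history [H] the next difference has mean 0,
    and each of its values [v] leads to a smaller history with a tree of its own. Jensen's
    inequality, with conditional probabilities as weights, merges these trees at the price [eta]. On
    a null history both sides are 0 and a leaf will do. *)
Lemma simple_martingale_gain eta k j H x y : 0 < eta -> (j + k)%N = N -> HH j H ->
  exists2 z, zigzag p C E x y z &
    \int[P]_(w in H) bellman_gain p C (x + \sum_(j.+1 <= i < N.+1) dd i w)
        (y + \sum_(j.+1 <= i < N.+1) eps i *: dd i w) <= prob P H * (z + k%:R * eta).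
Proof.
move=> eta0; elim: k j H x y => [|k ih] j H x y jk HjH; have mH := HH_measurable HjH.
  rewrite addn0 in jk; exists (bellman_gain p C x y); first exact: zigzag_leaf.
  under eq_Rintegral do rewrite !big_geq ?jk// !addr0.
  by rewrite Rintegral_const// mul0r addr0 mulrC.
have jN : (j < N)%N by rewrite -jk -addSnnS leq_addr.
set f := (X in Rintegral _ _ X).
have [_ mdd] := dd_simple j.+1.
have mHv v : measurable (H `&` dd j.+1 @^-1` [set v]) by exact: measurableI.
have [H0|Hn0] := eqVneq (prob P H) 0.
  exists (bellman_gain p C x y); first exact: zigzag_leaf.
  rewrite H0 mul0r.
  have := @Rintegral_null _ _ _ P _
    (fun w => (\sum_(j.+1 <= i < N.+1) dd i w, \sum_(j.+1 <= i < N.+1) eps i *: dd i w))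
    (fun q => bellman_gain p C (x + q.1) (y + q.2)) H _ mH H0 => -> //.
  apply: (simple_pair (@sigma_algebra_measurable _ Omega)).
    by apply: (simple_sum (@sigma_algebra_measurable _ Omega)).
  apply: (simple_sum (@sigma_algebra_measurable _ Omega)) => i _.
  exact: (simple_comp (@sigma_algebra_measurable _ Omega) ( *:%R (eps i))).
have Hp : 0 < prob P H by rewrite lt_neqAle eq_sym Hn0 prob_ge0.
(* The trees are chosen in a sigma type, so that their values become the function [zf] of [v] fed to
   Jensen's inequality. *)
have step v : {z | zigzag p C E (x + v) (y + eps j.+1 *: v) z &
    \int[P]_(w in H `&` dd j.+1 @^-1` [set v]) f w <=
    prob P (H `&` dd j.+1 @^-1` [set v]) * (z + k%:R * eta)}.
  apply: cid2.
  have [z hz hle] := ih j.+1 _ (x + v) (y + eps j.+1 *: v)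
    (etrans (addSnnS _ _) jk) (@HH_split _ _ v HjH).
  exists z; first exact: hz.
  apply: le_trans hle.
  rewrite le_eqVlt; apply/orP; left; apply/eqP.
  apply: eq_Rintegral => w; rewrite inE => -[_ /= wv].
  rewrite /f/= (big_ltn (m := j.+1)) ?ltnS// (big_ltn (m := j.+1)) ?ltnS// wv !addrA.
  by [].
pose zf v := s2val (step v).
pose s := fset_set (range (dd j.+1)).
pose wt v := prob P (H `&` dd j.+1 @^-1` [set v]) / prob P H.
have eE : E (eps j.+1) by apply: epsE; rewrite jN.
have [|||||z' hz' zz'] := @zigzag_jensen _ _ _ p C p1 E (eps j.+1) x y _ s wt id zf eta eE.
- by move=> v _; rewrite divr_ge0 ?prob_ge0.
- by rewrite -mulr_suml -prob_partition// divff.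
- have -> : \sum_(v <- s) real_scal c (wt v) *: id v =
      real_scal c (prob P H)^-1 *: simple_int P (dd j.+1) H.
    rewrite /simple_int scaler_sumr; apply: eq_bigr => v _.
    by rewrite scalerA -real_scalM mulrC.
  by rewrite HH_mean0// scaler0.
- by move=> v _; exact: (s2valP (step v)).
- exact: eta0.
exists z' => //.
rewrite (Rintegral_partition (dd_simple j.+1) mH); last exact: tail_integrable.
apply: (@le_trans _ _ (\sum_(v <- s) prob P (H `&` dd j.+1 @^-1` [set v]) * (zf v + k%:R * eta))).
  by apply: ler_sum => v _; exact: (s2valP' (step v)).
have -> : \sum_(v <- s) prob P (H `&` dd j.+1 @^-1` [set v]) * (zf v + k%:R * eta) =
   prob P H * (\sum_(v <- s) wt v * zf v + k%:R * eta).
  under eq_bigr do rewrite mulrDr.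
  rewrite big_split/= -mulr_suml -prob_partition// mulrDr; congr (_ + _).
  rewrite mulr_sumr; apply: eq_bigr => v _.
  by rewrite /wt mulrA; congr (_ * _); rewrite mulrCA divff// mulr1.
rewrite ler_pM2l// -natr1 mulrDl mul1r; lra.
Qed.

End SimpleMartingaleGain.

(** * From simple to general martingale differences *)

Section SimpleApproximation.
Context {R : realType} {c : bool} {X : normedModType (scal R c)}.
Local Notation K := (scal R c).
Context {d : measure_display} {Omega : measurableType d}.
Variable P : probability Omega R.
Variable p : R.
Hypothesis p1 : 1 < p.
Local Notation rs := (real_scal c).

(* [s] is close to [f], whose average over each atom of [lam] vanishes, so that
   subtracting from [s] its averages over these atoms is a small correction. *)
Lemma centered_simple_approx (T : choiceType) (G G' : set (set Omega)) (lam : Omega -> T)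
    (f : Omega -> X) delta :
  sigma_algebra setT G' -> G `<=` G' -> G' `<=` measurable -> simple_fun G lam ->
  strongly_measurable_wrt G' f -> in_Lp P p f ->
  (forall psi, real_functional psi -> forall B, G B -> \int[P]_(w in B) psi (f w) = 0) ->
  sigma_algebra setT G -> 0 < delta ->
  exists g : Omega -> X, [/\ simple_fun G' g,
    (Lpn P p (fun w => (g w - f w)%R) <= delta%:E)%E &
    forall Y, simple_int P g (lam @^-1` Y) = 0].
Proof.
move=> sG' GG' Gm slam sf lf f0 sG delta0.
pose B l := lam @^-1` [set l].
have [flam Glam] := slam.
have mlam : simple_fun measurable lam by apply: simple_sub slam; exact: subset_trans Gm.
have mpre Y : measurable (lam @^-1` Y).
  exact: (simple_preimage (@sigma_algebra_measurable _ Omega) Y mlam).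
(* A common bound for the factors [(prob P (B l))^-1] of the averages; null atoms contribute 0, the
   inverse of 0. With [s] within [delta / (1 + k)] of [f], the averages have norm at most
   [k * (delta / (1 + k))], and the two errors add up to [delta]. *)
pose k := \sum_(l <- fset_set (range lam)) (prob P (B l))^-1.
have k0 : 0 <= k by apply: sumr_ge0 => l _; rewrite invr_ge0 prob_ge0.
have kle w : (prob P (B (lam w)))^-1 <= k.
  have lw : lam w \in fset_set (range lam) by rewrite in_fset_set//; apply/mem_set; exists w.
  rewrite /k (big_fsetD1 _ lw)/= lerDl sumr_ge0// => l _.
  by rewrite invr_ge0 prob_ge0.
have e0 : 0 < delta / (1 + k) by rewrite divr_gt0// ltr_wpDr.
have [s ss sle] := Lp_approx p1 sG' Gm sf lf e0.
have sm : simple_fun measurable s by exact: simple_sub ss.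
have ls : in_Lp P p s by exact: (simple_in_Lp P p1 Gm ss).
pose avg l := rs (prob P (B l))^-1 *: simple_int P s (B l).
(* Since [f] has weak mean 0 on the atom, a functional norming the integral of [s] sees only
   [s - f], whose L^1 norm is at most its L^p norm. *)
have intle l : rnorm (simple_int P s (B l)) <= delta / (1 + k).
  have [psi [hpsi psiZ psile <-]] := norming_functional (simple_int P s (B l)).
  have mB : measurable (B l) by exact: mpre.
  have GB : G (B l) by exact: Glam.
  have ips := simple_integrable P psi sm mB.
  have ipf : P.-integrable (B l) (EFin \o (psi \o f)).
    by apply: integrableS (integrable_functional p1 lf hpsi).
  have lsf := in_LpB p1 ls lf.
  have irn : P.-integrable (B l) (EFin \o (fun w => rnorm (s w - f w))).
    by apply: integrableS (integrable_rnorm p1 lsf).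
  rewrite functional_simple_int//.
  have -> : \int[P]_(w in B l) psi (s w) = \int[P]_(w in B l) psi (s w - f w).
    rewrite (_ : \int[P]_(w in B l) psi (s w - f w) =
      \int[P]_(w in B l) (psi (s w) - psi (f w))); last first.
      by apply: eq_Rintegral => w _; exact: real_functionalB.
    by rewrite RintegralB// f0// subr0.
  apply: (@le_trans _ _ (\int[P]_(w in B l) rnorm (s w - f w))).
    apply: le_Rintegral => //.
    apply: integrableS (integrable_functional p1 lsf hpsi) => //.
  rewrite -lee_fin -EFin_Rintegral//.
  apply: le_trans sle; apply: le_trans (integral_rnorm_le P p1 lsf.1).
  apply: ge0_subset_integral => //; last by move=> w _; rewrite lee_fin rnorm_ge0.
  by apply/measurable_EFinP; exact: measurable_rnorm lsf.1.
have avgle w : rnorm (avg (lam w)) <= k * (delta / (1 + k)).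
  rewrite /avg rnormZr ger0_norm ?invr_ge0 ?prob_ge0//.
  by apply: ler_pM; rewrite ?invr_ge0 ?prob_ge0 ?rnorm_ge0.
pose g w := s w - avg (lam w).
have sg : simple_fun G' g.
  exact: (simple_op2 sG' (fun x y => x - y) ss (simple_comp sG' avg (simple_sub GG' slam))).
have gm : simple_fun measurable g by exact: simple_sub sg.
exists g; split => //.
- have sa : simple_fun measurable (fun w => avg (lam w)).
    exact: (simple_comp (@sigma_algebra_measurable _ Omega) avg mlam).
  rewrite (_ : (fun w => _) = fun w => (s w - f w) - avg (lam w)); last first.
    by apply/funext => w; rewrite /g addrAC.
  have sam := strongly_measurable_simple sa.
  apply: (le_trans (LpnB P p1 (in_LpB p1 ls lf).1 sam)).
  apply: (le_trans (leeD sle (in_Lp_bounded P p1 sam avgle).2)).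
  rewrite -EFinD lee_fin -[X in X + _]mul1r -mulrDl mulrCA divff ?mulr1//.
  by rewrite gt_eqF// ltr_wpDr.
- move=> Y; apply: rnorm_eq0.
  have [psi [hpsi psiZ psile <-]] := norming_functional (simple_int P g (lam @^-1` Y)).
  rewrite functional_simple_int// (Rintegral_partition mlam)//; last first.
    exact: (simple_integrable P psi gm (mpre Y)).
  rewrite big1// => l _.
  have [Yl|nYl] := pselect (Y l); last first.
    rewrite (_ : _ `&` _ = set0) ?Rintegral_set0//.
    by rewrite -subset0 => w [/= Yw lw]; apply: nYl; rewrite -lw.
  rewrite (_ : _ `&` _ = B l); last first.
    by rewrite predeqE => w; split => [[]//|/= lw]; split => //=; rewrite lw.
  have [Bl0|Bl0] := eqVneq (prob P (B l)) 0.
    by apply: (Rintegral_null psi gm) => //; exact: mpre.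
  rewrite (_ : \int[P]_(w in B l) psi (g w) =
      \int[P]_(w in B l) (psi (s w) - psi (avg l))); last first.
    by apply: eq_Rintegral => w; rewrite inE => /= <-; exact: real_functionalB.
  have mB : measurable (B l) by exact: mpre.
  rewrite RintegralB//; last 2 first.
  - exact: (simple_integrable P psi sm).
  - exact: finite_measure_integrable_cst.
  rewrite Rintegral_const// -functional_simple_int// /avg psiZ ?invr_ge0 ?prob_ge0//.
  by rewrite mulrAC mulVf// mul1r subrr.
Qed.

(** The approximants are built one after the other, and each is centered on the atoms of the history
    of those already chosen. This history is simple, so its atoms are finitely many, and it is
    [G n]-measurable, so [dd n.+1] has mean 0 on them. The result is a martingale difference
    sequence for its own history. *)
Lemma mds_simple_approx (G : nat -> set (set Omega)) (dd : nat -> Omega -> X) N delta :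
  Lp_mds P G p dd N -> 0 < delta ->
  exists g : nat -> Omega -> X, [/\ forall i, simple_fun measurable (g i),
    forall i, (1 <= i <= N)%N -> (Lpn P p (fun w => (g i w - dd i w)%R) <= delta%:E)%E &
    forall i Y, (i < N)%N ->
      simple_int P (g i.+1) ((fun w => mkseq (fun j => g j.+1 w) i) @^-1` Y) = 0].
Proof.
move=> [[sG Gm Gle] hdd] delta0.
have F n m : (n <= m)%N -> G n `<=` G m := Gle n m.
suff H n : (n <= N)%N -> exists g : nat -> Omega -> X,
   [/\ forall i, simple_fun measurable (g i), forall i, (1 <= i <= n)%N -> simple_fun (G i) (g i),
    forall i, (1 <= i <= n)%N -> (Lpn P p (fun w => (g i w - dd i w)%R) <= delta%:E)%E &
    forall i Y, (i < n)%N ->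
      simple_int P (g i.+1) ((fun w => mkseq (fun j => g j.+1 w) i) @^-1` Y) = 0].
  by have [g [h1 _ h2 h3]] := H N (leqnn N); exists g.
elim: n => [_|n ih nN].
  exists (fun _ _ => 0); split => [i|[|i]//|[|i]//|//].
  exact: (simple_cst (@sigma_algebra_measurable _ Omega)).
have [g [mg sg gd g0]] := ih (ltnW nN).
have nN' : (1 <= n.+1 <= N)%N by [].
have [ld sd md] := hdd _ nN'.
pose lam w := mkseq (fun j => g j.+1 w) n.
have slam : simple_fun (G n) lam.
  suff aux k : (k <= n)%N -> simple_fun (G n) (fun w => mkseq (fun j => g j.+1 w) k).
    exact: aux.
  elim: k => [_|k ihk kn]; first exact: (simple_cst (sG n) [::]).
  under eq_fun do rewrite mkseqS.
  apply: (simple_op2 (sG n) rcons (ihk (ltnW kn))).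
  by apply: (simple_sub (F _ _ kn)); apply: sg.
have [|h [sh hd h0]] := centered_simple_approx (sG n.+1) (F _ _ (leqnSn n)) (Gm n.+1) slam
  sd ld _ (sG n) delta0.
  move=> psi hpsi B GB; have := md _ hpsi _ GB; rewrite EFin_Rintegral.
  - by case.
  - exact: Gm GB.
  - apply: integrableS (integrable_functional p1 ld hpsi) => //.
    exact: Gm GB.
pose g' i := if i == n.+1 then h else g i.
have g'E i : (i <= n)%N -> g' i = g i by move=> ni; rewrite /g' ltn_eqF.
have g'S : g' n.+1 = h by rewrite /g' eqxx.
have lamE i : (i <= n)%N ->
    (fun w => mkseq (fun j => g' j.+1 w) i) = (fun w => mkseq (fun j => g j.+1 w) i).
  move=> ni; apply/funext => w; apply/eq_in_map => j; rewrite mem_iota add0n => ji.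
  by rewrite g'E// (leq_trans ji).
exists g'; split.
- by move=> i; rewrite /g'; case: eqP => // _; exact: simple_sub (Gm n.+1) sh.
- move=> i /andP[i1]; rewrite leq_eqVlt => /orP[/eqP ->|]; first by rewrite g'S.
  by rewrite ltnS => ni; rewrite g'E//; apply: sg; rewrite i1.
- move=> i /andP[i1]; rewrite leq_eqVlt => /orP[/eqP ->|]; first by rewrite g'S.
  by rewrite ltnS => ni; rewrite g'E// gd// i1.
- move=> i Y; rewrite ltnS leq_eqVlt => /orP[/eqP ->|ni]; first by rewrite g'S lamE.
  by rewrite g'E// lamE ?g0// ltnW.
Qed.

Lemma mds_zigzag_bound (C : R) (E : set K) (G : nat -> set (set Omega))
    (dd : nat -> Omega -> X) N (eps : nat -> K) : 0 <= C ->
  (forall z, zigzag (X := X) p C E 0 0 z -> z <= 0) ->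
  Lp_mds P G p dd N -> (forall i, (1 <= i <= N)%N -> E (eps i)) ->
  (Lpn P p (fun w => (\sum_(1 <= i < N.+1) eps i *: dd i w)%R) <=
   C%:E * Lpn P p (fun w => (\sum_(1 <= i < N.+1) dd i w)%R))%E.
Proof.
move=> C0 hz hmds epsE.
have simple_case (g : nat -> Omega -> X) : (forall i, simple_fun measurable (g i)) ->
    (forall i Y, (i < N)%N ->
      simple_int P (g i.+1) ((fun w => mkseq (fun j => g j.+1 w) i) @^-1` Y) = 0) ->
    (Lpn P p (fun w => (\sum_(1 <= i < N.+1) eps i *: g i w)%R) <=
     C%:E * Lpn P p (fun w => (\sum_(1 <= i < N.+1) g i w)%R))%E.
  move=> mg g0.
  have lg i : in_Lp P p (g i) by exact: (simple_in_Lp P p1 (@subset_refl _ _) (mg i)).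
  rewrite -gain_le0//; last 2 first.
  - by apply: (in_Lp_sum p1).
  - by apply: (in_Lp_sum p1) => i _; exact: in_LpZ.
  (* An event of [HH i] is a condition on the list of the first [i] values; prescribing the next
     value appends it to the lists. *)
  pose HH i := [set (fun w => mkseq (fun j => g j.+1 w) i) @^-1` Y | Y in @setT (set (seq X))].
  have mlam i : simple_fun measurable (fun w => mkseq (fun j => g j.+1 w) i).
    elim: i => [|i ih]; first exact: (simple_cst (@sigma_algebra_measurable _ Omega)).
    under eq_fun do rewrite mkseqS.
    exact: (simple_op2 (@sigma_algebra_measurable _ Omega) rcons ih (mg i.+1)).
  have mHH i : HH i `<=` measurable.
    move=> _ [Y _ <-].
    exact: (simple_preimage (@sigma_algebra_measurable _ Omega) Y (mlam i)).
  have splitHH i H v : HH i H -> HH i.+1 (H `&` g i.+1 @^-1` [set v]).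
    move=> [Y _ <-]; exists [set l | exists2 l', Y l' & l = rcons l' v] => //.
    rewrite predeqE => w; rewrite /preimage/= mkseqS; split => [[l' Yl' /rcons_inj[-> ->]//]|[Yw wv]].
    by exists (mkseq (fun j => g j.+1 w) i) => //; rewrite wv.
  have meanHH i H : (i < N)%N -> HH i H -> simple_int P (g i.+1) H = 0.
    by move=> iN [Y _ <-]; exact: g0.
  apply/ler_addgt0Pl => e e0; rewrite addr0.
  have eta0 : 0 < e / (N%:R + 1) by rewrite divr_gt0// ltr_wpDl.
  have HT : HH 0%N setT by exists setT => //; rewrite preimage_setT.
  have [z hz0 hle] := simple_martingale_gain C p1 mg epsE mHH splitHH meanHH 0 0 eta0
     (add0n N) HT.
  move: hle; under eq_Rintegral do rewrite !add0r.
  rewrite [prob P setT](_ : _ = 1); last by rewrite /prob probability_setT.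
  move=> hle; apply: (le_trans hle); rewrite mul1r.
  have zle := hz _ hz0.
  have : N%:R * (e / (N%:R + 1)) <= e.
    by rewrite mulrCA ger_pMr// ler_pdivrMr ?mul1r ?lerDl// ltr_wpDl.
  by lra.
have sdd i : (1 <= i <= N)%N -> in_Lp P p (dd i) by move=> /(hmds.2 _)[].
have sumLp (b : nat -> K) (f : nat -> Omega -> X) : (forall i, (1 <= i <= N)%N -> in_Lp P p (f i)) ->
    in_Lp P p (fun w => \sum_(1 <= i < N.+1) b i *: f i w).
  move=> lf; apply: (in_Lp_sum p1) => i; rewrite mem_index_iota ltnS => iN.
  exact/in_LpZ/lf.
have sum1 (f : nat -> Omega -> X) :
    (fun w => \sum_(1 <= i < N.+1) f i w) = (fun w => \sum_(1 <= i < N.+1) (1 : K) *: f i w).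
  by apply/funext => w; apply: eq_bigr => i _; rewrite scale1r.
pose A := \sum_(1 <= i < N.+1) snorm (eps i).
have A0 : 0 <= A by apply: sumr_ge0 => i _; exact: snorm_ge0.
have ldd1 := sumLp (fun=> 1) dd sdd; have ldde := sumLp eps dd sdd.
rewrite sum1 -(fineK (Lpn_fin_num ldd1)) -(fineK (Lpn_fin_num ldde)) -EFinM lee_fin.
apply/ler_addgt0Pl => e e0.
have den0 : 0 < A + C * N%:R + 1 by rewrite ltr_wpDl// addr_ge0// mulr_ge0.
(* An error [delta] in each difference costs [A * delta] in the transformed sum and [N * delta],
   multiplied by [C], in the plain sum; the 1 keeps the denominator positive. *)
have delta0 : 0 < e / (A + C * N%:R + 1) by rewrite divr_gt0.
have [g [mg gd g0]] := mds_simple_approx hmds delta0.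
have lg i : in_Lp P p (g i) by exact: (simple_in_Lp P p1 (@subset_refl _ _) (mg i)).
have diff (b : nat -> K) : (Lpn P p (fun w => (\sum_(1 <= i < N.+1) b i *: g i w -
    \sum_(1 <= i < N.+1) b i *: dd i w)%R) <=
    ((\sum_(1 <= i < N.+1) snorm (b i)) * (e / (A + C * N%:R + 1)))%:E)%E.
  rewrite (_ : (fun w => _) = fun w => \sum_(1 <= i < N.+1) b i *: (g i w - dd i w)); last first.
    by apply/funext => w; rewrite -sumrB; apply: eq_bigr => i _; rewrite scalerBr.
  have lgd i : (1 <= i <= N)%N -> in_Lp P p (fun w => g i w - dd i w).
    by move=> iN; apply: in_LpB => //; exact: sdd.
  apply: (le_trans (Lpn_sum P p1 _)).
    move=> i; rewrite mem_index_iota ltnS => iN; exact: (in_LpZ p1 (b i) (lgd i iN)).1.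
  rewrite mulr_suml -sumEFin big_seq [leRHS]big_seq; apply: lee_sum => i.
  rewrite mem_index_iota ltnS => iN; rewrite LpnZ//; last exact: (lgd i iN).1.
  by rewrite EFinM lee_wpmul2l ?lee_fin ?snorm_ge0// gd.
have tri (f h : Omega -> X) (t : R) : in_Lp P p f -> in_Lp P p h ->
    (Lpn P p (fun w => (f w - h w)%R) <= t%:E)%E ->
    fine (Lpn P p f) <= fine (Lpn P p h) + t /\ fine (Lpn P p h) <= fine (Lpn P p f) + t.
  move=> lf lh ht.
  have := Lpn_dist p1 lf lh; have lfh := in_LpB p1 lf lh.
  by move: ht; rewrite -(fineK (Lpn_fin_num lfh)) lee_fin ler_norml => ht /andP[]; split; lra.
have lg1 := sumLp (fun=> 1) g (fun i _ => lg i); have lge := sumLp eps g (fun i _ => lg i).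
have [_ t1] := tri _ _ _ lge ldde (diff eps).
have [t2 _] := tri _ _ _ lg1 ldd1 (diff (fun=> 1)).
have := simple_case g mg g0; rewrite sum1.
rewrite -(fineK (Lpn_fin_num lg1)) -(fineK (Lpn_fin_num lge)) -EFinM lee_fin => t3.
rewrite (_ : \sum_(1 <= i < N.+1) snorm 1 = N%:R) in t2; last first.
  rewrite big_const_nat subSS subn0 iter_addr_0 (_ : snorm 1 = 1)//.
  by rewrite -(real_scal1 c) snorm_real normr1.
have t4 := ler_wpM2l C0 t2.
have t5 : (A + C * N%:R) * (e / (A + C * N%:R + 1)) <= e.
  by rewrite mulrCA ger_pMr// ler_pdivrMr ?mul1r ?lerDl.
move: t1 t3 t4 t5; rewrite mulrDl mulrDr mulrA -/A; lra.
Qed.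

End SimpleApproximation.

(** * Convex functions attain their maximum at extreme points *)

Section Bauer.
Context {R : realType} {c : bool}.
Local Notation K := (scal R c).
Local Notation rs := (@real_scal R c).

(** With 0 as imaginary unit in the real case, the map [of_coord] from the plane is onto for both
    fields, and compactness is that of rectangles in [R * R]. *)
Definition im_unit : K := if c as b return scal R b then 'i%C else 0.

Definition im_scal : K -> R :=
  if c as b return scal R b -> R then (fun z : R[i] => complex.Im z) else (fun=> 0).

Definition of_coord (x : R * R) : K := rs x.1 + im_unit * rs x.2.

Lemma re_of_coord x : re_scal (of_coord x) = x.1.
Proof.
rewrite /of_coord /im_unit; case: (c) => /=; last by rewrite mul0r addr0.
by case: x => a b /=; simpc.
Qed.

Lemma of_coordK (k : K) : of_coord (re_scal k, im_scal k) = k.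
Proof.
rewrite /of_coord /im_unit /im_scal; case: (c) k => /= k; last by rewrite mul0r addr0.
by rewrite -complexE.
Qed.

Lemma re_scalZ t (k : K) : re_scal (rs t * k) = t * re_scal k.
Proof. by case: (c) k => //= -[a b]; simpc. Qed.

Lemma im_scalD (k l : K) : im_scal (k + l) = im_scal k + im_scal l.
Proof. by rewrite /im_scal; case: (c) k l => /= [[? ?] [? ?]|? ?]//; rewrite addr0. Qed.

Lemma im_scalZ t (k : K) : im_scal (rs t * k) = t * im_scal k.
Proof. by rewrite /im_scal; case: (c) k => /= [[a b]|k]; [simpc|rewrite mulr0]. Qed.

Lemma re_scal_le_snorm (k : K) : `|re_scal k| <= snorm k.
Proof.
rewrite /snorm; case: (c) k => //= k.
by have := normc_ge_Re k; rewrite lecE => /andP[_].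
Qed.

Lemma im_scal_le_snorm (k : K) : `|im_scal k| <= snorm k.
Proof.
rewrite /snorm /im_scal; case: (c) k => /= k; last by rewrite normr0.
rewrite -[leRHS]/(complex.Re `|k : R[i]|) normc_def/= -sqrtr_sqr.
by rewrite ler_wsqrtr// lerDr sqr_ge0.
Qed.

Lemma real_scal_continuous : continuous rs.
Proof.
move=> x; apply/cvgrPdist_lt => e e0.
have e0' : 0 < re_scal e by rewrite -(@real_scal_gt0 _ c) real_scal_re// ltW.
have /cvgrPdist_lt/(_ _ e0') : id y @[y --> x] --> x by exact: cvg_id.
apply: filterS => y xy; rewrite -real_scalN -real_scalD norm_real_scal.
by rewrite -(real_scal_re (ltW e0)) real_scal_lt.
Qed.

Lemma of_coord_continuous : continuous of_coord.
Proof.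
move=> x; apply: (@cvgD _ K^o).
  by apply: (@cvg_comp _ _ _ fst rs); [exact: cvg_fst|exact: real_scal_continuous].
apply: cvgMr.
by apply: (@cvg_comp _ _ _ snd rs); [exact: cvg_snd|exact: real_scal_continuous].
Qed.

Lemma re_of_coord_continuous : continuous (fun x => re_scal (of_coord x)).
Proof. by under eq_fun do rewrite re_of_coord; move=> x; exact: cvg_fst. Qed.

Lemma im_of_coord_continuous : continuous (fun x => im_scal (of_coord x)).
Proof.
rewrite /im_scal /of_coord /im_unit; case: (c) => /=; last by move=> x; exact: cvg_cst.
rewrite (_ : (fun x => _) = snd); first by move=> x; exact: cvg_snd.
by apply/funext => -[a b]/=; simpc.
Qed.

Lemma argmax_compact (f : R * R -> R) (B : set (R * R)) : B !=set0 -> compact B ->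
  closed B -> continuous f ->
  let M := [set x | B x /\ forall y, B y -> f y <= f x] in [/\ M !=set0, compact M & closed M].
Proof.
move=> B0 cB clB cf M.
have [x xB xmax] := @compact_EVT_max _ R f B B0 cB (continuous_subspaceT cf).
have Mx : M x by split; [exact/set_mem|move=> y By; apply: xmax; exact/mem_set].
have ME : M = B `&` f @^-1` `[f x, +oo[.
  rewrite predeqE => y; split => [[By ymax]|[By]].
    by split => //=; rewrite in_itv/= andbT; apply: ymax; exact/set_mem.
  rewrite /= in_itv/= andbT => fy; split => // z Bz; apply: le_trans fy.
  by apply: xmax; exact/mem_set.
have clM : closed M.
  rewrite ME; apply: closedI => //; apply: closed_comp; last exact: rray_closed.
  by move=> z _; exact: cf.
split => //; first by exists x.
by apply: (subclosed_compact clM cB) => y [].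
Qed.

(* Maximising lexicographically (f, then the real part, then the imaginary part)
   over the compact set A singles out an extreme point. *)
Lemma convex_max_extreme (A : set K) (f : K -> R) : A !=set0 -> closed A ->
  bounded_scal_set A -> continuous (f : K^o -> R) ->
  (forall t b b', 0 < t < 1 -> f (rs t * b + rs (1 - t) * b') <= t * f b + (1 - t) * f b') ->
  exists2 e, extreme_points A e & forall b, A b -> f b <= f e.
Proof.
move=> [a0 Aa0] clA [M hM] cf fconv.
pose m := re_scal M.
have Am b : A b -> snorm b <= m by move=> /hM /re_scal_le.
pose rect := `[- m, m]%classic `*` `[- m, m]%classic : set (R * R).
pose B := rect `&` of_coord @^-1` A.
have AB b : A b -> B (re_scal b, im_scal b).
  move=> Ab; have bm := Am _ Ab; rewrite /B/rect/=; split; last by rewrite /preimage/= of_coordK.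
  by split; rewrite /= in_itv/= -ler_norml (le_trans _ bm)// ?re_scal_le_snorm ?im_scal_le_snorm.
have clrect : closed rect.
  rewrite (_ : rect = fst @^-1` `[- m, m] `&` snd @^-1` `[- m, m])//; apply: closedI.
    by apply: closed_comp; [move=> z _; exact: cvg_fst|exact: itv_closed].
  by apply: closed_comp; [move=> z _; exact: cvg_snd|exact: itv_closed].
have clB : closed B.
  apply: closedI => //; apply: closed_comp clA => z _; exact: of_coord_continuous.
have cB : compact B.
  apply: (subclosed_compact clB _ (@subIsetl _ _ _)).
  by apply: compact_setX; exact: segment_compact.
have B0 : B !=set0 by exists (re_scal a0, im_scal a0); exact: AB.
have cfc : continuous (fun x => f (of_coord x)).
  by move=> x; apply: (@continuous_comp _ _ _ of_coord f); [exact: of_coord_continuous|exact: cf].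
have [M10 cM1 clM1] := argmax_compact B0 cB clB cfc.
have [M20 cM2 clM2] := argmax_compact M10 cM1 clM1 re_of_coord_continuous.
have [[q [[[Bq qf] qre] qim]] _ _] := argmax_compact M20 cM2 clM2 im_of_coord_continuous.
have max1 b : A b -> f b <= f (of_coord q).
  by move=> /AB /qf; rewrite of_coordK.
have max2 b : A b -> f b = f (of_coord q) -> re_scal b <= re_scal (of_coord q).
  move=> Ab fb; have := qre (re_scal b, im_scal b); rewrite of_coordK; apply; split.
    exact: AB.
  by move=> y By; rewrite of_coordK fb; exact: qf.
have max3 b : A b -> f b = f (of_coord q) -> re_scal b = re_scal (of_coord q) ->
    im_scal b <= im_scal (of_coord q).
  move=> Ab fb reb; have := qim (re_scal b, im_scal b); rewrite of_coordK; apply; split.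
    split; first exact: AB.
    by move=> y By; rewrite of_coordK fb; exact: qf.
  by move=> y My; rewrite of_coordK reb; exact: qre.
exists (of_coord q) => //; split; first by case: Bq.
move=> b b' t Ab Ab' /andP[t0 t1] qE.
pose s := re_scal t.
have tE : t = rs s by rewrite real_scal_re// ltW.
have s0 : 0 < s by rewrite -(real_scal_lt c) real_scal0 -tE.
have s1 : s < 1 by rewrite -(real_scal_lt c) real_scal1 -tE.
have qE' : of_coord q = rs s * b + rs (1 - s) * b'.
  by rewrite qE tE real_scalD real_scalN real_scal1.
(* A mean with positive weights reaches an upper bound of both terms only if both equal it. It is
   used for [f], then for the real part among maximisers of [f], then for the imaginary part. *)
have pin u v w : u <= w -> v <= w -> w <= s * u + (1 - s) * v -> u = w /\ v = w.
  by move=> uw vw h; split; apply/eqP; rewrite eq_le ?uw ?vw/=; nra.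
have s01 : 0 < s < 1 by rewrite s0 s1.
have [fb fb'] : f b = f (of_coord q) /\ f b' = f (of_coord q).
  by apply: pin; [exact: max1|exact: max1|rewrite [in leLHS]qE'; exact: fconv].
have [rb rb'] : re_scal b = re_scal (of_coord q) /\ re_scal b' = re_scal (of_coord q).
  by apply: pin; [exact: max2|exact: max2|rewrite [in leLHS]qE' re_scalD !re_scalZ].
have [ib ib'] : im_scal b = im_scal (of_coord q) /\ im_scal b' = im_scal (of_coord q).
  by apply: pin; [exact: max3|exact: max3|rewrite [in leLHS]qE' im_scalD !im_scalZ].
by rewrite -(of_coordK b) -(of_coordK b') rb rb' ib ib'.
Qed.

End Bauer.

(** * The UMD inequality from the operator norm *)

Section ExtremeMultipliers.
Context {R : realType} {c : bool} {X : normedModType (scal R c)}.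
Local Notation K := (scal R c).
Context {d : measure_display} {Omega : measurableType d}.
Variable P : probability Omega R.
Variable p : R.
Hypothesis p1 : 1 < p.

Lemma Lpn_affine_convex (g h : Omega -> X) t (b b' : K) : in_Lp P p g -> in_Lp P p h ->
  0 < t < 1 ->
  fine (Lpn P p (fun w => g w + (real_scal c t * b + real_scal c (1 - t) * b') *: h w)) <=
  t * fine (Lpn P p (fun w => g w + b *: h w)) +
  (1 - t) * fine (Lpn P p (fun w => g w + b' *: h w)).
Proof.
move=> lg lh /andP[t0 t1].
have lb k : in_Lp P p (fun w => g w + k *: h w) by apply: in_LpD => //; exact: in_LpZ.
rewrite (_ : (fun w => _) = fun w => real_scal c t *: (g w + b *: h w) +
    real_scal c (1 - t) *: (g w + b' *: h w)); last first.
  apply/funext => w; rewrite !scalerDr addrACA -scalerDl -real_scalD (addrC t) subrK.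
  by rewrite real_scal1 scale1r scalerDl !scalerA.
have l1 := in_LpZ p1 (real_scal c t) (lb b).
have l2 := in_LpZ p1 (real_scal c (1 - t)) (lb b').
have := LpnD P p1 l1.1 l2.1; rewrite !LpnZ//; [|exact: (lb _).1|exact: (lb _).1].
rewrite -(fineK (Lpn_fin_num (in_LpD p1 l1 l2))) -(fineK (Lpn_fin_num (lb b))).
rewrite -(fineK (Lpn_fin_num (lb b'))) -!EFinM -EFinD lee_fin !snorm_real.
by rewrite !ger0_norm// ?subr_ge0 ltW.
Qed.

Lemma Lpn_affine_continuous (g h : Omega -> X) : in_Lp P p g -> in_Lp P p h ->
  continuous ((fun k => fine (Lpn P p (fun w => g w + k *: h w))) : K^o -> R).
Proof.
move=> lg lh; apply: continuous_rnormP => x e e0.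
have h0 : 0 <= fine (Lpn P p h) by rewrite fine_ge0// Lpn_ge0.
exists (e / (fine (Lpn P p h) + 1)); first by rewrite divr_gt0// ltr_wpDl.
move=> y; rewrite ltr_pdivlMr ?ltr_wpDl// => yx.
have lb k : in_Lp P p (fun w => g w + k *: h w) by apply: in_LpD => //; exact: in_LpZ.
apply: (le_lt_trans (Lpn_dist p1 (lb y) (lb x))); apply: le_lt_trans yx.
rewrite (_ : (fun w => _) = fun w => (y - x : K) *: h w); last first.
  by apply/funext => w; rewrite opprD addrACA subrr add0r scalerBl.
rewrite LpnZ; [|exact: p1|exact: lh.1].
rewrite -(fineK (Lpn_fin_num lh)) -EFinM /=.
by rewrite ler_wpM2l ?snorm_ge0// lerDl.
Qed.

(** The right-hand side does not involve the multipliers, so they can be moved to extreme points one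
    at a time. In the induction, those with index above [k] are already extreme. *)
Lemma UMD_from_extreme (A : set K) (C : R) G dd N (eps : nat -> K) :
  closed A -> bounded_scal_set A -> Lp_mds (X := X) P G p dd N ->
  (forall eps, (forall i, (1 <= i <= N)%N -> extreme_points A (eps i)) ->
    (Lpn P p (fun w => (\sum_(1 <= i < N.+1) eps i *: dd i w)%R) <= C%:E)%E) ->
  (forall i, (1 <= i <= N)%N -> A (eps i)) ->
  (Lpn P p (fun w => (\sum_(1 <= i < N.+1) eps i *: dd i w)%R) <= C%:E)%E.
Proof.
move=> clA bA hmds hext epsA.
have sdd i : (1 <= i <= N)%N -> in_Lp P p (dd i) by move=> /(hmds.2 _)[].
suff H k e : (forall i, (1 <= i <= N)%N -> A (e i)) ->
    (forall i, (k < i <= N)%N -> extreme_points A (e i)) ->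
    (Lpn P p (fun w => (\sum_(1 <= i < N.+1) e i *: dd i w)%R) <= C%:E)%E.
  by apply: (H N) => // i /andP[Ni iN]; move: Ni; rewrite ltnNge iN.
elim: k e => [|k ih] e eA eext; first exact: hext.
have [kN|Nk] := leqP k.+1 N; last first.
  apply: ih => // i /andP[ki iN]; apply: eext; rewrite iN andbT.
  by move: Nk; rewrite ltnNge (leq_trans ki iN).
pose upd b i := if i == k.+1 then b else e i.
pose g w := \sum_(1 <= i < N.+1 | i != k.+1) e i *: dd i w.
have kin : (1 <= k.+1 <= N)%N by [].
have sumE b w : \sum_(1 <= i < N.+1) upd b i *: dd i w = g w + b *: dd k.+1 w.
  rewrite (bigD1_seq k.+1) ?mem_index_iota ?ltnS//= ?iota_uniq// /upd eqxx addrC.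
  by congr (_ + _); apply: eq_bigr => i /negbTE ->.
have lg : in_Lp P p g.
  rewrite /g; under eq_fun do rewrite -big_filter.
  apply: (in_Lp_sum p1) => i; rewrite mem_filter mem_index_iota ltnS => /andP[_ iN].
  exact/in_LpZ/sdd.
have lk := sdd _ kin.
have lb b : in_Lp P p (fun w => g w + b *: dd k.+1 w) by apply: in_LpD => //; exact: in_LpZ.
have [e1 ext1 max1] := @convex_max_extreme R c A
  (fun b => fine (Lpn P p (fun w => g w + b *: dd k.+1 w)))
  (ex_intro _ _ (eA _ kin)) clA bA (Lpn_affine_continuous lg lk)
  (fun t b b' => Lpn_affine_convex b b' lg lk).
have -> : (fun w => \sum_(1 <= i < N.+1) e i *: dd i w) =
    fun w => g w + e k.+1 *: dd k.+1 w.
  apply/funext => w; rewrite -sumE; apply: eq_bigr => i _.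
  by rewrite /upd; case: eqP => // ->.
apply: (@le_trans _ _ (Lpn P p (fun w => g w + e1 *: dd k.+1 w)%R)).
  rewrite -(fineK (Lpn_fin_num (lb e1))) -(fineK (Lpn_fin_num (lb (e k.+1)))) lee_fin.
  exact/max1/eA.
have -> : (fun w => g w + e1 *: dd k.+1 w) =
    fun w => \sum_(1 <= i < N.+1) upd e1 i *: dd i w.
  by apply/funext => w; rewrite sumE.
apply: ih => i iN; rewrite /upd; case: eqP => [_|ik] //; first by case: ext1.
- exact: eA.
- by apply: eext; case/andP: iN => ki ->; rewrite andbT ltn_neqAle eq_sym; apply/andP; split => //; apply/eqP.
Qed.

End ExtremeMultipliers.

(** * Rademacher variables as fair coins, density as approximation *)

Section Coins.
Context {R : realType} {d : measure_display} {Omega : measurableType d}.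
Variable P : probability Omega R.

(** Independence is applied to the value 1; the half for the complement follows by additivity of
    [P]. *)
Lemma rademacher_fair_coins F r : is_filtration F -> rademacher_adapted P F r ->
  fair_coins P F (fun n => r n @^-1` [set 1]).
Proof.
move=> [sF Fm _] [_ hr] n n0; have [[_ [r1 _]] rF ri] := hr n n0.
have m1 : measurable [set 1 : R] by rewrite -set_itv1; exact: measurable_itv.
have S1 : F n (r n @^-1` [set 1]) by exact: rF.
have half B : F n.-1 B -> prob P (r n @^-1` [set 1] `&` B) = 2^-1 * prob P B.
  move=> FB; rewrite /prob ri//.
  by rewrite r1 fineM// fin_num_measure//; exact: Fm FB.
split => // B FB; split; first exact: half.
have mB := Fm _ _ FB; have mS := Fm _ _ S1.
have := Rintegral_split mS mB (finite_measure_integrable_cst P 1 mB).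
rewrite !Rintegral_const ?mul1r//; last 2 first.
- by apply: measurableI => //; exact: measurableC.
- exact: measurableI.
by rewrite half// => h; lra.
Qed.

Lemma closure_snorm {c : bool} (a : nat -> scal R c) (E : set (scal R c)) :
  (forall N : nat, E `<=` closure [set a n | n in [set n | (N <= n)%N]]) ->
  forall e, E e -> forall n rho, 0 < rho -> exists2 m, (n < m)%N & snorm (a m - e) < rho.
Proof.
move=> hE e Ee n rho rho0.
have rr0 : 0 < real_scal c rho by rewrite real_scal_gt0.
have [_ [[m /= nm <-]]] := hE n.+1 e Ee _ (nbhsx_ballx e _ rr0).
rewrite -ball_normE/= distrC snormE real_scal_lt => h; by exists m.
Qed.

End Coins.

Section LowerBound.
Context {R : realType} {c : bool} {X : normedModType (scal R c)}.
Context {d : measure_display} {Omega : measurableType d}.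
Variable P : probability Omega R.

Lemma UMD_of_opnorm (F : nat -> set (set Omega)) (r : nat -> Omega -> R)
    (a : nat -> scal R c) (A : set (scal R c)) (p C : R) :
  1 < p -> closed A -> bounded_scal_set A -> is_filtration F -> rademacher_adapted P F r ->
  (forall N : nat, extreme_points A `<=` closure [set a n | n in [set n | (N <= n)%N]]) ->
  0 <= C -> (opnorm_TA (X := X) P F p a <= C%:E)%E -> UMD_A_ineq (X := X) p A C.
Proof.
move=> p1 clA bA hF hr dens C0 hC d' Omega' Q G dd N eps hmds epsA.
have hz := zigzag_le0 p1 C0 hF hC (rademacher_fair_coins hF hr) (closure_snorm dens).
have ldd : in_Lp Q p (fun w => \sum_(1 <= n < N.+1) dd n w).
  apply: (in_Lp_sum p1) => i; rewrite mem_index_iota ltnS => iN.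
  by have [] := hmds.2 _ iN.
have bound e : (forall i, (1 <= i <= N)%N -> extreme_points A (e i)) ->
    (Lpn Q p (fun w => (\sum_(1 <= i < N.+1) e i *: dd i w)%R) <=
     (C * fine (Lpn Q p (fun w => (\sum_(1 <= n < N.+1) dd n w)%R)))%:E)%E.
  move=> eext; rewrite EFinM (fineK (Lpn_fin_num ldd)).
  exact: (mds_zigzag_bound p1 C0 hz hmds eext).
have := UMD_from_extreme p1 clA bA hmds bound epsA.
by rewrite EFinM (fineK (Lpn_fin_num ldd)).
Qed.

End LowerBound.

(** * Completeness of L^p *)

Section LpComplete.
Context {R : realType} {c : bool} {X : completeNormedModType (scal R c)}.
Context {d : measure_display} {Omega : measurableType d}.
Variable P : probability Omega R.
Variable p : R.
Hypothesis p1 : 1 < p.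
Implicit Types (f g : Omega -> X).

Let p0 : 0 < p. Proof. exact: lt_trans ltr01 p1. Qed.

Lemma Lpn_triangle f g h e e' : in_Lp P p f -> in_Lp P p g -> in_Lp P p h ->
  (Lpn P p (fun w => (f w - g w)%R) <= e%:E)%E ->
  (Lpn P p (fun w => (g w - h w)%R) <= e'%:E)%E ->
  (Lpn P p (fun w => (f w - h w)%R) <= (e + e')%:E)%E.
Proof.
move=> lf lg lh fg gh.
have lfg := in_LpB p1 lf lg; have lgh := in_LpB p1 lg lh.
have := LpnD P p1 lfg.1 lgh.1.
rewrite (_ : (fun w => _) = fun w => f w - h w); last by apply/funext => w; rewrite subrKA.
by move=> /le_trans; apply; rewrite EFinD leeD.
Qed.

Lemma Lpn_fatou (u : nat -> Omega -> X) g (e : R) : 0 <= e ->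
  (forall j, strongly_measurable_wrt measurable (u j)) ->
  (forall w, (fun j => u j w) @ \oo --> g w) ->
  (forall j, (Lpn P p (u j) <= e%:E)%E) -> (Lpn P p g <= e%:E)%E.
Proof.
move=> e0 su ug ue; rewrite Lpn_le_pow//.
have limE w : limn_einf (fun j => ((rnorm (u j w)) `^ p)%:E) = ((rnorm (g w)) `^ p)%:E.
  apply: (cvg_limn_einf_sup _).1; apply: cvg_EFin; first exact: nearW.
  apply/cvgrPdist_lt => a a0.
  have [b b0 hb] := powR_continuous_ge0 p1 (rnorm_ge0 (g w)) a0.
  have /cvg_rnormP/cvgrPdist_lt/(_ _ b0) := ug w; apply: filterS => j.
  rewrite sub0r normrN ger0_norm ?rnorm_ge0// => ujw; rewrite distrC; apply: hb.
    exact: rnorm_ge0.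
  exact: le_lt_trans (rnorm_dist _ _) ujw.
under eq_integral do rewrite -limE.
apply: le_trans (fatou P measurableT _ _) _.
- by move=> j; exact: measurable_rnorm_pow.
- by move=> j w _; rewrite lee_fin powR_ge0.
rewrite limn_einf_lim; apply: lime_le; first exact: is_cvg_einfs.
apply: nearW => n; apply: (@le_trans _ _ (\int[P]_w ((rnorm (u n w)) `^ p)%:E)%E).
  by apply: ereal_inf_lbound; exists n => /=.
by rewrite -Lpn_le_pow.
Qed.

(** L^1 norms are at most L^p norms, so the series of the norms has integral at most [B] and is
    finite almost everywhere. *)
Lemma summable_off_null (s : nat -> Omega -> X) (b : nat -> R) (B : R) :
  (forall k, simple_fun measurable (s k)) ->
  (forall k, (Lpn P p (fun w => (s k.+1 w - s k w)%R) <= (b k)%:E)%E) ->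
  (forall n, \sum_(0 <= k < n) b k <= B) ->
  exists Z, [/\ measurable Z, P Z = 0%E & forall w, ~ Z w ->
    (\sum_(0 <= k <oo) (rnorm (s k.+1 w - s k w))%:E < +oo)%E].
Proof.
move=> ss sb bB.
pose v k w := (rnorm (s k.+1 w - s k w))%:E.
have sd k : simple_fun measurable (fun w => s k.+1 w - s k w).
  exact: (simple_op2 (@sigma_algebra_measurable _ Omega) (fun x y => x - y) (ss k.+1) (ss k)).
have mv k : measurable_fun setT (v k).
  by apply/measurable_EFinP; exact: (simple_fun_measurable (@rnorm R c X) (sd k)).
have v0 k w : (0 <= v k w)%E by rewrite lee_fin rnorm_ge0.
pose V w := (\sum_(0 <= k <oo) v k w)%E.
have mV : measurable_fun setT V.
  apply: (@ge0_emeasurable_sum _ _ _ setT v xpredT) => [k w _ _|k _]; first exact: v0.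
  exact: mv.
have V0 w : (0 <= V w)%E by apply: nneseries_ge0 => k _ _; exact: v0.
have iV : P.-integrable setT V.
  apply/integrableP; split => //.
  under eq_integral do rewrite gee0_abs//.
  rewrite integral_nneseries//; apply: (@le_lt_trans _ _ B%:E); last exact: ltry.
  apply: lime_le; first by apply: is_cvg_nneseries => k _ _; exact: integral_ge0.
  apply: nearW => n; apply: (@le_trans _ _ (\sum_(0 <= k < n) (b k)%:E)%E).
    apply: lee_sum => k _; apply: le_trans (sb k).
    by apply: integral_rnorm_le => //; exact: strongly_measurable_simple.
  by rewrite sumEFin lee_fin bB.
have [Z [mZ Z0 hZ]] := integrable_ae measurableT iV.
exists Z; split => // w nZw; rewrite -[ltLHS]/(V w) -ge0_fin_numE//.
by apply: contrapT => h; apply: nZw; apply: hZ => /= /(_ I).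
Qed.

Lemma rnorm_summable_cvg (x : nat -> X) :
  (\sum_(0 <= k <oo) (rnorm (x k.+1 - x k))%:E < +oo)%E -> exists l : X, x @ \oo --> l.
Proof.
move=> sfin; pose S n := \sum_(0 <= k < n) rnorm (x k.+1 - x k).
have SS n : S n.+1 = S n + rnorm (x n.+1 - x n) by rewrite /S big_nat_recr.
have ndS : {homo S : m n / (m <= n)%N >-> m <= n}.
  by apply/nondecreasing_seqP => n; rewrite SS lerDl rnorm_ge0.
have : cvgn S.
  apply: nondecreasing_is_cvgn => //.
  exists (fine (\sum_(0 <= k <oo) (rnorm (x k.+1 - x k))%:E)) => _ [n _ <-].
  rewrite -lee_fin fineK; last first.
    by rewrite ge0_fin_numE// nneseries_ge0// => k _ _; rewrite lee_fin rnorm_ge0.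
  rewrite -sumEFin; apply: nneseries_lim_ge => k _.
  by rewrite lee_fin rnorm_ge0.
move=> cS; have Sle n : S n <= limn S by exact: nondecreasing_cvgn_le.
have xS m n : (m <= n)%N -> rnorm (x n - x m) <= S n - S m.
  move=> /subnK <-; elim: (n - m)%N => [|k ih]; first by rewrite !subrr rnorm0.
  rewrite addSn -(subrKA (x (k + m)%N)) (le_trans (rnormD _ _))//.
  by rewrite SS; move: ih; lra.
apply: rnorm_cauchy_cvg => e e0.
have /cvgrPdist_lt/(_ _ e0)[N _ hN] := cS.
have close n : (N <= n)%N -> limn S - e < S n.
  by move=> /hN; rewrite /= ltr_distl => /andP[]; lra.
exists N => n m Nn Nm; have [mn|/ltnW nm] := leqP m n.
  by apply: le_lt_trans (xS _ _ mn) _; have := close _ Nm; have := Sle n; lra.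
rewrite rnormBC; apply: le_lt_trans (xS _ _ nm) _.
by have := close _ Nn; have := Sle m; lra.
Qed.

(** Strong measurability asks for simple functions converging at every point. Hence the fast
    subsequence is replaced by simple functions [s k] within [2 ^- k] of it, and these are set to 0
    on the exceptional null set. The limit [g] is then strongly measurable by construction, and
    Fatou's lemma yields convergence in L^p. *)
Lemma Lp_complete (u : nat -> Omega -> X) : (forall n, in_Lp P p (u n)) ->
  (forall e, 0 < e -> exists N : nat, forall n m, (N <= n)%N -> (N <= m)%N ->
     (Lpn P p (fun w => (u n w - u m w)%R) <= e%:E)%E) ->
  exists g, Lp_limit P p u g.
Proof.
move=> lu cu; have pw k : (0 : R) < 2 ^- k by rewrite invr_gt0 exprn_gt0.
have [N hN] := choice (fun k => cu _ (pw k)).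
have step k : exists s, simple_fun measurable s /\
    (Lpn P p (fun w => (s w - u (N k) w)%R) <= (2 ^- k)%:E)%E.
  have [s s1 s2] := Lp_approx p1 (@sigma_algebra_measurable _ Omega) (@subset_refl _ _)
    (lu (N k)).1 (lu (N k)) (pw k).
  by exists s.
have [s hs] := choice step.
have ss k : simple_fun measurable (s k) by case: (hs k).
have sd k : (Lpn P p (fun w => (s k w - u (N k) w)%R) <= (2 ^- k)%:E)%E by case: (hs k).
have ls k : in_Lp P p (s k) by exact: (simple_in_Lp P p1 (@subset_refl _ _) (ss k)).
have su k m : (N k <= m)%N -> (Lpn P p (fun w => (s k w - u m w)%R) <= (2 ^- k + 2 ^- k)%:E)%E.
  by move=> km; apply: (Lpn_triangle (g := u (N k))) => //; exact: hN.
have sjk j k : (Lpn P p (fun w => (s j w - s k w)%R) <=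
    (2 ^- j + 2 ^- j + (2 ^- k + 2 ^- k))%:E)%E.
  apply: (Lpn_triangle (g := u (maxn (N j) (N k)))) => //.
    by apply: su; exact: leq_maxl.
  by rewrite LpnBC; apply: su; exact: leq_maxr.
have half k : (2 ^- k.+1 + 2 ^- k.+1 : R) = 2 ^- k by rewrite exprS invfM; field.
have [Z [mZ PZ hZ]] : exists Z, [/\ measurable Z, P Z = 0%E & forall w, ~ Z w ->
    (\sum_(0 <= k <oo) (rnorm (s k.+1 w - s k w))%:E < +oo)%E].
  (* Consecutive distances are at most twice [2 ^- k] plus twice [2 ^- k.+1], that is [3 * 2 ^- k],
     with sum 6. *)
  apply: (summable_off_null (b := fun k => 3 * 2 ^- k) (B := 6)) => // [k|n].
    apply: le_trans (sjk _ _) _; rewrite lee_fin half; lra.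
  suff -> : \sum_(0 <= k < n) 3 * 2 ^- k = 6 - 6 * 2 ^- n :> R by have := pw n; lra.
  elim: n => [|n ih]; first by rewrite big_geq// expr0 invr1; lra.
  by rewrite big_nat_recr//= ih -half; lra.
pose t k w := if `[< Z w >] then 0 else s k w.
have st k : simple_fun measurable (t k).
  apply: (simple_if (@sigma_algebra_measurable _ Omega)) => //.
  exact: (simple_cst (@sigma_algebra_measurable _ Omega)).
have tm k := strongly_measurable_simple (st k).
have lt k : in_Lp P p (t k) by exact: (simple_in_Lp P p1 (@subset_refl _ _) (st k)).
have tcvg w : exists l : X, (fun k => t k w) @ \oo --> l.
  rewrite /t; case: asboolP => [_|/hZ/rnorm_summable_cvg//]; exists 0; exact: cvg_cst.
have [g tg] := choice tcvg.
have sg : strongly_measurable_wrt measurable g by exists t.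
have tst k : (Lpn P p (fun w => (s k w - t k w)%R) <= 0%:E)%E.
  rewrite Lpn_le_pow// powR0 ?gt_eqF//.
  rewrite (ae_eq_integral (cst 0%E)) ?integral0//.
    apply: measurable_rnorm_pow; apply: (strongly_measurableB (@sigma_algebra_measurable _ Omega)).
      by case: (ls k).
    exact: tm.
  exists Z; split => // w /= h; apply: contrapT => nZ; apply: h => _.
  rewrite /t; case: asboolP => // _; rewrite subrr rnorm0 powR0// gt_eqF//.
have tjk j k : (k <= j)%N -> (Lpn P p (fun w => (t k w - t j w)%R) <= (4 * 2 ^- k)%:E)%E.
  move=> kj; apply: (@le_trans _ _ (Lpn P p (fun w => (s k w - s j w)%R))).
    apply: Lpn_le => //.
    - by have [] := in_LpB p1 (lt k) (lt j).
    - by have [] := in_LpB p1 (ls k) (ls j).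
    - by move=> w; rewrite /t; case: asboolP => // _; rewrite subrr rnorm0 rnorm_ge0.
  apply: le_trans (sjk _ _) _; rewrite lee_fin.
  have : 2 ^- j <= 2 ^- k :> R by rewrite lef_pV2 ?posrE ?exprn_gt0// ler_eXn2l// ltr1n.
  lra.
have tgk k : (Lpn P p (fun w => (t k w - g w)%R) <= (4 * 2 ^- k)%:E)%E.
  apply: (@Lpn_fatou (fun j w => t k w - t (j + k)%N w)).
  - by rewrite mulr_ge0// ltW.
  - by move=> j; have [] := in_LpB p1 (lt k) (lt (j + k)%N).
  - move=> w; apply: cvgB; first exact: cvg_cst.
    by have := tg w; rewrite -(cvg_shiftn k).
  - by move=> j; apply: tjk; exact: leq_addl.
have lg : in_Lp P p g.
  split => //; rewrite (_ : g = fun w => t 0%N w - (t 0%N w - g w)); last first.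
    by apply/funext => w; rewrite subKr.
  have := LpnB P p1 (tm 0%N) (strongly_measurableB (@sigma_algebra_measurable _ Omega) (tm 0%N) sg).
  move=> /le_lt_trans; apply; apply: lte_add_pinfty; first by case: (lt 0%N).
  exact: le_lt_trans (tgk 0%N) (ltry _).
exists g; split => //; apply: cvge0P => [n|e e0]; first exact: Lpn_ge0.
(* Two units of [2 ^- k] lead from [u n] to [s k], none from [s k] to [t k], four from [t k] to
   [g]. *)
have [k hk] : exists k, 6 * 2 ^- k < e.
  exists (Num.truncn (6 / e)).+1; rewrite ltr_pdivrMr ?exprn_gt0// mulrC -ltr_pdivrMr//.
  by apply: (lt_trans (truncnS_gt _)); rewrite -natrX ltr_nat ltn_expl.
exists (N k) => // n /= kn.
have e1 := Lpn_triangle (lu n) (ls k) (lt k) _ (tst k).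
have e2 := Lpn_triangle (lu n) (lt k) lg (e1 _ _) (tgk k).
apply: le_trans (e2 _ _) _; first by rewrite LpnBC; exact: su.
rewrite lee_fin; move: hk; lra.
Qed.

End LpComplete.

(** * The operator norm from the UMD inequality *)

Section CoinSymmetry.
Context {R : realType} {d : measure_display} {Omega : measurableType d}.
Variable P : probability Omega R.

Lemma integral_eq_law (u v : Omega -> R) :
  P.-integrable setT (EFin \o u) -> P.-integrable setT (EFin \o v) ->
  (forall D, measurable D -> P (u @^-1` D) = P (v @^-1` D)) ->
  (\int[P]_w (u w)%:E = \int[P]_w (v w)%:E)%E.
Proof.
move=> iu iv uv.
have mu : measurable_fun setT u by apply/measurable_EFinP; exact: measurable_int iu.
have mv : measurable_fun setT v by apply/measurable_EFinP; exact: measurable_int iv.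
have e1 := @integral_pushforward _ _ _ _ R u mu P setT EFin (@EFin_measurable R setT) iu measurableT.
have e2 := @integral_pushforward _ _ _ _ R v mv P setT EFin (@EFin_measurable R setT) iv measurableT.
rewrite preimage_setT in e1; rewrite preimage_setT in e2.
rewrite -[LHS]e1 -[RHS]e2; apply: eq_measure_integral => D mD _; exact: uv.
Qed.

(* Both sides are the integral of the identity with respect to the law of f
   restricted to S and to its complement, and these two laws coincide. *)
Lemma integral_indep_half (S B : set Omega) (f : Omega -> R) (G : set (set Omega)) :
  sigma_algebra setT G -> G `<=` measurable -> measurable S ->
  (forall C, G C -> prob P (S `&` C) = prob P (~` S `&` C)) ->
  (forall D, measurable D -> G (f @^-1` D)) -> P.-integrable setT (EFin \o f) -> G B ->
  \int[P]_(w in S `&` B) f w = \int[P]_(w in ~` S `&` B) f w.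
Proof.
move=> sG Gm mS hS mf intf GB; have mB := Gm _ GB.
have mSB : measurable (S `&` B) by exact: measurableI.
have mCB : measurable (~` S `&` B) by apply: measurableI => //; exact: measurableC.
have mft : measurable_fun setT f by move=> _ D mD; rewrite setTI; apply: Gm; exact: mf.
rewrite Rintegral_mkcond [RHS]Rintegral_mkcond /Rintegral; congr fine.
have intE E : measurable E -> P.-integrable setT (EFin \o (f \_ E)).
  move=> mE; apply: (@le_integrable _ _ _ P setT measurableT _ (EFin \o f)) => //.
    apply/measurable_EFinP/(measurable_restrictT f mE); exact: measurable_funTS.
  by move=> w _ /=; rewrite lee_fin patchE; case: ifP => // _; rewrite normr0.
apply: integral_eq_law; [exact: intE|exact: intE|move=> D mD].
have preE E : measurable E -> P ((f \_ E) @^-1` D) =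
    (prob P (f @^-1` D `&` E) + (if `[< D 0 >] then 1 - prob P E else 0))%:E.
  move=> mE.
  have mfD : measurable (f @^-1` D) by apply: Gm; exact: mf.
  have -> : (f \_ E) @^-1` D = (f @^-1` D `&` E) `|` (if `[< D 0 >] then ~` E else set0).
    rewrite predeqE => w; rewrite /preimage/= patchE.
    case: asboolP => D0; have [wE|nE] := boolP (w \in E).
    - have Ew := set_mem wE; split => [?|[[]//|]]; [by left|by []].
    - by split => // _; right; apply: contraNP nE => nnE; apply/mem_set; apply: contrapT.
    - have Ew := set_mem wE; split => [?|[[]//|]//]; by left.
    - split => // -[[_ Ew]|//]; by move: nE; rewrite mem_set.
  rewrite measureU//; last 3 first.
  - exact: measurableI.
  - by case: asboolP => // _; exact: measurableC.
  - by rewrite -subset0 => w [[_ Ew]]; case: asboolP.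
  rewrite EFinD; congr (_ + _)%E; first by rewrite probE//; exact: measurableI.
  case: asboolP => _; last by rewrite measure0.
  by rewrite EFinB probE//; exact: probability_setC.
rewrite !preE//; congr (_ + _)%:E.
  have GfB : G (f @^-1` D `&` B) by apply: (sigma_algI sG) => //; exact: mf.
  by rewrite setICA [in RHS]setICA; exact: hS.
by rewrite hS.
Qed.

End CoinSymmetry.

(** * Transforms of a martingale under the UMD inequality *)

Section UpperBound.
Context {R : realType} {c : bool} {X : completeNormedModType (scal R c)}.
Local Notation K := (scal R c).
Context {d : measure_display} {Omega : measurableType d}.
Variable P : probability Omega R.
Variables (F : nat -> set (set Omega)) (S : nat -> set Omega) (p b : R).
Variables (a : nat -> K) (A : set K).
Hypothesis p1 : 1 < p.
Hypothesis hF : is_filtration F.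
Hypothesis hS : fair_coins P F S.
Hypothesis aA : forall n, A (a n).
Hypothesis b0 : 0 <= b.
Hypothesis hb : UMD_A_ineq (X := X) p A b.

Let sF n : sigma_algebra setT (F n). Proof. by case: hF. Qed.
Let Fm n : F n `<=` measurable. Proof. by case: hF => _ h _; exact: h. Qed.
Let Fle n m : (n <= m)%N -> F n `<=` F m. Proof. by case: hF => _ _; apply. Qed.

Variable f : nat -> Omega -> X.
Hypothesis hf : Lp_martingale P F p f.

Let lf n : in_Lp P p (f n). Proof. by case: (hf.1 n). Qed.
Let sf n : strongly_measurable_wrt (F n) (f n). Proof. by case: (hf.1 n). Qed.

Let df n w := f n.+1 w - f n w.

Let ldf n : in_Lp P p (df n). Proof. exact: in_LpB. Qed.

Let sdf n : strongly_measurable_wrt (F n.+1) (df n).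
Proof.
apply: (strongly_measurableB (sF n.+1)) => //.
by apply: strongly_measurable_sub (sf n); exact: Fle.
Qed.

Let intB g psi B : in_Lp P p g -> real_functional psi -> measurable B ->
  P.-integrable B (EFin \o (fun w => psi (g w : X))).
Proof. by move=> lg hpsi mB; apply: integrableS (integrable_functional p1 lg hpsi). Qed.

Lemma martingale_diff_mean0 n psi B : real_functional psi -> F n B ->
  \int[P]_(w in B) psi (df n w) = 0.
Proof.
move=> hpsi FB; have mB := Fm FB.
have := hf.2 n.+1 isT psi hpsi B FB; rewrite /= !EFin_Rintegral//; try exact: intB.
move=> [e]; rewrite (_ : \int[P]_(w in B) _ =
    \int[P]_(w in B) (psi (f n.+1 w) - psi (f n w))); last first.
  by apply: eq_Rintegral => w _; exact: real_functionalB.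
by rewrite RintegralB ?e ?subrr//; exact: intB.
Qed.

(** In an increment the term with [f 0] cancels, so the UMD inequality applies directly to the
    differences after time [m], for the filtration shifted by [m]. *)
Lemma TA_increment_bound m n :
  (Lpn P p (fun w => (TA a f (m + n) w - TA a f m w)%R) <=
   b%:E * Lpn P p (fun w => (f (m + n)%N w - f m w)%R))%E.
Proof.
have hmds : Lp_mds P (fun k => F (m + k)) p (fun i => df (m + i.-1)) n.
  split; first by split; [move=> k|move=> k; exact: Fm|move=> k l kl; apply: Fle; rewrite leq_add2l].
  move=> [//|i] _ /=; split => //; first by rewrite addnS.
  move=> psi hpsi B FB; rewrite EFin_Rintegral ?martingale_diff_mean0//.
  - exact: Fm FB.
  - by apply: intB => //; exact: Fm FB.
have := hb hmds (fun i _ => aA (m + i)).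
rewrite (_ : (fun w => _) = fun w => TA a f (m + n) w - TA a f m w); last first.
  apply/funext => w; rewrite /TA opprD addrACA subrr add0r.
  rewrite [in RHS](@big_cat_nat _ _ _ m.+1)//= ?ltnS ?leq_addr// [RHS]addrAC subrr add0r.
  rewrite -[in RHS](add1n m) big_addn (_ : ((m + n).+1 - m = n.+1)%N); last first.
    by rewrite -addnS addKn.
  apply: eq_big_nat => -[//|i] _.
  by rewrite /df addSn addnS (addnC i).
rewrite (_ : (fun w => \sum_(1 <= _ < _) _) = fun w => f (m + n)%N w - f m w)//.
apply/funext => w; rewrite big_add1/= (telescope_sumr_eq (fun i => f (m + i)%N w))//.
  by rewrite addn0.
by move=> i _; rewrite /df addnS.
Qed.

(* f 0 is not a martingale difference, but it becomes one after multiplying the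
   whole martingale by the sign of a coin tossed after time N. *)
Lemma TA_bound N : (Lpn P p (TA a f N) <= b%:E * Lpn P p (f N))%E.
Proof.
have [FS hSB] := hS (ltn0Sn N); set Sg := S N.+1 in FS hSB.
have mS := Fm FS.
have hhalf k B : (k <= N)%N -> F k B -> prob P (Sg `&` B) = prob P (~` Sg `&` B).
  by move=> kN FB; have [-> ->] := hSB _ (Fle kN FB).
pose tr (E : set Omega) k := [set H | exists2 B, F k B & H `&` E = B `&` E].
have str E k : sigma_algebra setT (tr E k).
  split.
  - by exists set0 => //; exact: sigma_alg0 (sF k).
  - move=> H [B FB HB]; exists (~` B); first exact: (sigma_algC (sF k)).
    rewrite setTD predeqE => w; have /(congr1 (fun Z => Z w)) /= e := HB.
    by split => -[nH Ew]; split => // h; apply: nH;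
      [have : (H `&` E) w by rewrite HB|have : (B `&` E) w by rewrite -HB]; case.
  - move=> H /(_ _)/cid2 hH; pose B i := s2val (hH i).
    exists (\bigcup_i B i).
      by case: (sF k) => _ _; apply => i; exact: (s2valP (hH i)).
    rewrite !setI_bigcupl; apply: eq_bigcupr => i _; exact: (s2valP' (hH i)).
pose Gs k := if k is k'.+1 then tr Sg k' `&` tr (~` Sg) k' else F 0%N.
have subtr E k : F k `<=` tr E k by move=> B FB; exists B.
have hG : is_filtration Gs.
  split.
  - move=> [|k]; first exact: sF.
    have s1 := str Sg k; have s2 := str (~` Sg) k; split.
    + by split; exact: sigma_alg0.
    + by move=> H [h1 h2]; split; rewrite setTD; exact: sigma_algC.
    + move=> H hH; split; [case: s1 => _ _ h|case: s2 => _ _ h]; by apply: h => i; case: (hH i).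
  - move=> [|k]; first exact: Fm.
    move=> H [[B1 FB1 e1] [B2 FB2 e2]].
    rewrite -(setIT H) -(setUv Sg) setIUr e1 e2.
    by apply: measurableU; apply: measurableI => //;
      [exact: Fm FB1|exact: Fm FB2|exact: measurableC].
  - move=> [|k] [|l] kl; [exact: subset_refl| |by []|].
    + by move=> B FB; split; apply: subtr; apply: Fle FB.
    + move=> H [[B1 FB1 e1] [B2 FB2 e2]]; split; [exists B1|exists B2] => //.
        by apply: Fle FB1.
      by apply: Fle FB2.
pose sgn (g : Omega -> X) w := if `[< Sg w >] then g w else - g w.
have rsgn g w : rnorm (sgn g w) = rnorm (g w).
  by rewrite /sgn; case: asboolP => // _; rewrite rnormN.
have GsS k : Gs k.+1 Sg.
  split; first by exists setT; [exact: (sigma_algT (sF k))|rewrite setIid setTI].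
  by exists set0; [exact: (sigma_alg0 (sF k))|rewrite setICr set0I].
have sGs k : sigma_algebra setT (Gs k) by case: hG.
have Gsm k : Gs k `<=` measurable by case: hG.
have ssgn k g : strongly_measurable_wrt (F k) g -> strongly_measurable_wrt (Gs k.+1) (sgn g).
  move=> sg; have sg' : strongly_measurable_wrt (Gs k.+1) g.
    by apply: strongly_measurable_sub sg => B FB; split; exact: subtr.
  apply: (strongly_measurable_if (sGs k.+1)) => //.
  have := strongly_measurableZ (sGs k.+1) (-1) sg'.
  by under eq_fun do rewrite scaleN1r.
have lsgn k g : strongly_measurable_wrt (F k) g -> in_Lp P p g -> in_Lp P p (sgn g).
  move=> sg [_ lg]; split.
    by apply: (strongly_measurable_sub (@Gsm k.+1)); exact: ssgn.
  by rewrite (eq_Lpn P p (rsgn g)).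
have sgn_int k g psi H B1 B2 : real_functional psi -> in_Lp P p g ->
    strongly_measurable_wrt (F k) g -> measurable H ->
    Sg `&` H = Sg `&` B1 -> ~` Sg `&` H = ~` Sg `&` B2 ->
    \int[P]_(w in H) psi (sgn g w) =
    \int[P]_(w in Sg `&` B1) psi (g w) - \int[P]_(w in ~` Sg `&` B2) psi (g w).
  move=> hpsi lg sg mH e1 e2.
  have mCH : measurable (~` Sg `&` H) by apply: measurableI => //; exact: measurableC.
  rewrite (Rintegral_split mS mH); last exact: (intB (lsgn k g sg lg)).
  rewrite -e1 -e2; congr (_ + _).
    by apply: eq_Rintegral => w; rewrite inE => -[Sw _]; rewrite /sgn; case: asboolP.
  transitivity (\int[P]_(w in ~` Sg `&` H) (- 1 * psi (g w))).
    apply: eq_Rintegral => w; rewrite inE => -[Sw _]; rewrite /sgn; case: asboolP => // _.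
    by rewrite real_functionalN// mulN1r.
  by rewrite RintegralZl// ?mulN1r//; exact: intB.
(* The coin of time [N.+1] is independent of [F k], so both faces give equal integrals; for [f 0]
   the sign makes them cancel. *)
have half_int k (g : Omega -> X) psi B : (k <= N)%N -> real_functional psi -> in_Lp P p g ->
    strongly_measurable_wrt (F k) g -> F k B ->
    \int[P]_(w in Sg `&` B) psi (g w) = \int[P]_(w in ~` Sg `&` B) psi (g w).
  move=> kN hpsi lg sg FB.
  apply: (integral_indep_half (G := F k)) => //.
  - by move=> C FC; exact: (hhalf k).
  - by move=> D mD; exact: (strongly_measurable_comp (sF k) hpsi.2 sg).
  - exact: (integrable_functional p1 lg hpsi).
pose dd i := if i is k.+2 then sgn (df k) else sgn (f 0%N).
have hmds : Lp_mds P Gs p dd N.+1.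
  split => // -[//|[|k]] /andP[_ kN] /=.
  - split; [exact: lsgn _ _ (sf 0) (lf 0)|exact: ssgn|move=> psi hpsi B FB].
    have mB := Fm FB.
    rewrite EFin_Rintegral//; last exact: (intB (lsgn _ _ (sf 0) (lf 0))).
    rewrite (@sgn_int 0%N _ _ _ B B)//; congr (_%:E).
    by rewrite (half_int 0%N (f 0%N) psi B)// subrr.
  - split; [exact: lsgn _ _ (sdf k) (ldf k)|exact: ssgn|move=> psi hpsi H HG].
    have mH := Gsm k.+1 _ HG; have [[B1 FB1 e1] [B2 FB2 e2]] := HG.
    rewrite EFin_Rintegral//; last exact: (intB (lsgn _ _ (sdf k) (ldf k))).
    have zero B : F k B -> \int[P]_(w in Sg `&` B) psi (df k w) = 0 /\
        \int[P]_(w in ~` Sg `&` B) psi (df k w) = 0.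
      move=> FB; have FB' := Fle (leqnSn k) FB.
      have e := half_int k.+1 (df k) psi B kN hpsi (ldf k) (sdf k) FB'.
      have := martingale_diff_mean0 hpsi FB; rewrite (Rintegral_split mS (Fm FB)); last exact: (intB (ldf k) hpsi (Fm FB)).
      rewrite e => h; split; lra.
    rewrite (@sgn_int k.+1 _ _ _ B1 B2)//.
    + by rewrite (zero _ FB1).1 (zero _ FB2).2 subrr.
    + by rewrite setIC e1 setIC.
    + by rewrite setIC e2 setIC.
have sgnE (w : Omega) : exists2 e : K, (e = 1 \/ e = -1) & forall g, sgn g w = e *: g w.
  rewrite /sgn; case: asboolP => _; [exists 1|exists (-1)]; rewrite ?scale1r//; [by left| |by right|].
    by move=> g; rewrite scale1r.
  by move=> g; rewrite scaleN1r.
have fE k w : f k w = f 0%N w + \sum_(0 <= i < k) df i w.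
  by rewrite telescope_sumr// addrC subrK.
have re (e : K) (x : X) : e = 1 \/ e = -1 -> rnorm (e *: x) = rnorm x.
  by case=> ->; rewrite rnormZ /snorm ?normrN normr1 -(real_scal1 c) re_scalK mul1r.
have <- : Lpn P p (fun w => \sum_(1 <= n < N.+2) a n.-1 *: dd n w) = Lpn P p (TA a f N).
  apply: eq_Lpn => w; have [e e1 he] := sgnE w; rewrite -[RHS](re e)//; congr rnorm.
  rewrite big_ltn//= he /TA scalerDr !scalerA mulrC; congr (_ + _).
  rewrite big_add1/= scaler_sumr; apply: eq_big_nat => -[//|i] _ /=.
  by rewrite he !scalerA mulrC.
have <- : Lpn P p (fun w => \sum_(1 <= n < N.+2) dd n w) = Lpn P p (f N).
  apply: eq_Lpn => w; have [e e1 he] := sgnE w; rewrite -[RHS](re e)//; congr rnorm.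
  rewrite big_ltn//= he (fE N) scalerDr; congr (_ + _).
  by rewrite !big_add1/= scaler_sumr; apply: eq_bigr => i _; rewrite he.
exact: (hb hmds (fun i _ => aA i.-1)).
Qed.

Lemma TA_martingale : Lp_martingale P F p (TA a f).
Proof.
split=> [n|[//|n] _ psi hpsi B FB].
  have l i : in_Lp P p (fun w => f i w - f i.-1 w) by exact: in_LpB.
  split.
    apply: (in_LpD p1); first exact: in_LpZ.
    by apply: (in_Lp_sum p1) => i _; exact: in_LpZ.
  apply: (strongly_measurableD (sF n)).
    apply: (strongly_measurableZ (sF n)); apply: strongly_measurable_sub (sf 0).
    exact: Fle.
  apply: (strongly_measurable_sum (sF n)) => i; rewrite mem_index_iota ltnS => /andP[i0 il].
  apply: (strongly_measurableZ (sF n)); apply: (strongly_measurableB (sF n)).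
    by apply: strongly_measurable_sub (sf i); exact: Fle.
  by apply: strongly_measurable_sub (sf i.-1); apply: Fle; rewrite (leq_trans (leq_pred _)).
have lTA k : in_Lp P p (TA a f k).
  apply: (in_LpD p1); first exact: in_LpZ.
  by apply: (in_Lp_sum p1) => i _; apply: in_LpZ => //; exact: in_LpB.
have mB := Fm FB; rewrite /= !EFin_Rintegral//; try exact: intB.
congr (_%:E); rewrite (_ : \int[P]_(w in B) psi (TA a f n.+1 w) =
    \int[P]_(w in B) (psi (TA a f n w) + psi (a n.+1 *: df n w))); last first.
  apply: eq_Rintegral => w _; rewrite -hpsi.1; congr psi.
  by rewrite /TA big_nat_recr//= addrA.
rewrite RintegralD//; [|exact: intB|exact: (intB (ldf n) (real_functionalZ (a n.+1) hpsi))].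
by rewrite (martingale_diff_mean0 (real_functionalZ (a n.+1) hpsi) FB) addr0.
Qed.

Lemma TA_limit g : Lp_limit P p f g -> exists h, Lp_limit P p (TA a f) h.
Proof.
move=> [lg fg]; apply: (Lp_complete p1) => [n|e e0]; first by case: (TA_martingale.1 n).
(* Two distances to the limit, multiplied by [b], stay below [e]; [b + 1] allows [b = 0]. *)
have d0 : 0 < e / (b + 1) / 2 by rewrite !divr_gt0// ltr_wpDl.
have [N _ hN] := cvge0_lt fg d0.
exists N; suff H n m : (N <= n)%N -> (n <= m)%N ->
    (Lpn P p (fun w => (TA a f m w - TA a f n w)%R) <= e%:E)%E.
  move=> n m Nn Nm; have [nm|/ltnW mn] := leqP n m; last exact: H.
  by rewrite LpnBC; exact: H.
move=> Nn /subnKC nm; rewrite -nm; apply: le_trans (TA_increment_bound _ _) _; rewrite nm.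
have h1 := ltW (hN n Nn); have h2 := ltW (hN m (leq_trans Nn (leq_trans (leq_addr _ _) (eq_leq nm)))).
rewrite LpnBC in h1; have := Lpn_triangle p1 (lf m) lg (lf n) h2 h1 => h3.
apply: (@le_trans _ _ (b%:E * (e / (b + 1) / 2 + e / (b + 1) / 2)%:E)%E).
  by rewrite lee_wpmul2l.
rewrite -EFinM lee_fin -splitr mulrCA ger_pMr// ler_pdivrMr ?mul1r ?lerDl// ltr_wpDl//.
Qed.

Lemma TA_limit_bound g h : Lp_limit P p f g -> (Lpn P p g <= 1)%E ->
  Lp_limit P p (TA a f) h -> (Lpn P p h <= b%:E)%E.
Proof.
move=> [lg fg] g1 [lh Th]; rewrite -(fineK (Lpn_fin_num lh)) lee_fin.
have {}g1 : fine (Lpn P p g) <= 1 by rewrite -lee_fin fineK// Lpn_fin_num.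
apply/ler_addgt0Pl => e e0.
have b1 : 0 < b + 1 by rewrite ltr_wpDl.
(* This error occurs [b] times through the norm of [f n] and once through that of [TA a f n], in
   total [e]. *)
have d0 : 0 < e / (b + 1) by rewrite divr_gt0.
have [N1 _ h1] := cvge0_lt fg d0; have [N2 _ h2] := cvge0_lt Th d0.
pose n := maxn N1 N2.
have lT : in_Lp P p (TA a f n) by case: (TA_martingale.1 n).
have {}h1 := h1 n (leq_maxl _ _); have {}h2 := h2 n (leq_maxr _ _).
have t1 := Lpn_dist p1 (lf n) lg; have t2 := Lpn_dist p1 lT lh.
have := TA_bound n.
move: h1 h2 => /=; rewrite -(fineK (Lpn_fin_num (in_LpB p1 (lf n) lg))).
rewrite -(fineK (Lpn_fin_num (in_LpB p1 lT lh))) !lte_fin => h1 h2.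
rewrite -(fineK (Lpn_fin_num lT)) -(fineK (Lpn_fin_num (lf n))) -EFinM lee_fin => h3.
move: t1 t2; rewrite !ler_norml => /andP[_ t1] /andP[t2 _].
have t4 : fine (Lpn P p (f n)) <= 1 + e / (b + 1) by lra.
have t5 := ler_wpM2l b0 t4.
have t6 : e = b * (e / (b + 1)) + e / (b + 1) by field; rewrite gt_eqF.
by move: t5; rewrite mulrDr mulr1; lra.
Qed.

End UpperBound.

(** * Equality of the two constants *)

(** The zero martingale contributes the value 0. This excludes a supremum of -oo and makes a finite
    operator norm an admissible UMD constant. *)
Lemma opnorm_TA_ge0 (R : realType) (c : bool) (X : normedModType (scal R c)) (p : R)
    (d : measure_display) (Omega : measurableType d) (P : probability Omega R)
    (F : nat -> set (set Omega)) (a : nat -> scal R c) :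
  1 < p -> is_filtration F -> (0 <= opnorm_TA (X := X) P F p a)%E.
Proof.
move=> p1 [sF _ _]; have l0 := in_Lp0 P p1 (X := X).
have lim (u : nat -> Omega -> X) : (forall n, u n = fun=> 0) -> Lp_limit P p u (fun=> 0).
  by move=> u0; apply: (Lp_limit_eventually (M := 0) p1 l0) => n _.
have z0 : Lp_limit P p (TA a (fun _ _ => 0 : X)) (fun=> 0).
  apply: lim => n; apply/funext => w; rewrite /TA scaler0 add0r big1// => i _.
  by rewrite subrr scaler0.
rewrite -(Lpn0 (c := c) (X := X) P p1); apply: ereal_sup_ubound.
exists (fun _ _ => 0); split; [split; last by exists (fun=> 0); exact: lim|].
- split => // n; split => //; exact: (strongly_measurable_cst (sF n)).
- split; first by exists (fun=> 0); split; [exact: lim|rewrite Lpn0].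
  by left; exists (fun=> 0).
Qed.

Theorem theorem3p4 (R : realType) (c : bool) (X : completeNormedModType (scal R c))
  (p : R) (A : set (scal R c))
  (d : measure_display) (Omega : measurableType d) (P : probability Omega R)
  (F : nat -> set (set Omega)) (r : nat -> Omega -> R) (a : nat -> scal R c) :
  1 < p ->
  closed A -> convex_set A -> bounded_scal_set A ->
  is_filtration F ->
  rademacher_adapted P F r ->
  (forall n, extreme_points A (a n)) ->
  (forall N : nat, extreme_points A `<=` closure [set a n | n in [set n | (N <= n)%N]]) ->
  opnorm_TA (X := X) P F p a = beta_A (X := X) p A.
Proof.
move=> p1 clA _ bA hF hr aE dens.
have aA n : A (a n) by case: (aE n).
apply/eqP; rewrite eq_le; apply/andP; split.
  apply: le_ereal_inf_tmp => _ [b [b0 hb] <-]; apply: ge_ereal_sup.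
  have coins := rademacher_fair_coins hF hr.
  move=> _ [f [[mf [g0 lim0]] [[g [lg g1]] [[h [lh ->]]|[nM ->]]]]].
    exact: (TA_limit_bound p1 hF coins aA b0 hb mf lg g1 lh).
  (* A finite UMD constant keeps [TA a f] in [Mdis], so the clause that assigns +oo never
     applies. *)
  exfalso; apply: nM; split; first exact: TA_martingale.
  exact: (TA_limit p1 hF aA b0 hb mf lim0).
have := opnorm_TA_ge0 X P a p1 hF.
case Co : (opnorm_TA (X := X) P F p a) => [C| |] // C0; last by rewrite leey.
apply: ereal_inf_lbound; exists C => //; split; first by rewrite -lee_fin.
by apply: (UMD_of_opnorm p1 clA bA hF hr dens) => //; rewrite ?Co ?lexx// -lee_fin.
Qed.
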